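(* Let $E\subset\mathbb{R}^d$ be a $W$-invariant compact convex set, let $x\in E$, and let $p$ be an integer with $p\geq\gamma+d/2+1$, where $\gamma>0$. Define $$f_x(y)=\frac{e^{-i(x,y)}}{(1+\Vert y\Vert^2)^p}\quad(y\in\mathbb{R}^d),\qquad F_x(t)=\int_{\mathbb{R}^d} f_x(y)\,K(iy,t)\,\omega_k(y)\,dy\quad(t\in\mathbb{R}^d).$$ Then the function $F_x:\mathbb{R}^d\to\mathbb{C}$ does not have compact support.
   Context: Let $d\geq 1$ and let $(\cdot,\cdot)$ be the standard inner product on $\mathbb{R}^d$, with norm $\Vert\cdot\Vert$, extended to a bilinear form on $\mathbb{C}^d$. Let $R\subset\mathbb{R}^d\setminus\{0\}$ be a (reduced, not necessarily crystallographic) root system, normalized so that $\Vert\alpha\Vert^2=2$ for all $\alpha\in R$, with positive subsystem $R_+$. For $\alpha\in R$ let $\sigma_\alpha$ be the orthogonal reflection in the hyperplane orthogonal to $\alpha$, and let $W$ be the finite reflection group generated by the $\sigma_\alpha$. Let $k:R\to[0,\infty)$ be a $W$-invariant function (multiplicity function). Put $$\gamma=\sum_{\alpha\in R_+}k(\alpha),\qquad \omega_k(y)=\prod_{\alpha\in R_+}|(\alpha,y)|^{2k(\alpha)}\quad(y\in\mathbb{R}^d).$$ It is assumed that $\gamma>0$. The Dunkl operators are, for $j=1,\dots,d$ and $f\in C^1(\mathbb{R}^d)$, $$T_jf(x)=\frac{\partial f}{\partial x_j}(x)+\sum_{\alpha\in R_+}k(\alpha)\,\alpha_j\,\frac{f(x)-f(\sigma_\alpha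 x)}{(\alpha,x)}.$$ For each $z\in\mathbb{C}^d$ there is a unique real-analytic function $u=K(\cdot,z)$ on $\mathbb{R}^d$ with $T_ju=z_ju$ for $j=1,\dots,d$ and $u(0)=1$. The function $K$ so defined is the Dunkl kernel; it extends to a holomorphic function on $\mathbb{C}^d\times\mathbb{C}^d$, which is symmetric: $K(z,w)=K(w,z)$. Under the stated assumption on $p$, the integral defining $F_x(t)$ converges absolutely and $F_x$ is a continuous function on $\mathbb{R}^d$. *)

(* Defs.v *)
From HB Require Import structures.
From mathcomp Require Import all_boot all_order all_algebra.
From mathcomp Require Import finmap complex.
From mathcomp Require Import all_classical all_reals all_analysis.

Set Implicit Arguments.
Unset Strict Implicit.
Unset Printing Implicit Defensive.

Import Order.TTheory GRing.Theory Num.Theory.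
Import numFieldNormedType.Exports.

Local Open Scope classical_set_scope.
Local Open Scope ring_scope.

(* Lebesgue measure on R^n, carried by n.-tuples: the image of
   (Lebesgue on R) \x (Lebesgue on R^n) under (a, t) |-> a :: t. *)

Definition cons_pair (R : realType) (n : nat)
    (u : measurableTypeR R * n.-tuple (measurableTypeR R)) :
    n.+1.-tuple (measurableTypeR R) :=
  [the n.+1.-tuple (measurableTypeR R) of u.1 :: u.2].

Lemma measurable_cons_pair (R : realType) (n : nat) :
  measurable_fun [set: measurableTypeR R * n.-tuple (measurableTypeR R)]
    (@cons_pair R n).
Proof.
apply: measurable_cons; [exact: measurable_fst|exact: measurable_snd].
Qed.

(* The sigma-finiteness of m1 \x m2 is shadowed in the library by the instance
   for subprobabilities, hence this restatement. *)
Lemma sigma_finite_product d1 d2 (T1 : measurableType d1)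
    (T2 : measurableType d2) (R : realType)
    (m1 : {sigma_finite_measure set T1 -> \bar R})
    (m2 : {sigma_finite_measure set T2 -> \bar R}) :
  sigma_finite setT (m1 \x m2)%E.
Proof.
have /sigma_finiteP[F [TF ndF Foo]] := sigma_finiteT m1.
have /sigma_finiteP[G [TG ndG Goo]] := sigma_finiteT m2.
exists (fun n => F n `*` G n).
  rewrite -setXTT TF TG predeqE => -[x y]; split.
    move=> [/= [n _ Fnx] [k _ Gky]]; exists (maxn n k) => //; split.
    - by move: x Fnx; exact/subsetPset/ndF/leq_maxl.
    - by move: y Gky; exact/subsetPset/ndG/leq_maxr.
  by move=> [n _ []/= ? ?]; split; exists n.
move=> k; have [mF Fk] := Foo k; have [mG Gk] := Goo k.
split; first exact: measurableX.
by rewrite product_measure1E// lte_mul_pinfty// ge0_fin_numE.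
Qed.

Lemma sigma_finite_pushforward_can d1 d2 (T1 : measurableType d1)
    (T2 : measurableType d2) (R : realType)
    (m : set T1 -> \bar R) (f : T1 -> T2) (g : T2 -> T1) :
  measurable_fun setT g -> cancel f g -> sigma_finite setT m ->
  sigma_finite setT (pushforward m f).
Proof.
move=> mg fK [F FT Foo].
exists (fun i => g @^-1` F i).
  by rewrite -preimage_bigcup -FT preimage_setT.
move=> i; have [mF Fi] := Foo i; split.
  by rewrite -[X in measurable X]setTI; exact: mg.
by rewrite /pushforward -comp_preimage (_ : g \o f = id)//; apply/funext => x /=.
Qed.

Definition split_tuple (R : realType) (n : nat)
    (t : n.+1.-tuple (measurableTypeR R)) :
    measurableTypeR R * n.-tuple (measurableTypeR R) :=
  (tnth t ord0, [tuple of behead t]).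

Lemma cons_pairK (R : realType) (n : nat) :
  cancel (@cons_pair R n) (@split_tuple R n).
Proof. by move=> [a t]; congr pair; apply: val_inj. Qed.

Lemma measurable_split_tuple (R : realType) (n : nat) :
  measurable_fun setT (@split_tuple R n).
Proof.
apply/measurable_fun_pair; [exact: measurable_tnth|exact: measurable_behead].
Qed.

Section lebesgue_cons.
Context (R : realType) (n : nat).
Variable m : {sigma_finite_measure set (n.-tuple (measurableTypeR R)) -> \bar R}.

Definition lebesgue_cons : set (n.+1.-tuple (measurableTypeR R)) -> \bar R :=
  pushforward (@lebesgue_measure R \x m)%E (@cons_pair R n).

Let lebesgue_cons0 : lebesgue_cons set0 = 0%E.
Proof. by rewrite /lebesgue_cons /pushforward preimage_set0 measure0. Qed.

Let lebesgue_cons_ge0 A : (0 <= lebesgue_cons A)%E.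
Proof. by rewrite /lebesgue_cons /pushforward measure_ge0. Qed.

Let lebesgue_cons_sigma_additive : semi_sigma_additive lebesgue_cons.
Proof.
apply: measure_semi_sigma_additive; exact: measurable_cons_pair.
Qed.

HB.instance Definition _ := isMeasure.Build _ _ _ lebesgue_cons
  lebesgue_cons0 lebesgue_cons_ge0 lebesgue_cons_sigma_additive.

Let lebesgue_cons_sigma_finite : sigma_finite setT lebesgue_cons.
Proof.
rewrite /lebesgue_cons.
apply: (sigma_finite_pushforward_can _ (@cons_pairK R n)).
  exact: measurable_split_tuple.
exact: sigma_finite_product.
Qed.

HB.instance Definition _ := Measure_isSigmaFinite.Build _ _ _ lebesgue_cons
  lebesgue_cons_sigma_finite.

End lebesgue_cons.

Fixpoint lebesgue_tuple (R : realType) (n : nat) :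
    {sigma_finite_measure set (n.-tuple (measurableTypeR R)) -> \bar R} :=
  match n with
  | 0 => \d_ [tuple]
  | n'.+1 => lebesgue_cons (lebesgue_tuple R n')
  end.

(* Complex differentiability everywhere on F^d x F^d (F will be C). *)
Definition holomorphic2 (F : numFieldType) (d : nat)
    (K : 'rV[F]_d -> 'rV[F]_d -> F) : Prop :=
  forall q : 'rV[F]_d * 'rV[F]_d,
    differentiable (fun q : 'rV[F]_d * 'rV[F]_d => K q.1 q.2 : F^o) q.

Section dunkl.
Context {R : realType} {d : nat}.
Local Notation C := R[i].
Implicit Types (x y a : 'rV[R]_d) (Phi Pos : {fset 'rV[R]_d}).

(* Integral over R^d of a complex-valued function, by real and imaginary
   parts; tuples are read as row vectors. *)
Definition integral_Rd (g : 'rV[R]_d -> C) : C :=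
  Complex
    (\int[lebesgue_tuple R d]_t complex.Re (g (\row_j tnth t j)))
    (\int[lebesgue_tuple R d]_t complex.Im (g (\row_j tnth t j))).

(* The norm that the library puts on row vectors is the sup norm, so the
   Euclidean inner product is spelled out; ||y||^2 is [dot y y]. *)
Definition dot x y : R := \sum_j x 0 j * y 0 j.

Definition refl a x : 'rV[R]_d := x - (2 * dot a x / dot a a) *: a.

Definition root_system Phi : Prop :=
  [/\ 0 \notin Phi,
      (forall a b, a \in Phi -> b \in Phi -> refl a b \in Phi) &
      (forall a (c : R), a \in Phi -> (c *: a \in Phi) = (c == 1) || (c == -1))].

Definition normalized Phi : Prop := forall a, a \in Phi -> dot a a = 2.

Definition positive_subsystem Phi Pos : Prop :=
  exists b, (forall a, a \in Phi -> dot a b != 0) /\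
            (forall a, (a \in Pos) = (a \in Phi) && (0 < dot a b)).

(* Reflections are involutions, so closing under composition gives a group. *)
Inductive reflection_group Phi : ('rV[R]_d -> 'rV[R]_d) -> Prop :=
| reflection_group_id : reflection_group Phi id
| reflection_group_refl a w :
    a \in Phi -> reflection_group Phi w -> reflection_group Phi (refl a \o w).

(* Only the values of k on Phi matter. *)
Definition multiplicity_function Phi (k : 'rV[R]_d -> R) : Prop :=
  (forall a, a \in Phi -> 0 <= k a) /\
  (forall w a, reflection_group Phi w -> a \in Phi -> k (w a) = k a).

Definition invariant_set Phi (E : set 'rV[R]_d) : Prop :=
  forall w x, reflection_group Phi w -> E x -> E (w x).

Definition dunkl_gamma Pos (k : 'rV[R]_d -> R) : R := \sum_(a <- Pos) k a.

(* The library's power satisfies 0 `^ 0 = 1, so roots with k a = 0 contribute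
   the factor 1 everywhere. *)
Definition dunkl_weight Pos (k : 'rV[R]_d -> R) y : R :=
  \prod_(a <- Pos) `|dot a y| `^ (2 * k a).

Definition deriveC (f : 'rV[R]_d -> C) (v x : 'rV[R]_d) : C :=
  Complex ('D_v (fun y => complex.Re (f y) : R^o) x)
          ('D_v (fun y => complex.Im (f y) : R^o) x).

(* (f x - f (refl a x)) / (a, x), which for C^1 functions f extends
   continuously to the hyperplane (a, x) = 0: when (a, a) = 2 one has
   refl a x = x - (a, x) a, hence the value there is the derivative of f
   along a. *)
Definition dunkl_quotient a (f : 'rV[R]_d -> C) x : C :=
  if dot a x == 0 then deriveC f a x
  else (f x - f (refl a x)) / (dot a x)%:C%C.

Definition dunkl_operator Pos (k : 'rV[R]_d -> R) (j : 'I_d)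
    (f : 'rV[R]_d -> C) x : C :=
  deriveC f (delta_mx 0 j) x +
  \sum_(a <- Pos) (k a * a 0 j)%:C%C * dunkl_quotient a f x.

(* Sum of the power series with coefficients c over the multi-indices having
   all entries < N. *)
Definition box_sum (c : ('I_d -> nat) -> C) (N : nat) (h : 'rV[R]_d) : C :=
  \sum_(m : {ffun 'I_d -> 'I_N}) c (fun j => m j) * (\prod_j h 0 j ^+ m j)%:C%C.

(* Around each point, u is the sum of an absolutely convergent power series. *)
Definition real_analytic (u : 'rV[R]_d -> C) : Prop :=
  forall x0, exists (c : ('I_d -> nat) -> C) (r : R), 0 < r /\
    forall h : 'rV[R]_d, (forall j, `|h 0 j| < r) ->
      (exists M : R, forall N,
        \sum_(m : {ffun 'I_d -> 'I_N})
          `|c (fun j => m j) * (\prod_j h 0 j ^+ m j)%:C%C| <= M%:C%C) /\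
      (fun N => box_sum c N h : C^o) @ \oo --> (u (x0 + h) : C^o).

Definition toC x : 'rV[C]_d := map_mx (fun r : R => r%:C%C) x.

Definition dunkl_eigenfunction Pos (k : 'rV[R]_d -> R) (z : 'rV[C]_d)
    (u : 'rV[R]_d -> C) : Prop :=
  [/\ real_analytic u,
      (forall j x, dunkl_operator Pos k j u x = z 0 j * u x) &
      u 0 = 1].

(* The Dunkl kernel as an entire function on C^d x C^d: for each z its
   restriction to real first arguments is the normalized joint eigenfunction
   with eigenvalue z. *)
Definition dunkl_kernel Pos (k : 'rV[R]_d -> R)
    (K : 'rV[C]_d -> 'rV[C]_d -> C) : Prop :=
  (forall z, dunkl_eigenfunction Pos k z (fun x => K (toC x) z)) /\
  holomorphic2 K.

(* exp (- i (x, y)) / (1 + ||y||^2)^p *)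
Definition f_x (p : int) x y : C :=
  Complex (cos (dot x y)) (- sin (dot x y)) / ((1 + dot y y) ^ p)%:C%C.

Definition F_x Pos (k : 'rV[R]_d -> R) (K : 'rV[C]_d -> 'rV[C]_d -> C) (p : int)
    x (t : 'rV[R]_d) : C :=
  integral_Rd (fun y =>
    f_x p x y * K ('i%C *: toC y) (toC t) * (dunkl_weight Pos k y)%:C%C).

Definition compactly_supported (g : 'rV[R]_d -> C) : Prop :=
  compact (closure [set t | g t != 0]).

End dunkl.

(* Main.v *)
(** Let [om] be the weight, [lam = gamma + d/2], [rho_s = om exp(-s|.|^2)] and
    [Phi_q(w) = \int cos (x,y) (1+|y|^2)^(-q) rho_w(y) dy].

    Along a ray the joint eigenvalue equation of the Dunkl operators reads
    [E u + sum_a k(a) (u - u o sigma_a) = (x,z) u] with [E] the Euler operator, which has no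
    singularities. At a maximum on a ball the radial derivative is nonnegative; this gives
    uniqueness, [|K(x,iy)| <= 1], the Lipschitz bound [|K(x,iy) - K(x',iy)| <= |y||x - x'|] and,
    with the identity theorem on the imaginary axis, [K(iy,t) = K(t,iy)]. Integration by parts then
    yields [\int K(t,iy) rho_s(t) dt = exp(-|y|^2/(4s)) \int rho_s].

    If [F_x] had compact support, integrating [Re F_x] against [rho_s] and exchanging integrals would
    show [Phi_p(w) = w^(-lam) sum_n H_n w^(-n)] with [|H_n| <= A B^n/n!]. Since
    [Phi_(q-1) = Phi_q - Phi_q'], expansions of this form descend to [q = 0] by
    [H'_n = H_n + (lam+n-1) H_(n-1)]. But [Phi_0] has the coefficients
    [(-1)^n/(2n)! \int (x,y)^(2n) rho_1], of alternating sign. With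
    [r_n = 1/(lam (lam+1) ... (lam+n-1))] the sum of [(-1)^n r_n H'_n] over [n <= N] telescopes to
    [(-1)^N r_N H_N], which tends to 0, while for [q = 0] it is at least [\int rho_1 > 0]. *)

From HB Require Import structures.
Require Import Defs.
From mathcomp Require Import all_boot all_order all_algebra.
From mathcomp Require Import finmap complex.
From mathcomp Require Import all_classical all_reals all_analysis.
From mathcomp Require Import measurable_realfun ring lra.

Set Implicit Arguments.
Unset Strict Implicit.
Unset Printing Implicit Defensive.

Import Order.TTheory GRing.Theory Num.Theory.
Import numFieldNormedType.Exports.
Import ComplexField.Normc.

Local Open Scope classical_set_scope.
Local Open Scope ring_scope.

(** * Identity theorem for entire functions *)

(** The transform of a compactly supported function should be entire, while [f_x] has poles on 1 +
    (y,y) = 0. Making this rigorous would take an inversion formula, which the definition of [K]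
    does not supply. Gaussians replace it: their transform is explicit, so pairing Re F_x with rho_s
    gives by Fubini an identity in one variable w = 1/(4s). There the pole survives as the operator
    1 - d/dw, and undoing it from q = 0 forces coefficients of size lam (lam+1) ... (lam+n-1), since
    the alternating signs of the data forbid cancellation; r_n divides out exactly this growth.

    Two obstacles shape the rest. [F_x] contains K(iy,t) with the imaginary argument first, whereas
    the eigenvalue equations act on a real first argument: hence the symmetry of the kernel. The
    weight need not be differentiable across the reflecting hyperplanes: hence its regularization
    before integrating by parts. The Lipschitz bound keeps the difference quotients bounded when the
    regularization is removed, and the bound on p makes |f_x| om integrable. *)

Section interval_integral.
Context {R : realType}.
Implicit Types (f g : R -> R) (a b c : R).
Local Notation leb := (@lebesgue_measure R).

Definition int_itv f a b : R := \int[leb]_(x in `[a, b]) f x.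

Lemma continuous_integrable_itv f a b : continuous f ->
  leb.-integrable `[a, b] (EFin \o f).
Proof.
move=> cf; apply: continuous_compact_integrable; first exact: segment_compact.
exact: continuous_subspaceT.
Qed.

Lemma int_itv_cat f a c b : continuous f -> a <= c -> c <= b ->
  int_itv f a b = int_itv f a c + int_itv f c b.
Proof.
move=> cf ac cb; have := @Rintegral_itvB R f (BLeft a) (BRight b) c.
rewrite /int_itv bnd_simp => /(_ (continuous_integrable_itv _ _ cf) ac).
rewrite bnd_simp => /(_ cb) h; rewrite -(@Rintegral_itv_obnd_cbnd R c (BRight b)).
  by rewrite -h addrC subrK.
apply: (integrableS _ _ _ (continuous_integrable_itv c b cf)) => //.
by apply: subset_itv; rewrite bnd_simp.
Qed.

Lemma int_itvD f g a b : continuous f -> continuous g ->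
  int_itv (fun x => f x + g x) a b = int_itv f a b + int_itv g a b.
Proof. by move=> cf cg; apply: RintegralD => //; exact: continuous_integrable_itv. Qed.

Lemma int_itv_cst (r : R) a b : a <= b -> int_itv (fun=> r) a b = r * (b - a).
Proof.
move=> ab; rewrite /int_itv Rintegral_cst//= lebesgue_measure_itv/= lte_fin.
by move: ab; rewrite le_eqVlt => /predU1P[->|->//]; rewrite ltxx subrr mulr0.
Qed.

Lemma int_itv_le f g a b : continuous f -> continuous g ->
  (forall x, a <= x <= b -> f x <= g x) -> int_itv f a b <= int_itv g a b.
Proof.
by move=> cf cg fg; apply: le_Rintegral => //; exact: continuous_integrable_itv.
Qed.

Lemma int_itv_ge (r : R) f a b : continuous f -> a <= b ->
  (forall x, a <= x <= b -> r <= f x) -> r * (b - a) <= int_itv f a b.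
Proof.
move=> cf ab h; rewrite -int_itv_cst//; apply: int_itv_le => // x; exact: cvg_cst.
Qed.

Lemma int_itv_ub (r : R) f a b : continuous f -> a <= b ->
  (forall x, a <= x <= b -> f x <= r) -> int_itv f a b <= r * (b - a).
Proof.
move=> cf ab h; rewrite -int_itv_cst//; apply: int_itv_le => // x; exact: cvg_cst.
Qed.

End interval_integral.

(** * Goursat's theorem for closed one-forms on rectangles *)

Section goursat.
Context {R : realType}.
Variables (P Q : R -> R -> R).

(** The line integral of P dx + Q dy counterclockwise around [a,b] x [c,d], opposite sides being
    paired in one integrand. *)
Definition rect_int (a b c d : R) : R :=
  int_itv (fun x => P x c - P x d) a b + int_itv (fun y => Q b y - Q a y) c d.

Hypothesis cPx : forall y, continuous (fun x => P x y).
Hypothesis cQy : forall x, continuous (Q x).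

Let cP c d : continuous (fun x => P x c - P x d).
Proof. by move=> x; apply: cvgB; exact: cPx. Qed.

Let cQ a b : continuous (fun y => Q b y - Q a y).
Proof. by move=> y; apply: cvgB; exact: cQy. Qed.

Lemma rect_int_vcut a m b c d : a <= m -> m <= b ->
  rect_int a b c d = rect_int a m c d + rect_int m b c d.
Proof.
move=> am mb; rewrite /rect_int (int_itv_cat _ am mb)//.
rewrite (_ : int_itv (fun y => Q b y - Q a y) c d =
  int_itv (fun y => Q m y - Q a y) c d + int_itv (fun y => Q b y - Q m y) c d).
  by lra.
by rewrite -int_itvD//; congr int_itv; apply/funext => y; lra.
Qed.

Lemma rect_int_hcut a b c m d : c <= m -> m <= d ->
  rect_int a b c d = rect_int a b c m + rect_int a b m d.
Proof.
move=> am mb; rewrite /rect_int (int_itv_cat _ am mb)//.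
rewrite (_ : int_itv (fun x => P x c - P x d) a b =
  int_itv (fun x => P x c - P x m) a b + int_itv (fun x => P x m - P x d) a b).
  by lra.
by rewrite -int_itvD//; congr int_itv; apply/funext => y; lra.
Qed.

(** The boundary integrals of the four quarters add up to that of the whole, so not all of them can
    fall below a quarter of the bound. The bound is proportional to the area, hence the chosen
    quarter inherits it with the same [e]. *)
Lemma rect_int_bisect (e w h a c : R) : 0 <= w -> 0 <= h ->
  e * (w * h) <= `|rect_int a (a + w) c (c + h)| ->
  exists a' c', [/\ a <= a', a' + w / 2 <= a + w, c <= c', c' + h / 2 <= c + h &
   e * (w / 2 * (h / 2)) <= `|rect_int a' (a' + w / 2) c' (c' + h / 2)|].
Proof.
move=> w0 h0 H.
have w20 : 0 <= w / 2 by rewrite divr_ge0.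
have h20 : 0 <= h / 2 by rewrite divr_ge0.
have E : e * (w / 2 * (h / 2)) = e * (w * h) / 4 by field.
have aw : a + w / 2 + w / 2 = a + w by field.
have ch : c + h / 2 + h / 2 = c + h by field.
have am : a <= a + w / 2 by rewrite lerDl.
have mw : a + w / 2 <= a + w by rewrite -aw lerDl.
have cm : c <= c + h / 2 by rewrite lerDl.
have mh : c + h / 2 <= c + h by rewrite -ch lerDl.
have [|hA] := leP (e * (w / 2 * (h / 2))) `|rect_int a (a + w / 2) c (c + h / 2)|.
  by exists a, c.
have [|hB] := leP (e * (w / 2 * (h / 2)))
    `|rect_int a (a + w / 2) (c + h / 2) (c + h)|.
  by exists a, (c + h / 2); rewrite ch.
have [|hC] := leP (e * (w / 2 * (h / 2)))
    `|rect_int (a + w / 2) (a + w) c (c + h / 2)|.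
  by exists (a + w / 2), c; rewrite aw.
have [|hD] := leP (e * (w / 2 * (h / 2)))
    `|rect_int (a + w / 2) (a + w) (c + h / 2) (c + h)|.
  by exists (a + w / 2), (c + h / 2); rewrite aw ch.
exfalso; move: H hA hB hC hD.
rewrite (rect_int_vcut _ _ am mw) !(rect_int_hcut _ _ cm mh).
move: (rect_int _ _ _ _) (rect_int _ _ _ _) (rect_int _ _ _ _) (rect_int _ _ _ _).
move=> D C B A; rewrite E.
have := ler_normD (A + B) (C + D); have := ler_normD A B; have := ler_normD C D.
by move: `|A + B + (C + D)| `|A + B| `|C + D| `|A| `|B| `|C| `|D| (e * (w * h)) => *; lra.
Qed.

(** Differentiability at a single point, spelled out with the sum of the absolute increments as
    norm, so that the estimates below stay elementary inequalities between reals. *)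
Definition has_gradient (F : R -> R -> R) (a b p q : R) := forall e : R, 0 < e ->
  exists2 r, 0 < r & forall x y, `|x - a| < r -> `|y - b| < r ->
    `|F x y - F a b - (p * (x - a) + q * (y - b))| <= e * (`|x - a| + `|y - b|).

Lemma gradient_increment (F : R -> R -> R) (a b p q e r w h x1 y1 x2 y2 : R) : 0 < e ->
  (forall x y, `|x - a| < r -> `|y - b| < r ->
    `|F x y - F a b - (p * (x - a) + q * (y - b))| <= e / 2 * (`|x - a| + `|y - b|)) ->
  w < r -> h < r -> `|x1 - a| <= w -> `|x2 - a| <= w -> `|y1 - b| <= h -> `|y2 - b| <= h ->
  `|F x1 y1 - F x2 y2 - (p * (x1 - x2) + q * (y1 - y2))| <= e * (w + h).
Proof.
move=> e0 H wr hr a1 a2 b1 b2.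
have B x y : `|x - a| <= w -> `|y - b| <= h ->
    `|F x y - F a b - (p * (x - a) + q * (y - b))| <= e / 2 * (w + h).
  move=> xw yh; apply: (le_trans (H x y (le_lt_trans xw wr) (le_lt_trans yh hr))).
  by rewrite ler_wpM2l ?lerD// ltW// divr_gt0.
have -> : F x1 y1 - F x2 y2 - (p * (x1 - x2) + q * (y1 - y2)) =
    (F x1 y1 - F a b - (p * (x1 - a) + q * (y1 - b))) -
    (F x2 y2 - F a b - (p * (x2 - a) + q * (y2 - b))) by ring.
rewrite (le_trans (ler_normB _ _))// (le_trans (lerD (B _ _ a1 b1) (B _ _ a2 b2)))//.
by rewrite -mulrDl -splitr.
Qed.

(** The y-derivative of [P] and the x-derivative of [Q] have the common value [q], so the linear
    parts contribute -q w h and q w h and cancel. The remainders are at most e (w + h) on each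
    integrand, over lengths w and h. *)
Lemma rect_int_small a b p q s : has_gradient P a b p q -> has_gradient Q a b q s ->
  forall e : R, 0 < e -> exists2 r, 0 < r &
    forall x y w h, x <= a <= x + w -> y <= b <= y + h -> w < r -> h < r ->
    `|rect_int x (x + w) y (y + h)| <= e * (w + h) ^+ 2.
Proof.
move=> dP dQ e e0; have e20 : 0 < e / 2 by rewrite divr_gt0.
have [r r0 Hr] := dP _ e20; have [t t0 Ht] := dQ _ e20.
exists (Num.min r t); first by rewrite lt_min r0 t0.
move=> x y w h xa yb; rewrite !lt_min => /andP[wr wt] /andP[hr ht].
have w0 : 0 <= w by move: xa; lra.
have h0 : 0 <= h by move: yb; lra.
have aw z : x <= z <= x + w -> `|z - a| <= w by move: xa; rewrite ler_norml; lra.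
have bh z : y <= z <= y + h -> `|z - b| <= h by move: yb; rewrite ler_norml; lra.
have xx : x <= x <= x + w by rewrite lexx lerDl.
have xw : x <= x + w <= x + w by rewrite lexx lerDl w0.
have yy : y <= y <= y + h by rewrite lexx lerDl.
have yh : y <= y + h <= y + h by rewrite lexx lerDl h0.
have I1 z : x <= z <= x + w -> `|P z y - P z (y + h) + q * h| <= e * (w + h).
  move=> xz; have := gradient_increment e0 Hr wr hr (aw z xz) (aw z xz) (bh y yy) (bh _ yh).
  by rewrite (_ : _ - _ - _ = P z y - P z (y + h) + q * h)//; ring.
have I2 z : y <= z <= y + h -> `|Q (x + w) z - Q x z - q * w| <= e * (w + h).
  move=> yz; have := gradient_increment e0 Ht wt ht (aw _ xw) (aw x xx) (bh z yz) (bh z yz).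
  by rewrite (_ : _ - _ - _ = Q (x + w) z - Q x z - q * w)//; ring.
have J1 : (- q * h - e * (w + h)) * (x + w - x) <= int_itv (fun x => P x y - P x (y + h)) x (x + w).
  apply: int_itv_ge => // [|z /I1]; first by case/andP: xw.
  by rewrite ler_norml => /andP[+ _]; lra.
have J2 : int_itv (fun x => P x y - P x (y + h)) x (x + w) <= (- q * h + e * (w + h)) * (x + w - x).
  apply: int_itv_ub => // [|z /I1]; first by case/andP: xw.
  by rewrite ler_norml => /andP[_]; lra.
have J3 : (q * w - e * (w + h)) * (y + h - y) <= int_itv (fun y => Q (x + w) y - Q x y) y (y + h).
  apply: int_itv_ge => // [|z /I2]; first by case/andP: yh.
  by rewrite ler_norml => /andP[+ _]; lra.
have J4 : int_itv (fun y => Q (x + w) y - Q x y) y (y + h) <= (q * w + e * (w + h)) * (y + h - y).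
  apply: int_itv_ub => // [|z /I2]; first by case/andP: yh.
  by rewrite ler_norml => /andP[_]; lra.
rewrite /rect_int; move: (int_itv _ _ _) (int_itv _ _ _) J1 J2 J3 J4 => A B.
rewrite ![_ + _ - _]addrAC !subrr !add0r => J1 J2 J3 J4.
have := mulr_ge0 (ltW e0) (sqr_ge0 (w - h)).
have := mulr_ge0 (ltW e0) (mulr_ge0 w0 h0).
rewrite ler_norml; nra.
Qed.

Hypothesis closed_form : forall a b, exists p q s,
  has_gradient P a b p q /\ has_gradient Q a b q s.

(** Repeated bisection yields nested rectangles whose boundary integrals stay at least [e] times
    their area. At the common point of the rectangles this contradicts the quadratic smallness with
    an arbitrary constant. *)
Lemma rect_int0 a b c d : a < b -> c < d -> rect_int a b c d = 0.
Proof.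
move=> ab cd; apply/eqP; rewrite -normr_le0 leNgt; apply/negP => I0.
pose w := b - a; pose h := d - c.
have w0 : 0 < w by rewrite subr_gt0.
have h0 : 0 < h by rewrite subr_gt0.
pose e := `|rect_int a b c d| / (w * h).
have e0 : 0 < e by rewrite divr_gt0 ?mulr_gt0.
pose W n : R := w / 2 ^+ n; pose H n : R := h / 2 ^+ n.
have W0 n : 0 <= W n by rewrite divr_ge0 ?exprn_ge0// ltW.
have H0 n : 0 <= H n by rewrite divr_ge0 ?exprn_ge0// ltW.
have WS n : W n.+1 = W n / 2 by rewrite /W exprSr invfM mulrA.
have HS n : H n.+1 = H n / 2 by rewrite /H exprSr invfM mulrA.
pose good n (x : R * R) :=
  e * (W n * H n) <= `|rect_int x.1 (x.1 + W n) x.2 (x.2 + H n)|.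
have step n (x : {x | good n x}) : exists y : {y | good n.+1 y},
  [/\ (val x).1 <= (val y).1, (val y).1 + W n.+1 <= (val x).1 + W n,
      (val x).2 <= (val y).2 & (val y).2 + H n.+1 <= (val x).2 + H n].
  case: x => -[x1 x2] gx /=.
  have [y1 [y2 [h1 h2 h3 h4 h5]]] := rect_int_bisect (W0 n) (H0 n) gx.
  by rewrite -WS -HS in h2 h4 h5; exists (exist _ (y1, y2) h5).
have g0 : good 0%N (a, c).
  rewrite /good /W /H expr0 !divr1 /= /e divfK ?mulf_neq0 ?gt_eqF//.
  by rewrite /w /h !subrKC.
pose nxt n x := sval (cid (step n x)).
pose s := fix s n : {x | good n x} :=
  match n with 0%N => exist _ (a, c) g0 | m.+1 => nxt m (s m) end.
pose u n := (val (s n)).1; pose v n := (val (s n)).2.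
have uvS n : [/\ u n <= u n.+1, u n.+1 + W n.+1 <= u n + W n,
    v n <= v n.+1 & v n.+1 + H n.+1 <= v n + H n].
  exact: (svalP (cid (step n (s n)))).
have ndu : {homo u : n m / (n <= m)%N >-> n <= m}.
  by apply: homo_leq => // [x y z|n]; [exact: le_trans|have [] := uvS n].
have ndv : {homo v : n m / (n <= m)%N >-> n <= m}.
  by apply: homo_leq => // [x y z|n]; [exact: le_trans|have [] := uvS n].
have nuW : {homo (fun n => u n + W n) : n m / (n <= m)%N >-> m <= n}.
  by apply: (homo_leq (r := fun x y => y <= x)) => // [x y z xy yz|n];
    [exact: le_trans yz xy|have [] := uvS n].
have nvH : {homo (fun n => v n + H n) : n m / (n <= m)%N >-> m <= n}.
  by apply: (homo_leq (r := fun x y => y <= x)) => // [x y z xy yz|n];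
    [exact: le_trans yz xy|have [] := uvS n].
have uW m n : u m <= u n + W n.
  apply: (le_trans (ndu _ _ (leq_maxl m n))).
  apply: le_trans (nuW _ _ (leq_maxr m n)); rewrite lerDl; exact: W0.
have vH m n : v m <= v n + H n.
  apply: (le_trans (ndv _ _ (leq_maxl m n))).
  apply: le_trans (nvH _ _ (leq_maxr m n)); rewrite lerDl; exact: H0.
pose x := sup (range u); pose y := sup (range v).
have xP n : u n <= x <= u n + W n.
  apply/andP; split.
    apply: ub_le_sup; last by exists n.
    by exists (u 0%N + W 0%N) => _ [m _ <-]; exact: uW.
  by apply: ge_sup; [exists (u 0%N), 0%N|move=> _ [m _ <-]; exact: uW].
have yP n : v n <= y <= v n + H n.
  apply/andP; split.
    apply: ub_le_sup; last by exists n.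
    by exists (v 0%N + H 0%N) => _ [m _ <-]; exact: vH.
  by apply: ge_sup; [exists (v 0%N), 0%N|move=> _ [m _ <-]; exact: vH].
have [p [q [t [gP gQ]]]] := closed_form x y.
(* All rectangles keep the proportions w : h, and this constant makes f (W n + H n)^2 exactly half
   of e W n H n. *)
pose f := e * (w * h) / (2 * (w + h) ^+ 2).
have wh0 : 0 < w + h by exact: addr_gt0.
have f0 : 0 < f by apply: divr_gt0; apply: mulr_gt0 => //; [exact: mulr_gt0|exact: exprn_gt0].
have [r r0 Hr] := rect_int_small gP gQ f0.
have [n Hn] : exists n, (w + h) / r < 2 ^+ n.
  exists (Num.bound ((w + h) / r)).
  apply: lt_trans (archi_boundP _) _; first by rewrite divr_ge0 ?ltW.
  by rewrite -natrX ltr_nat; exact: ltn_expl.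
have p2 : (0 : R) < 2 ^+ n by rewrite exprn_gt0.
have := svalP (s n); rewrite -/(good n _) /good -/(u n) -/(v n) leNgt => /negP; apply.
move: Hn; rewrite ltr_pdivrMr// => Hn.
apply: le_lt_trans (Hr _ _ _ _ (xP n) (yP n) _ _) _.
- by rewrite /W ltr_pdivrMr// mulrC; lra.
- by rewrite /H ltr_pdivrMr// mulrC; lra.
rewrite (_ : W n + H n = (w + h) / 2 ^+ n); last by rewrite /W /H -mulrDl.
have p3 : (2 : R) ^+ n != 0 by rewrite gt_eqF.
have -> : f * ((w + h) / 2 ^+ n) ^+ 2 = e * (w * h) / 2 / (2 ^+ n) ^+ 2.
  by rewrite /f; field; rewrite p3 gt_eqF.
have -> : e * (W n * H n) = e * (w * h) / (2 ^+ n) ^+ 2.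
  by rewrite /W /H; field.
rewrite ltr_pM2r ?invr_gt0 ?exprn_gt0//.
have : 0 < e * (w * h) by apply: mulr_gt0 => //; exact: mulr_gt0.
by move: (e * (w * h)) => z z0; lra.
Qed.

End goursat.

(** * From complex derivatives to Cauchy's theorem on rectangles *)

Section complex_derivable.
Context {R : realType}.
Local Notation C := R[i].
Implicit Types (f : C -> C) (z w : C).

Lemma normc_Re_le z : `|complex.Re z| <= normc z.
Proof.
case: z => a b /=; rewrite -sqrtr_sqr ler_wsqrtr//.
by rewrite lerDl sqr_ge0.
Qed.

Lemma normc_Im_le z : `|complex.Im z| <= normc z.
Proof.
case: z => a b /=; rewrite -sqrtr_sqr ler_wsqrtr//.
by rewrite lerDr sqr_ge0.
Qed.

Lemma normc_le_ReIm z : normc z <= `|complex.Re z| + `|complex.Im z|.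
Proof.
case: z => a b /=; rewrite -(@ger0_norm _ (`|a| + `|b|)) ?addr_ge0//.
rewrite -sqrtr_sqr ler_wsqrtr// sqrrD !real_normK ?num_real//.
by rewrite addrAC lerDl mulrn_wge0// mulr_ge0.
Qed.

Lemma normc_ge0 z : 0 <= normc z.
Proof. by case: z => a b /=; exact: sqrtr_ge0. Qed.

(** The norm of [C] takes its values in [C], so both the tolerance and the radius pass through
    [complex.Re]; afterwards all epsilons are real. *)
Lemma derivable_normc f z : derivable (f : C^o -> C^o) z 1 -> exists l : C,
  forall e : R, 0 < e -> exists2 r : R, 0 < r &
    forall w, normc (w - z) < r -> normc (f w - f z - l * (w - z)) <= e * normc (w - z).
Proof.
move=> /cvg_ex[/= l /cvgrPdist_le fl]; exists l => e e0.
have eC0 : 0 < (e%:C)%C by rewrite ltcR.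
have := fl _ eC0; rewrite near_withinE => -[r /= r0 Hr].
have rE : r = ((complex.Re r)%:C)%C by rewrite RRe_real// gtr0_real.
exists (complex.Re r); first by rewrite -ltcR -rE.
move=> w wr; have [->|wz] := eqVneq w z.
  by rewrite !subrr mulr0 subr0 normc0 mulr0.
have wz0 : w - z != 0 by rewrite subr_eq0.
have /= := Hr (w - z); rewrite sub0r normrN => /(_ _ wz0).
have -> : (`|w - z| < r)%R by rewrite rE ltcR.
move=> /(_ isT).
rewrite [_%:A]mulr1 subrK => h.
have -> : f w - f z - l * (w - z) = - ((l - (w - z)^-1 *: (f w - f z)) * (w - z)).
  by rewrite mulrBl [_ *: _]mulrC divfK// opprB.
rewrite normcN normcM ler_wpM2r ?normc_ge0//.
by rewrite -lecR.
Qed.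

Definition reC f (x y : R) : R := complex.Re (f (Complex x y)).
Definition imC f (x y : R) : R := complex.Im (f (Complex x y)).

(** The Cauchy-Riemann equations for f' = p + i q. Comparing the first and the third gradient shows
    that u dx - v dy, the real part of f dz, is a closed form. *)
Lemma has_gradient_reC f a b : derivable (f : C^o -> C^o) (Complex a b) 1 ->
  exists p q, [/\ has_gradient (reC f) a b p (- q), has_gradient (imC f) a b q p &
   has_gradient (fun x y => - imC f x y) a b (- q) (- p)].
Proof.
move=> /derivable_normc[[p q] H]; exists p, q.
have K e : 0 < e -> exists2 r : R, 0 < r & forall x y, `|x - a| < r -> `|y - b| < r ->
  `|reC f x y - reC f a b - (p * (x - a) + - q * (y - b))| <= e * (`|x - a| + `|y - b|) /\
  `|imC f x y - imC f a b - (q * (x - a) + p * (y - b))| <= e * (`|x - a| + `|y - b|).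
  move=> e0; have [r r0 Hr] := H e e0; exists (r / 2); first by rewrite divr_gt0.
  move=> x y xa yb; have := Hr (Complex x y).
  have D : Complex x y - Complex a b = Complex (x - a) (y - b) by [].
  rewrite D; have n : normc (Complex (x - a) (y - b)) <= `|x - a| + `|y - b|.
    exact: normc_le_ReIm.
  have -> : normc (Complex (x - a) (y - b)) < r.
    by apply: (le_lt_trans n); rewrite [ltRHS]splitr ltrD.
  move=> /(_ isT) h.
  have {}h := le_trans h (ler_wpM2l (ltW e0) n).
  have := le_trans (normc_Re_le _) h; have := le_trans (normc_Im_le _) h.
  rewrite /reC /imC; case: (f (Complex x y)) => u v; case: (f (Complex a b)) => u0 v0 /=.
  by rewrite mulNr [q * (x - a) + _]addrC addrC.
split=> e /K[r r0 Hr]; exists r => // x y xa yb; have [h1 h2] := Hr _ _ xa yb => //.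
rewrite -normrN; apply: le_trans h2; rewrite le_eqVlt; apply/orP; left; apply/eqP.
by congr (`|_|); lra.
Qed.

Lemma has_gradient_continuous (F : R -> R -> R) a b p q : has_gradient F a b p q ->
  {for a, continuous (fun x => F x b)} /\ {for b, continuous (F a)}.
Proof.
move=> H; split; apply/cvgrPdist_le => e e0.
- have [r r0 Hr] := H 1 ltr01.
  have m0 : 0 < Num.min r (e / (1 + `|p|)) by rewrite lt_min r0 divr_gt0// ltr_pwDl.
  near=> x.
  have : `|x - a| < Num.min r (e / (1 + `|p|)).
    by rewrite distrC; near: x; exact: cvgr_dist_lt.
  rewrite lt_min => /andP[xr xe].
  have := Hr x b xr; rewrite !subrr normr0 mulr0 !addr0 => /(_ r0).
  rewrite mul1r => h.
  rewrite distrC -(subrK (p * (x - a)) (F x b - F a b)) (le_trans (ler_normD _ _))//.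
  rewrite normrM; move: xe; rewrite ltr_pdivlMr ?ltr_pwDl// => xe.
  by nra.
- have [r r0 Hr] := H 1 ltr01.
  have m0 : 0 < Num.min r (e / (1 + `|q|)) by rewrite lt_min r0 divr_gt0// ltr_pwDl.
  near=> x.
  have : `|x - b| < Num.min r (e / (1 + `|q|)).
    by rewrite distrC; near: x; exact: cvgr_dist_lt.
  rewrite lt_min => /andP[xr xe].
  have := Hr a x; rewrite !subrr normr0 mulr0 !add0r => /(_ r0 xr).
  rewrite mul1r => h.
  rewrite distrC -(subrK (q * (x - b)) (F a x - F a b)) (le_trans (ler_normD _ _))//.
  rewrite normrM; move: xe; rewrite ltr_pdivlMr ?ltr_pwDl// => xe.
  by nra.
Unshelve. all: by end_near. Qed.

(** The left-hand side is the real part of the contour integral of [f], that is [rect_int] of u dx -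
    v dy. *)
Lemma cauchy_rect f a b c d : (forall z, derivable (f : C^o -> C^o) z 1) ->
  a < b -> c < d ->
  int_itv (fun x => reC f x c - reC f x d) a b +
  int_itv (fun y => - imC f b y - - imC f a y) c d = 0.
Proof.
move=> df ab cd.
have cont x y := has_gradient_reC (df (Complex x y)).
apply: (@rect_int0 _ (reC f) (fun x y => - imC f x y)) => //.
- by move=> y x; have [p [q [/has_gradient_continuous[]]]] := cont x y.
- by move=> x y; have [p [q [_ _ /has_gradient_continuous[]]]] := cont x y.
- by move=> x y; have [p [q []]] := cont x y; exists p, (- q), (- p).
Qed.

Lemma continuous_reC_imC f : (forall z, derivable (f : C^o -> C^o) z 1) ->
  [/\ forall y, continuous (fun x => reC f x y), forall x, continuous (reC f x),
      forall y, continuous (fun x => imC f x y) & forall x, continuous (imC f x)].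
Proof.
move=> df; have cont x y := has_gradient_reC (df (Complex x y)).
split=> [y x|x y|y x|x y]; have [p [q [h1 h2 _]]] := cont x y.
- by have [] := has_gradient_continuous h1.
- by have [] := has_gradient_continuous h1.
- by have [] := has_gradient_continuous h2.
- by have [] := has_gradient_continuous h2.
Qed.

End complex_derivable.

(** * Entire functions vanishing on the real axis *)

Section identity_on_the_real_axis.
Context {R : realType}.
Local Notation C := R[i].
Implicit Types (f : C -> C).

Lemma continuous_bounded_itv (h : R -> R) (a b : R) : a <= b -> continuous h ->
  exists2 M, 0 <= M & forall x, a <= x <= b -> `|h x| <= M.
Proof.
move=> ab ch; have [|c _ Hc] := @EVT_max R (fun x => `|h x|) a b ab.
  by apply: continuous_subspaceT => x; apply: continuous_comp; [exact: ch|exact: norm_continuous].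
by exists `|h c| => // x xab; apply: Hc; rewrite in_itv.
Qed.

Lemma derivableM_C (f g : C -> C) z : derivable (f : C^o -> C^o) z 1 ->
  derivable (g : C^o -> C^o) z 1 -> derivable ((fun w => f w * g w) : C^o -> C^o) z 1.
Proof. by move=> df dg; have H := @derivableM C C^o f g z 1 df dg; exact: H. Qed.

Lemma derivable_expr (f : C -> C) n z : derivable (f : C^o -> C^o) z 1 ->
  derivable ((fun w => f w ^+ n) : C^o -> C^o) z 1.
Proof.
move=> df; elim: n => [|n IH]; first exact: derivable_cst.
rewrite (_ : (fun w => _) = (fun w => f w * f w ^+ n)).
  exact: derivableM_C.
by apply/funext => w; rewrite exprS.
Qed.

(** A polynomial peaking at [i]. On the line Im z = 1 it is 1 - x^2/5, which is positive for |x| <=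
    2 because 5 > 4; on the sides |x| = 2 of the rectangle its modulus stays below 9/10. *)
Definition landau (z : C) : C := 1 - (z - 'i%C) ^+ 2 * (5^-1)%:C%C.

Lemma derivable_landau z : derivable (landau : C^o -> C^o) z 1.
Proof.
have di : derivable (id : C^o -> C^o) z 1 by exact: derivable_id.
have dc c : derivable (cst c : C^o -> C^o) z 1 by exact: derivable_cst.
have d1 : derivable ((fun w : C => w - 'i%C) : C^o -> C^o) z 1.
  by have H := @derivableB C C^o C^o id (cst 'i%C) z 1 di (dc _); exact: H.
have d2 := derivableM_C (@derivable_expr _ 2 _ d1) (dc (5^-1 : R)%:C%C).
by have H := @derivableB C C^o C^o (cst 1) _ z 1 (dc _) d2; exact: H.
Qed.

Lemma landau_top x : landau (Complex x 1) = (1 - x ^+ 2 / 5)%:C%C.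
Proof.
rewrite /landau; have -> : Complex x 1 - 'i%C = x%:C%C.
  by apply/eqP; rewrite eq_complex /= subr0 subrr !eqxx.
by rewrite rmorphB rmorphM rmorphXn /= rmorph1.
Qed.

Lemma landau_side x y : `|x| = 2 -> 0 <= y <= 1 -> normc (landau (Complex x y)) <= 9 / 10.
Proof.
move=> x2 y01; have xx : x ^+ 2 = 4.
  by rewrite -(@real_normK _ x) ?num_real// x2; lra.
have -> : landau (Complex x y) =
   Complex (1 - (4 - (y - 1) ^+ 2) / 5) (- (2 * x * (y - 1)) / 5).
  by apply/eqP; rewrite eq_complex /= -xx; apply/andP; split; apply/eqP; field.
rewrite /= -(@ger0_norm _ (9 / 10)) ?divr_ge0// -sqrtr_sqr ler_wsqrtr//.
have -> : (- (2 * x * (y - 1)) / 5) ^+ 2 = 16 * (y - 1) ^+ 2 / 25.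
  by rewrite (_ : 16 = 4 * x ^+ 2); [field|rewrite xx; lra].
(* The squared modulus is ((1 + s)^2 + 16 s)/25, at most 20/25 for s <= 1, and 20/25 < 81/100. *)
set s := (y - 1) ^+ 2; have s1 : s <= 1.
  by move/andP: y01 => [y0 y1]; rewrite /s; nra.
have s0 : 0 <= s by rewrite sqr_ge0.
by nra.
Qed.

Lemma geometric_ratio_small (A B a b : R) : 0 < A -> 0 <= b -> b < a ->
  exists n, B * b ^+ n < A * a ^+ n.
Proof.
move=> A0 b0 ba; have a0 : 0 < a by exact: le_lt_trans ba.
have ba0 : 0 <= b / a by rewrite divr_ge0// ltW.
have q1 : `|b / a| < 1 by rewrite (ger0_norm ba0) ltr_pdivrMr// mul1r.
have /cvgrPdist_lt/(_ (A / (1 + `|B|))) := cvg_expr q1.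
rewrite divr_gt0 ?ltr_pwDl// => /(_ isT)[n _ /(_ n (leqnn n))].
rewrite sub0r normrN normrX (ger0_norm ba0) => H; exists n.
move: H; rewrite expr_div_n ltr_pdivrMr ?exprn_gt0// mulrAC.
rewrite ltr_pdivlMr ?ltr_pwDl// => H.
apply: le_lt_trans H; rewrite mulrC ler_wpM2l ?exprn_ge0//.
by rewrite (le_trans (ler_norm _))// lerDr.
Qed.

(* Cauchy's theorem for [f * landau ^+ n] on [[-2, 2] x [0, 1]]: the bottom side contributes nothing
   and the vertical sides are exponentially small, whereas on the top side [landau ^+ n] is an
   approximate identity at ['i]. *)
Lemma entire_zero_Re f : (forall z, derivable (f : C^o -> C^o) z 1) ->
  (forall x : R, f x%:C%C = 0) -> ~ 0 < complex.Re (f 'i%C).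
Proof.
move=> df f0 fi.
pose d := complex.Re (f 'i%C) / 2.
have d0 : 0 < d by rewrite divr_gt0.
have [c1 c2 c3 c4] := continuous_reC_imC df.
have [e [e0 e1 He]] : exists e, [/\ 0 < e, e <= 1 & forall x, `|x| <= e -> d <= reC f x 1].
  have /cvgrPdist_lt/(_ _ d0)[r /= r0 Hr] := c1 1 0.
  exists (Num.min 1 (r / 2)); split; rewrite ?lt_min ?ge_min ?lexx ?ltr01 ?divr_gt0//.
  move=> x; rewrite le_min => /andP[_ xr].
  have /= := Hr x; rewrite sub0r normrN; have -> : `|x| < r.
    by apply: (le_lt_trans xr); rewrite ltr_pdivrMr// ltr_pMr// ltr1n.
  move=> /(_ isT); rewrite {1}/reC => /ltr_normlP[_]; rewrite /d.
  by move: (complex.Re (f 'i%C)) (reC f x 1) => u v; lra.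
have n22 : -2 < 2 :> R by lra.
have [M1 M10 HM1] := continuous_bounded_itv (ltW n22) (c1 1).
have sideb x : `|x| = 2 -> exists2 M, 0 <= M & forall y, 0 <= y <= 1 -> normc (f (Complex x y)) <= M.
  move=> _; have [M M0 HM] := continuous_bounded_itv ler01 (c2 x).
  have [M' M'0 HM'] := continuous_bounded_itv ler01 (c4 x).
  exists (M + M'); first exact: addr_ge0.
  by move=> y y01; apply: le_trans (normc_le_ReIm _) _; apply: lerD; [exact: HM|exact: HM'].
have [|M2 M20 HM2] := sideb 2; first by rewrite ger0_norm.
have [|M3 M30 HM3] := sideb (-2); first by rewrite normrN ger0_norm.
(* On the top side [a] bounds [landau] from below for |x| <= e/2 and [b] bounds it from above for
   |x| >= e; [b] also serves on the vertical sides. For e/2 <= |x| <= e only the sign of Re f is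
   used. *)
pose a : R := 1 - (e / 2) ^+ 2 / 5.
pose b : R := Num.max (9 / 10) (1 - e ^+ 2 / 5).
have e2 : 0 < e ^+ 2 <= 1 by rewrite exprn_gt0//= expr_le1// ltW.
have ba : b < a.
  by rewrite /b /a gt_max expr_div_n; apply/andP; split; lra.
have b0 : 0 <= b by rewrite le_max; apply/orP; left; lra.
have a0 : 0 < a by exact: le_lt_trans ba.
(* The gain is d a^n over an interval of length e. The losses are M1 b^n over at most the whole top
   side, of length 4, and (M2 + M3) b^n over the vertical sides, of length 1. *)
have [n Hn] := geometric_ratio_small (M1 * 4 + M2 + M3) (mulr_gt0 d0 e0) b0 ba.
pose g z := f z * landau z ^+ n.
have dg z : derivable (g : C^o -> C^o) z 1.
  have H := derivableM_C (df z) (@derivable_expr landau n z (@derivable_landau z)).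
  exact: H.
have [g1 g2 g3 g4] := continuous_reC_imC dg.
have := cauchy_rect dg n22 ltr01.
have -> : (fun x => reC g x 0 - reC g x 1) = (fun x => - (reC f x 1 * (1 - x ^+ 2 / 5) ^+ n)).
  apply/funext => x; rewrite /reC /g f0 mul0r /= sub0r landau_top -rmorphXn /=.
  by case: (f _) => u v /=; rewrite mulr0 subr0.
set J1 := int_itv _ _ _; set J2 := int_itv _ _ _.
have Hg x y M : `|x| = 2 -> 0 <= y <= 1 -> normc (f (Complex x y)) <= M ->
  `|imC g x y| <= M * b ^+ n.
  move=> x2 y01 fM; apply: (le_trans (normc_Im_le _)); rewrite /g normcM.
  apply: ler_pM => //; try exact: normc_ge0.
  have -> : normc (landau (Complex x y) ^+ n) = normc (landau (Complex x y)) ^+ n.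
    by elim: n {g dg g1 g2 g3 g4 Hn J1 J2} => [|n IH]; [rewrite !expr0 normc1|rewrite !exprS normcM IH].
  apply: lerXn2r; rewrite ?nnegrE ?normc_ge0//.
  by rewrite le_max landau_side.
have J2b : J2 <= (M2 + M3) * b ^+ n * (1 - 0).
  apply: int_itv_ub => // [y|y y01]; first by apply: cvgB; apply: cvgN; [exact: g4|exact: g4].
  have h2 : `|imC g 2 y| <= M2 * b ^+ n by apply: Hg => //; [rewrite ger0_norm|exact: HM2].
  have h3 : `|imC g (-2) y| <= M3 * b ^+ n.
    by apply: Hg => //; [rewrite normrN ger0_norm|exact: HM3].
  move: h2 h3; rewrite !ler_norml mulrDl.
  move: (imC g 2 y) (imC g (-2) y) (M2 * b ^+ n) (M3 * b ^+ n) => u v U V; lra.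
pose h x := - (reC f x 1 * (1 - x ^+ 2 / 5) ^+ n).
have ch : continuous h.
  have -> : h = (fun x => reC g x 0 - reC g x 1).
    apply/funext => x; rewrite /h /reC /g f0 mul0r /= sub0r landau_top -rmorphXn /=.
    by case: (f _) => u v /=; rewrite mulr0 subr0.
  by move=> x; apply: cvgB; [exact: (g1 0)|exact: (g1 1)].
have hout x : -2 <= x <= 2 -> e / 2 <= `|x| -> h x <= M1 * b ^+ n.
  move=> x2 xe; have xx : x ^+ 2 <= 4 by move/andP: x2 => [x2 x2']; nra.
  have k0 : 0 <= 1 - x ^+ 2 / 5 by lra.
  have [xe1|xe1] := leP `|x| e.
    apply: (@le_trans _ _ 0); last by rewrite mulr_ge0 ?exprn_ge0.
    by rewrite oppr_le0 mulr_ge0 ?exprn_ge0// (le_trans (ltW d0))// He.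
  rewrite /h -mulNr; apply: (@le_trans _ _ (`|reC f x 1| * (1 - x ^+ 2 / 5) ^+ n)).
    by rewrite ler_wpM2r ?exprn_ge0// -normrN ler_norm.
  apply: ler_pM; rewrite ?exprn_ge0//; first exact: HM1.
  apply: lerXn2r; rewrite ?nnegrE// le_max; apply/orP; right.
  by rewrite -(@real_normK _ x) ?num_real//; nra.
have hin x : - (e / 2) <= x <= e / 2 -> h x <= - (d * a ^+ n).
  move=> xe; have xe1 : `|x| <= e / 2 by rewrite ler_norml.
  rewrite /h lerN2; apply: ler_pM; rewrite ?(ltW d0) ?exprn_ge0 ?(ltW a0)//.
    by apply: He; apply: (le_trans xe1); lra.
  apply: lerXn2r; rewrite ?nnegrE ?(ltW a0)//.
    by apply: (le_trans (ltW a0)); rewrite /a -(@real_normK _ x) ?num_real//;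
      have := normr_ge0 x; move: `|x| xe1 => y y1 y0; nra.
  rewrite /a -(@real_normK _ x) ?num_real//; have := normr_ge0 x.
  by move: `|x| xe1 => y y1 y0; nra.
have J1b : J1 <= M1 * b ^+ n * (- (e / 2) - -2) + (- (d * a ^+ n) * (e / 2 - - (e / 2)) +
     M1 * b ^+ n * (2 - e / 2)).
  have i1 : -2 <= - (e / 2) by lra.
  have i2 : - (e / 2) <= e / 2 by lra.
  have i3 : e / 2 <= 2 by lra.
  have -> : J1 = int_itv h (-2) 2 by [].
  rewrite (int_itv_cat ch i1 (le_trans i2 i3)) (int_itv_cat ch i2 i3).
  apply: lerD; [|apply: lerD]; apply: int_itv_ub => //.
  - by move=> x xe; apply: hout; [lra|rewrite ler0_norm; lra].
  - by move=> x xe; apply: hout; [lra|rewrite ger0_norm; lra].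
have B0 : 0 <= M1 * b ^+ n * e by rewrite !mulr_ge0 ?exprn_ge0// ltW.
move: Hn J1b J2b B0; rewrite !mulrDl.
move: J1 J2 => J1 J2.
have -> : d * e * a ^+ n = d * a ^+ n * e by ring.
have -> : M1 * 4 * b ^+ n = M1 * b ^+ n * 4 by ring.
move: (M1 * b ^+ n) (M2 * b ^+ n) (M3 * b ^+ n) (d * a ^+ n) => P1 P2 P3 P4.
by nra.
Qed.

(** Multiplication by the conjugate of f(i) turns a nonzero value at [i] into a positive real part.
    The single point [i] is all that the symmetry of the kernel requires. *)
Lemma entire_zero f : (forall z, derivable (f : C^o -> C^o) z 1) ->
  (forall x : R, f x%:C%C = 0) -> f 'i%C = 0.
Proof.
move=> df f0; apply/eqP/negPn/negP => fi.
apply: (@entire_zero_Re (fun z => (f 'i%C)^*%C * f z)).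
- move=> z; have dc : derivable (cst (f 'i%C)^*%C : C^o -> C^o) z 1 by exact: derivable_cst.
  exact: (derivableM_C dc (df z)).
- by move=> x; rewrite f0 mulr0.
- move: fi; case: (f 'i%C) => u v; rewrite eq_complex /= negb_and mulNr opprK -!expr2 => uv.
  by rewrite lt0r paddr_eq0 ?sqr_ge0// !sqrf_eq0 addr_ge0 ?sqr_ge0// negb_and uv.
Qed.

End identity_on_the_real_axis.

(** * Root systems and the Dunkl kernel *)

Section euclid.
Context {R : realType} {d : nat}.
Implicit Types (x y z a b : 'rV[R]_d) (c : R).

Lemma dotC x y : dot x y = dot y x.
Proof. by apply: eq_bigr => j _; rewrite mulrC. Qed.

Lemma dotDl x y z : dot (x + y) z = dot x z + dot y z.
Proof. by rewrite -big_split; apply: eq_bigr => j _; rewrite mxE mulrDl. Qed.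

Lemma dotZl c x y : dot (c *: x) y = c * dot x y.
Proof. by rewrite mulr_sumr; apply: eq_bigr => j _; rewrite mxE mulrA. Qed.

Lemma dotDr x y z : dot x (y + z) = dot x y + dot x z.
Proof. by rewrite dotC dotDl !(dotC x). Qed.

Lemma dotZr c x y : dot x (c *: y) = c * dot x y.
Proof. by rewrite dotC dotZl dotC. Qed.

Lemma dotNl x y : dot (- x) y = - dot x y.
Proof. by rewrite -scaleN1r dotZl mulN1r. Qed.

Lemma dotNr x y : dot x (- y) = - dot x y.
Proof. by rewrite dotC dotNl dotC. Qed.

Lemma dotBl x y z : dot (x - y) z = dot x z - dot y z.
Proof. by rewrite dotDl dotNl. Qed.

Lemma dotBr x y z : dot x (y - z) = dot x y - dot x z.
Proof. by rewrite dotDr dotNr. Qed.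

Lemma dot0l x : dot 0 x = 0.
Proof. by rewrite -(scale0r 0) dotZl mul0r. Qed.

Lemma dot0r x : dot x 0 = 0.
Proof. by rewrite dotC dot0l. Qed.

Lemma dot_ge0 x : 0 <= dot x x.
Proof. by apply: sumr_ge0 => j _; rewrite -expr2 sqr_ge0. Qed.

Lemma sqr_coord_le_dot x j : x 0 j ^+ 2 <= dot x x.
Proof.
rewrite /dot (bigD1 j)//= -expr2 lerDl; apply: sumr_ge0 => i _.
by rewrite -expr2 sqr_ge0.
Qed.

Lemma dot_eq0 x : (dot x x == 0) = (x == 0).
Proof.
apply/eqP/eqP => [x0|->]; last exact: dot0l.
apply/rowP => j; rewrite mxE; have := sqr_coord_le_dot x j.
by rewrite x0 le_eqVlt ltNge sqr_ge0 orbF sqrf_eq0 => /eqP.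
Qed.

Lemma dot_cauchy_schwarz x y : dot x y ^+ 2 <= dot x x * dot y y.
Proof.
have [->|y0] := eqVneq y 0; first by rewrite !dot0r expr0n mulr0.
have yy : 0 < dot y y by rewrite lt_def dot_eq0 y0 dot_ge0.
have := dot_ge0 (dot y y *: x - dot x y *: y).
rewrite !(dotBl, dotBr, dotZl, dotZr) (dotC y x).
move=> h; rewrite -subr_ge0 -(pmulr_rge0 _ yy); apply: (le_trans h).
by rewrite le_eqVlt; apply/orP; left; apply/eqP; ring.
Qed.

Definition enorm x := Num.sqrt (dot x x).

Lemma enorm_ge0 x : 0 <= enorm x.
Proof. exact: sqrtr_ge0. Qed.

Lemma sqr_enorm x : enorm x ^+ 2 = dot x x.
Proof. by rewrite sqr_sqrtr// dot_ge0. Qed.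

Lemma normr_dot_le x y : `|dot x y| <= enorm x * enorm y.
Proof.
rewrite -(ler_pXn2r (n := 2))// ?nnegrE ?mulr_ge0 ?enorm_ge0//.
by rewrite real_normK ?num_real// exprMn !sqr_enorm dot_cauchy_schwarz.
Qed.

Lemma enormZ c x : enorm (c *: x) = `|c| * enorm x.
Proof.
by rewrite /enorm dotZl dotZr mulrA -expr2 sqrtrM ?sqr_ge0// sqrtr_sqr.
Qed.

Lemma enorm_eq0 x : (enorm x == 0) = (x == 0).
Proof. by rewrite sqrtr_eq0 le_eqVlt ltNge dot_ge0 orbF dot_eq0. Qed.

Lemma enorm0 : enorm 0 = 0.
Proof. by apply/eqP; rewrite enorm_eq0. Qed.

Lemma normr_coord_le x j : `|x 0 j| <= enorm x.
Proof. by rewrite -sqrtr_sqr ler_wsqrtr// sqr_coord_le_dot. Qed.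

Lemma refl_linear a c x y : refl a (c *: x + y) = c *: refl a x + refl a y.
Proof.
rewrite /refl dotDr dotZr scalerBr scalerA !mulrDr mulrDl scalerDl.
rewrite [2 * (c * _)]mulrCA -[c * _ / _]mulrA opprD.
by rewrite addrACA.
Qed.

Lemma refl0 a : refl a 0 = 0.
Proof. by rewrite /refl dot0r mulr0 mul0r scale0r subrr. Qed.

Lemma reflD a x y : refl a (x + y) = refl a x + refl a y.
Proof. by rewrite -[x]scale1r refl_linear !scale1r. Qed.

Lemma reflZ a c x : refl a (c *: x) = c *: refl a x.
Proof. by rewrite -[c *: x]addr0 refl_linear refl0 addr0. Qed.

Lemma reflB a x y : refl a (x - y) = refl a x - refl a y.
Proof. by rewrite reflD -scaleN1r reflZ scaleN1r. Qed.

Section normalized_root.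
Variables (a : 'rV[R]_d) (a2 : dot a a = 2).

Lemma reflE x : refl a x = x - dot a x *: a.
Proof. by rewrite /refl a2 mulrAC divff ?mul1r// pnatr_eq0. Qed.

Lemma dot_refl x : dot a (refl a x) = - dot a x.
Proof. by rewrite reflE dotBr dotZr a2; lra. Qed.

Lemma reflK x : refl a (refl a x) = x.
Proof. by rewrite reflE dot_refl reflE scaleNr opprK subrK. Qed.

Lemma dot_refl2 x y : dot (refl a x) (refl a y) = dot x y.
Proof.
rewrite (reflE x) dotBl dotZl dot_refl reflE dotBr dotZr (dotC x a).
by lra.
Qed.

Lemma dot_refl_swap x y : dot (refl a x) y = dot x (refl a y).
Proof. by rewrite -[in LHS](reflK y) dot_refl2. Qed.

Lemma enorm_refl x : enorm (refl a x) = enorm x.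
Proof. by rewrite /enorm dot_refl2. Qed.

Lemma refl_self : refl a a = - a.
Proof. by rewrite reflE a2 scaler_nat mulr2n opprD addrA subrr sub0r. Qed.

End normalized_root.

Lemma refl_conj a b x : dot a a = 2 -> dot b b = 2 ->
  refl b (refl a x) = refl (refl b a) (refl b x).
Proof.
move=> a2 b2; rewrite (reflE (a := refl b a)) dot_refl2// (reflE a2) reflB reflZ//.
Qed.

Lemma refl_oppl a x : dot a a = 2 -> refl (- a) x = refl a x.
Proof.
move=> a2; rewrite (reflE a2) reflE ?dotNl ?dotNr ?opprK//.
by rewrite scalerN scaleNr opprK.
Qed.

Lemma reflN b a : refl b (- a) = - refl b a.
Proof. by rewrite -scaleN1r reflZ scaleN1r. Qed.

End euclid.

Section root_system_sums.
Context {R : realType} {d : nat}.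
Variables (Phi Pos : {fset 'rV[R]_d}) (k : 'rV[R]_d -> R).
Hypotheses (rootP : root_system Phi) (normP : normalized Phi).
Hypotheses (posP : positive_subsystem Phi Pos) (kP : multiplicity_function Phi k).

Lemma Pos_sub a : a \in Pos -> a \in Phi.
Proof. by case: posP => b [_ ->] /andP[]. Qed.

Lemma Pos_dot a : a \in Pos -> dot a a = 2.
Proof. by move/Pos_sub/normP. Qed.

Lemma Phi_opp a : a \in Phi -> - a \in Phi.
Proof.
by case: rootP => _ _ /(_ a (-1)) h /h; rewrite scaleN1r eqxx orbT => ->.
Qed.

Lemma Phi_refl a b : a \in Phi -> b \in Phi -> refl a b \in Phi.
Proof. by case: rootP => _ + _; exact. Qed.

Lemma Pos_or_opp a : a \in Phi -> (a \notin Pos) = (- a \in Pos).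
Proof.
move=> aPhi; case: posP => b [b0 bP]; rewrite !bP aPhi Phi_opp//= dotNl oppr_gt0.
by rewrite -leNgt le_eqVlt (negbTE (b0 _ aPhi)).
Qed.

Lemma k_ge0 a : a \in Pos -> 0 <= k a.
Proof. by move/Pos_sub; case: kP => + _; exact. Qed.

Lemma k_refl a b : a \in Phi -> b \in Phi -> k (refl b a) = k a.
Proof.
move=> aP bP; case: kP => _; apply => //.
exact: (reflection_group_refl bP (reflection_group_id _)).
Qed.

Lemma k_opp a : a \in Phi -> k (- a) = k a.
Proof. by move=> aP; rewrite -{1}(refl_self (normP aP)) k_refl. Qed.

(** A reflection permutes the lines spanned by the roots; this is the induced permutation of the
    positive representatives. *)
Definition pos_refl b a := if refl b a \in Pos then refl b a else - refl b a.

Lemma pos_refl_Pos b a : b \in Phi -> a \in Pos -> pos_refl b a \in Pos.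
Proof.
move=> bP aP; rewrite /pos_refl; case: ifPn => //.
by rewrite Pos_or_opp// Phi_refl// Pos_sub.
Qed.

Lemma pos_reflK b a : b \in Phi -> a \in Pos -> pos_refl b (pos_refl b a) = a.
Proof.
move=> bP aP; have b2 := normP bP; rewrite {2}/pos_refl; case: ifPn => h.
  by rewrite /pos_refl reflK// aP.
by rewrite /pos_refl reflN reflK// -Pos_or_opp ?aP ?opprK// Pos_sub.
Qed.

(** [pos_refl b] is an involution of [Pos], and an even [F] takes the same value at [refl b a] and
    at its positive representative. *)
Lemma big_Pos_refl (T : Type) (idx : T) (op : Monoid.com_law idx) (F : 'rV[R]_d -> T) b :
  b \in Phi -> (forall a, a \in Phi -> F (- a) = F a) ->
  \big[op/idx]_(a <- Pos) F (refl b a) = \big[op/idx]_(a <- Pos) F a.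
Proof.
move=> bP FN; transitivity (\big[op/idx]_(a <- map (pos_refl b) Pos) F a).
  rewrite big_map big_seq [RHS]big_seq; apply: eq_bigr => a aP.
  by rewrite /pos_refl; case: ifPn => // _; rewrite FN// Phi_refl// Pos_sub.
apply: perm_big; apply: uniq_perm.
- rewrite map_inj_in_uniq ?fset_uniq// => x y xP yP h.
  by rewrite -(pos_reflK bP xP) -(pos_reflK bP yP) h.
- exact: fset_uniq.
- move=> a; apply/mapP/idP => [[x xP ->]|aP]; first exact: pos_refl_Pos.
  by exists (pos_refl b a); [exact: pos_refl_Pos|rewrite pos_reflK].
Qed.

End root_system_sums.

Section kernel_derivatives.
Context {R : realType} {d : nat}.
Local Notation C := R[i].

(** Restricting the complex increment to real [h] turns the complex derivative of [F] into real
    derivatives of the two components of [G]. It transports holomorphy of [K] to real directional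
    derivatives. *)
Lemma is_derive_ReIm (V : normedModType C) (F : V -> C^o) (a v : V)
    (W : normedModType R) (G : W -> C) (x w : W) :
  derivable F a v -> (forall h : R, G (h *: w + x) = F (h%:C%C *: v + a)) ->
  is_derive x w (fun y => complex.Re (G y) : R^o) (complex.Re ('D_v F a)) /\
  is_derive x w (fun y => complex.Im (G y) : R^o) (complex.Im ('D_v F a)).
Proof.
move=> dF GF; have Gx : G x = F a by rewrite -[x]add0r -(scale0r w) GF !scale0r add0r.
move: (dF) => /cvg_ex[/= l Fl].
have -> : 'D_v F a = l by apply/cvg_lim.
have K e : 0 < e -> \forall h \near (0 : R)^', 
    `|complex.Re l - h^-1 * (complex.Re (G (h *: w + x)) - complex.Re (G x))| <= e /\
    `|complex.Im l - h^-1 * (complex.Im (G (h *: w + x)) - complex.Im (G x))| <= e.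
  move=> e0; have eC0 : 0 < (e%:C)%C by rewrite ltcR.
  move/cvgrPdist_le : (Fl) => /(_ _ eC0); rewrite near_withinE => -[r /= r0 Hr].
  have rE : r = ((complex.Re r)%:C)%C by rewrite RRe_real// gtr0_real.
  rewrite near_withinE; exists (complex.Re r); first by rewrite /= -ltcR -rE.
  move=> h /=; rewrite sub0r normrN => hr h0.
  have := Hr h%:C%C; rewrite /= sub0r normrN.
  have -> : (`|h%:C%C| < r)%R by rewrite normc_def/= expr0n/= addr0 sqrtr_sqr rE ltcR.
  have h0' : h%:C%C != 0 :> C by apply: contra h0 => /eqP/complexI->.
  move=> /(_ isT h0'); rewrite -GF -Gx -fmorphV => H.
  have {H} : normc (l - h^-1%:C%C * (G (h *: w + x) - G x)) <= e by rewrite -lecR.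
  move=> H; have := le_trans (normc_Im_le _) H; have := le_trans (normc_Re_le _) H.
  case: l {Fl Hr H} => l1 l2; case: (G _) => u1 u2; case: (G _) => v1 v2 /=.
  by rewrite !mul0r subr0 addr0.
by split; apply: DeriveDef;
  [apply/cvg_ex; exists (complex.Re l)|apply/cvg_lim => //|
   apply/cvg_ex; exists (complex.Im l)|apply/cvg_lim => //];
  apply/cvgrPdist_le => e /K; apply: filterS => h [].
Qed.

Lemma toC_line (h : R) (v x : 'rV[R]_d) : toC (h *: v + x) = h%:C%C *: toC v + toC x.
Proof. by apply/rowP => j; rewrite !mxE rmorphD rmorphM. Qed.

Lemma toC_sum (v : 'rV[R]_d) : toC v = \sum_j (v 0 j)%:C%C *: toC (delta_mx 0 j).
Proof.
apply/rowP => i; rewrite mxE summxE (bigD1 i)//= big1 ?addr0.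
  by rewrite !mxE !eqxx mulr1.
by move=> j ji; rewrite !mxE eqxx [i == j]eq_sym (negbTE ji) mulr0.
Qed.

End kernel_derivatives.

Section kernel.
Context {R : realType} {d : nat}.
Local Notation C := R[i].
Variables (Pos : {fset 'rV[R]_d}) (k : 'rV[R]_d -> R) (K : 'rV[C]_d -> 'rV[C]_d -> C).
Hypothesis (dK : dunkl_kernel Pos k K).

Let Kp (q : 'rV[C]_d * 'rV[C]_d) : C^o := K q.1 q.2.

Lemma kernel_differentiable q : differentiable Kp q.
Proof. exact: (dK.2 q). Qed.

Lemma kernel_continuous (z w : 'rV[C]_d) (e : R) : 0 < e -> exists2 r : R, 0 < r &
  forall z' w' : 'rV[C]_d, (forall j, normc (z 0 j - z' 0 j) < r) ->
    (forall j, normc (w 0 j - w' 0 j) < r) -> normc (K z w - K z' w') < e.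
Proof.
move=> e0; have := differentiable_continuous (kernel_differentiable (z, w)).
have eC0 : 0 < (e%:C)%C by rewrite ltcR.
move=> /cvgrPdist_lt/(_ _ eC0)/nbhs_ballP[r /= r0 Hr].
have rE : r = ((complex.Re r)%:C)%C by rewrite RRe_real// gtr0_real.
exists (complex.Re r); first by rewrite -ltcR -rE.
move=> z' w' hz hw; rewrite -ltcR; apply: (Hr (z', w')).
by split; split=> //= i j; rewrite (ord1 i) /ball/= rE ltcR; [exact: hz|exact: hw].
Qed.

Lemma kernel0 z : K 0 z = 1.
Proof.
have [_ _] := dK.1 z; rewrite (_ : toC 0 = 0)//.
by apply/rowP => j; rewrite !mxE.
Qed.

Let dKp (z : 'rV[C]_d) (x v : 'rV[R]_d) : C :=
  derive Kp (toC x, z) (toC v, 0).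

Lemma is_derive_kernel z (x v : 'rV[R]_d) :
  is_derive x v (fun y => complex.Re (K (toC y) z) : R^o) (complex.Re (dKp z x v)) /\
  is_derive x v (fun y => complex.Im (K (toC y) z) : R^o) (complex.Im (dKp z x v)).
Proof.
apply: (@is_derive_ReIm _ _ Kp _ _ _ (fun y => K (toC y) z)).
  by apply: diff_derivable; exact: kernel_differentiable.
by move=> h; rewrite toC_line /Kp /= scaler0 add0r.
Qed.

Lemma deriveC_kernel z (x v : 'rV[R]_d) :
  deriveC (fun y => K (toC y) z) v x = dKp z x v.
Proof.
have [h1 h2] := is_derive_kernel z x v.
rewrite /deriveC (@derive_val _ _ _ _ _ _ _ h1) (@derive_val _ _ _ _ _ _ _ h2).
by case: (dKp _ _ _).
Qed.

Definition cdot (x : 'rV[R]_d) (z : 'rV[C]_d) : C := \sum_j (x 0 j)%:C%C * z 0 j.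

(** Directional derivatives of the kernel are linear in [v] because they are values of the
    differential of [K], a map on the product space. *)
Lemma deriveC_kernel_coord z (x v : 'rV[R]_d) :
  deriveC (fun y => K (toC y) z) v x =
  \sum_j (v 0 j)%:C%C * deriveC (fun y => K (toC y) z) (delta_mx 0 j) x.
Proof.
rewrite deriveC_kernel /dKp deriveE; last exact: kernel_differentiable.
have -> : (toC v, 0) = \sum_j (v 0 j)%:C%C *: (toC (delta_mx 0 j), 0) :> 'rV[C]_d * 'rV[C]_d.
  rewrite [RHS]surjective_pairing; congr pair.
    by rewrite raddf_sum {1}toC_sum.
  by rewrite raddf_sum big1// => j _; rewrite /= scaler0.
rewrite linear_sum; apply: eq_bigr => j _; rewrite linearZ deriveC_kernel /dKp deriveE//; exact: kernel_differentiable.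
Qed.

(** The d eigenvalue equations weighted by the coordinates of [v]: the Dunkl operator in the
    direction [v] has eigenvalue (v,z). *)
Lemma dunkl_directional z (x v : 'rV[R]_d) :
  deriveC (fun y => K (toC y) z) v x +
    \sum_(a <- Pos) (k a * dot a v)%:C%C * dunkl_quotient a (fun y => K (toC y) z) x =
  cdot v z * K (toC x) z.
Proof.
set u := fun y => K (toC y) z; have [_ eu _] := dK.1 z.
rewrite -/u in eu *.
transitivity (\sum_j (v 0 j)%:C%C * dunkl_operator Pos k j u x); last first.
  by rewrite mulr_suml; apply: eq_bigr => j _; rewrite eu mulrA.
under [RHS]eq_bigr => j _ do rewrite /dunkl_operator mulrDr.
rewrite big_split -deriveC_kernel_coord; congr (_ + _).
under [RHS]eq_bigr => j _ do rewrite mulr_sumr.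
rewrite exchange_big; apply: eq_bigr => a _ /=.
rewrite /dot mulr_sumr rmorph_sum mulr_suml; apply: eq_bigr => j _.
rewrite [RHS]mulrA -[in RHS]rmorphM; congr (_%:C%C * _).
by ring.
Qed.

(* The hyperplane terms drop out since [refl a x = x] when [dot a x = 0]: the identity has no singularities. *)
Lemma kernel_euler z (x : 'rV[R]_d) :
  deriveC (fun y => K (toC y) z) x x +
    \sum_(a <- Pos) (k a)%:C%C * (K (toC x) z - K (toC (refl a x)) z) =
  cdot x z * K (toC x) z.
Proof.
rewrite -dunkl_directional; congr (_ + _); apply: eq_bigr => a _.
rewrite rmorphM -mulrA; congr (_ * _); rewrite /dunkl_quotient.
case: eqP => [ax|/eqP ax]; last by rewrite mulrC divfK// (inj_eq (@complexI R)).
by rewrite ax mul0r /refl ax mulr0 mul0r scale0r subr0 subrr.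
Qed.

End kernel.

(** * The maximum principle and bounds for the kernel *)

Section rays.
Context {R : realType} {d : nat}.
Implicit Types (x y z : 'rV[R]_d).

Lemma is_derive_line (f : 'rV[R]_d -> R) (l r : R) x v :
  is_derive (r *: v + x) v (f : _ -> R^o) l ->
  is_derive r 1 (fun s : R => f (s *: v + x)) l.
Proof.
move=> [df dl].
have E : (fun h : R => h^-1 *: (((fun s : R => f (s *: v + x)) \o shift r) (h *: 1) - f (r *: v + x))) =
  (fun h : R => h^-1 *: ((f \o shift (r *: v + x)) (h *: v) - f (r *: v + x) : R^o)).
  by apply/funext => h /=; rewrite [h *: 1]mulr1 scalerDl addrA.
apply: DeriveDef; first by rewrite /derivable E; exact: df.
by rewrite /derive E; exact: dl.
Qed.

Lemma is_derive_ray (f : 'rV[R]_d -> R) (l r : R) x :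
  is_derive (r *: x) x (f : _ -> R^o) l -> is_derive r 1 (fun s : R => f (s *: x)) l.
Proof.
move=> H; have : is_derive (r *: x + 0) x (f : _ -> R^o) l by rewrite addr0.
move=> /is_derive_line; set g := (X in is_derive _ _ X _).
by rewrite (_ : g = (fun s : R => f (s *: x)))//; apply/funext => s; rewrite /g addr0.
Qed.

Lemma is_derive_ray1 (f : 'rV[R]_d -> R) (l : R) x :
  is_derive x x (f : _ -> R^o) l -> is_derive (1 : R) 1 (fun s : R => f (s *: x)) l.
Proof. by move=> H; apply: is_derive_ray; rewrite scale1r. Qed.

Lemma is_derive_left_max_ge0 (f : R -> R) (l : R) : is_derive (1 : R) 1 f l ->
  (forall r, 0 <= r <= 1 -> f r <= f 1) -> 0 <= l.
Proof.
move=> [/cvg_ex[/= m fm] <-] Hf.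
have -> : 'D_1 f 1 = m by apply/cvg_lim.
rewrite leNgt; apply/negP => m0; move/cvgrPdist_lt : fm => /(_ (- m)).
rewrite oppr_gt0 => /(_ m0); rewrite near_withinE => -[r /= r0 Hr].
pose h := - Num.min (r / 2) 1.
have h0 : h < 0 by rewrite oppr_lt0 lt_min ltr01 divr_gt0.
have h1 : -1 <= h by rewrite lerN2 ge_min lexx orbT.
have hr : `|h| < r.
  rewrite ltr0_norm// opprK; apply: (@le_lt_trans _ _ (r / 2)).
    by rewrite ge_min lexx.
  by rewrite ltr_pdivrMr// ltr_pMr// ltr1n.
have /= := Hr h; rewrite sub0r normrN => /(_ hr); rewrite lt_eqF// => /(_ isT).
rewrite [_%:A]mulr1 => H; have : 0 <= h^-1 *: (f (h + 1) - f 1).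
  by apply: mulr_le0; [rewrite invr_le0 ltW|rewrite subr_le0; apply: Hf; lra].
by move: H; move: (_ *: _) => q /ltr_normlP[]; lra.
Qed.

Lemma continuous_dot x : continuous (fun y => dot x y).
Proof.
apply: continuous_big => [p|j _ y].
  by apply: cvgD; [exact: cvg_fst|exact: cvg_snd].
have c : continuous (fun y : 'rV[R]_d => y 0 j) by exact: coord_continuous.
have h : (fun y : 'rV[R]_d => x 0 j) @ y --> x 0 j by exact: cst_continuous.
exact: (cvgM h (c y)).
Qed.

Lemma continuous_sqr_norm : continuous (fun y : 'rV[R]_d => dot y y).
Proof.
apply: continuous_big => [p|j _ y].
  by apply: cvgD; [exact: cvg_fst|exact: cvg_snd].
have c : continuous (fun y : 'rV[R]_d => y 0 j) by exact: coord_continuous.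
exact: (cvgM (c y) (c y)).
Qed.

Lemma continuous_enorm : continuous (fun y : 'rV[R]_d => enorm y).
Proof.
move=> y; apply: (@continuous_comp _ _ _ (fun y : 'rV[R]_d => dot y y) Num.sqrt).
  exact: continuous_sqr_norm.
exact: sqrt_continuous.
Qed.

Lemma compact_eball (r : R) : compact [set y : 'rV[R]_d | enorm y <= r].
Proof.
apply: bounded_closed_compact.
  exists r; split; first exact: num_real.
  move=> s rs y /= yr; apply: le_trans (ltW rs); apply: le_trans yr.
  rewrite [X in X <= _]/Num.norm /=.
  have [->|/mx_norm_neq0[[i j] ->]] := eqVneq (mx_norm y) 0; first exact: enorm_ge0.
  by rewrite (ord1 i) /=; exact: normr_coord_le.
apply: (@preimage_closed _ _ (fun y => enorm y) [set z | z <= r]).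
  by move=> y _; exact: continuous_enorm.
exact: closed_le.
Qed.

End rays.

Section maximum_principle.
Context {R : realType} {d : nat}.
Variables (Pos : {fset 'rV[R]_d}) (k : 'rV[R]_d -> R).
Hypotheses (k0 : forall a, a \in Pos -> 0 <= k a) (norm2 : forall a, a \in Pos -> dot a a = 2).
Implicit Types (x y : 'rV[R]_d).

(** The nonlocal term of the Euler identity. As k >= 0 and reflections preserve balls, it is
    nonnegative at a point where [u] is maximal on a ball; the estimates of this part rest on that
    sign. *)
Definition refl_defect (u : 'rV[R]_d -> R) x := \sum_(a <- Pos) k a * (u x - u (refl a x)).

(** Twice P(P - p') + Q(Q - q') equals (P - p')^2 + (Q - q')^2 plus the difference of the squared
    moduli. This is the sign of the reflection terms for the pair of components of a complex
    function. *)
Lemma refl_defect_sum2_ge0 (x : 'rV[R]_d) (p q p' q' : 'rV[R]_d -> R) (P Q : R) :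
  (forall a, a \in Pos -> p' a ^+ 2 + q' a ^+ 2 <= P ^+ 2 + Q ^+ 2) ->
  0 <= P * (\sum_(a <- Pos) k a * (P - p' a)) + Q * (\sum_(a <- Pos) k a * (Q - q' a)).
Proof.
move=> H; rewrite !mulr_sumr -big_split/= big_seq sumr_ge0// => a aP.
rewrite (_ : _ + _ = k a * (P * (P - p' a) + Q * (Q - q' a))); last by ring.
rewrite mulr_ge0 ?k0//; have := H a aP.
have := sqr_ge0 (P - p' a); have := sqr_ge0 (Q - q' a).
by move: (p' a) (q' a) => u v; nra.
Qed.

Variables (u v : 'rV[R]_d -> R) (be la : 'rV[R]_d).
Hypotheses (cu : continuous u) (cv : continuous v).
Hypothesis (du : forall x, is_derive x x (u : _ -> R^o)
  (- refl_defect u x + dot x be * u x - dot x la * v x)).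
Hypothesis (dv : forall x, is_derive x x (v : _ -> R^o)
  (- refl_defect v x + dot x be * v x + dot x la * u x)).

(** Here u + i v has the complex eigenvalue be + i la. At a point p where the damped square |u + i
    v|^2 exp(-c |y|) is maximal on the ball, its radial derivative is nonnegative. If p and the
    value there were nonzero, the equation would make that derivative negative: the reflection terms
    have a good sign since reflected points carry the same damping, the rotation by [la] cancels,
    and 2 (p,be) is smaller than c |p|. *)
Lemma max_principle c x : 2 * enorm be < c ->
  u x ^+ 2 + v x ^+ 2 <= (u 0 ^+ 2 + v 0 ^+ 2) * expR (c * enorm x).
Proof.
move=> bc; pose G y := u y ^+ 2 + v y ^+ 2.
pose q y := G y * expR (- c * enorm y).
have cq : continuous q.
  move=> y; have hG : G z @[z --> y] --> G y.
    exact: (cvgD (cvgM (@cu y) (@cu y)) (cvgM (@cv y) (@cv y))).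
  have h : (fun y : 'rV[R]_d => - c) @ y --> - c by exact: cst_continuous.
  have h2 : {for y, continuous (fun y : 'rV[R]_d => - c * enorm y)}.
    exact: (cvgM h (@continuous_enorm _ _ y)).
  have hE := continuous_comp h2 (@continuous_expR R _).
  exact: (cvgM hG hE).
have [|p pB Hp] := EVT_max_rV _ (@compact_eball R d (enorm x)) (continuous_subspaceT cq).
  by exists 0; rewrite /= enorm0 enorm_ge0.
have {}Hp y : enorm y <= enorm x -> q y <= q p by move=> h; apply: Hp; rewrite inE.
have {}pB : enorm p <= enorm x by rewrite inE in pB.
have [p0|p0] := eqVneq p 0.
  have := Hp x (lexx _); rewrite /q p0 enorm0 mulr0 expR0 mulr1 mulNr expRN.
  by rewrite ler_pdivrMr ?expR_gt0.
have [Gp|Gp] := eqVneq (G p) 0.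
  have := Hp x (lexx _); rewrite /q Gp mul0r pmulr_lle0 ?expR_gt0// => G0.
  by apply: (le_trans G0); rewrite mulr_ge0 ?expR_ge0// addr_ge0 ?sqr_ge0.
exfalso; have Gp0 : 0 < G p by rewrite lt_def Gp addr_ge0 ?sqr_ge0.
pose n := enorm p; have n0 : 0 < n by rewrite lt_def enorm_eq0 p0 enorm_ge0.
have h1 := is_derive_ray1 (du p); have h2 := is_derive_ray1 (dv p).
set du1 := - refl_defect u p + _ - _ in h1.
set dv1 := - refl_defect v p + _ + _ in h2.
(* This is [q] along the ray through [p]; for r >= 0 the norm of r p is n r, so no norm has to be
   differentiated. *)
pose f r := (u (r *: p) * u (r *: p) + v (r *: p) * v (r *: p)) * expR (- c * n * r).
have hf : is_derive (1 : R) 1 f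
   (((u p * du1 + u p * du1) + (v p * dv1 + v p * dv1)) * expR (- c * n) +
    G p * (expR (- c * n) * (- c * n))).
  have e1 : is_derive (1 : R) 1 (fun r : R => - c * n * r) (- c * n).
    have := @is_deriveZ _ _ _ id (- c * n) (1 : R) 1 1 (is_derive_id _ _).
    by rewrite [_ *: _]mulr1.
  have e2 := @is_derive1_comp R expR _ 1 _ _ (is_derive_expR _) e1.
  have e3 := is_deriveM (is_deriveD (is_deriveM h1 h1) (is_deriveM h2 h2)) e2.
  apply: (is_derive_eq e3); rewrite !fctE !scale1r /comp mulr1 /G.
  by rewrite -![_ *: _]/(_ * _); ring.
suff Hf : forall r, 0 <= r <= 1 -> f r <= f 1; last first.
  move=> r /andP[r0 r1]; rewrite /f mulr1 scale1r.
  have := Hp (r *: p); rewrite /q /G enormZ (ger0_norm r0) -/n !expr2.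
  rewrite [- c * (r * n)]mulrCA [r * (- c * n)]mulrC; apply.
  by rewrite (le_trans _ pB)// -/n ger_pMl.
have := is_derive_left_max_ge0 hf Hf; rewrite leNgt => /negP; apply.
rewrite [X in _ + X < 0]mulrCA [X in _ + X < 0]mulrC -mulrDl pmulr_llt0 ?expR_gt0//.
have key : 0 <= u p * refl_defect u p + v p * refl_defect v p.
  apply: (@refl_defect_sum2_ge0 p u v (fun a => u (refl a p)) (fun a => v (refl a p))).
  move=> a aP; have := Hp (refl a p); rewrite /q enorm_refl ?norm2// pB => /(_ isT).
  by rewrite ler_pM2r// expR_gt0.
have bn : dot p be <= enorm be * n.
  by rewrite (le_trans (ler_norm _))// (le_trans (normr_dot_le _ _))// mulrC.
have -> : u p * du1 + u p * du1 + (v p * dv1 + v p * dv1) + G p * (- c * n) =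
  - 2 * (u p * refl_defect u p + v p * refl_defect v p) + G p * (2 * dot p be - c * n).
  by rewrite /du1 /dv1 /G; ring.
rewrite -[ltRHS]addr0 ler_ltD//; first by rewrite mulNr oppr_le0 mulr_ge0.
rewrite pmulr_rlt0// subr_lt0.
apply: (@le_lt_trans _ _ (2 * (enorm be * n))); first by rewrite ler_pM2l.
by rewrite mulrA ltr_pM2r.
Qed.

End maximum_principle.

(** * Lipschitz bound by doubling the variables *)

Section lipschitz_principle.
Context {R : realType} {d : nat}.
Variables (Pos : {fset 'rV[R]_d}) (k : 'rV[R]_d -> R).
Hypotheses (k0 : forall a, a \in Pos -> 0 <= k a) (norm2 : forall a, a \in Pos -> dot a a = 2).
Implicit Types (x y : 'rV[R]_d).
Local Notation refl_defect := (refl_defect Pos k).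

Variables (u v : 'rV[R]_d -> R) (la : 'rV[R]_d).
Hypotheses (cu : continuous u) (cv : continuous v).
Hypothesis (du : forall x, is_derive x x (u : _ -> R^o) (- refl_defect u x - dot x la * v x)).
Hypothesis (dv : forall x, is_derive x x (v : _ -> R^o) (- refl_defect v x + dot x la * u x)).
Hypothesis uv1 : forall x, u x ^+ 2 + v x ^+ 2 <= 1.

Let G x y := (u x - u y) ^+ 2 + (v x - v y) ^+ 2.

Let G_ge0 x y : 0 <= G x y. Proof. by rewrite addr_ge0 ?sqr_ge0. Qed.

Let continuous_G : continuous (fun p : 'rV[R]_d * 'rV[R]_d => G p.1 p.2).
Proof.
move=> p.
have c1 : {for p, continuous (fun q : 'rV[R]_d * 'rV[R]_d => u q.1)}.
  by apply: continuous_comp; [exact: cvg_fst|exact: cu].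
have c2 : {for p, continuous (fun q : 'rV[R]_d * 'rV[R]_d => u q.2)}.
  by apply: continuous_comp; [exact: cvg_snd|exact: cu].
have c3 : {for p, continuous (fun q : 'rV[R]_d * 'rV[R]_d => v q.1)}.
  by apply: continuous_comp; [exact: cvg_fst|exact: cv].
have c4 : {for p, continuous (fun q : 'rV[R]_d * 'rV[R]_d => v q.2)}.
  by apply: continuous_comp; [exact: cvg_snd|exact: cv].
have c5 : {for p, continuous (fun q : 'rV[R]_d * 'rV[R]_d => u q.1 - u q.2)}.
  exact: (cvgB c1 c2).
have c6 : {for p, continuous (fun q : 'rV[R]_d * 'rV[R]_d => v q.1 - v q.2)}.
  exact: (cvgB c3 c4).
exact: (cvgD (cvgM c5 c5) (cvgM c6 c6)).
Qed.

(** The quotient of [G] by (|x - y| + e)^2 is maximized over a product of two balls, [e] keeping the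
    denominator positive. At a maximizing pair both points are dilated together, so only radial
    derivatives occur. Reflecting both points by the same root preserves their distance and the
    balls, which gives the reflection terms their sign; what is left is linear in (p - p', la). *)
Let lipschitz_delta (e : R) x y : 0 < e -> G x y <= (enorm la * (enorm (x - y) + e)) ^+ 2.
Proof.
move=> e0; pose D (p : 'rV[R]_d * 'rV[R]_d) := enorm (p.1 - p.2) + e.
have D0 p : 0 < D p by rewrite ltr_wpDl// enorm_ge0.
pose q p := G p.1 p.2 / D p ^+ 2.
have cq : continuous q.
  move=> p; have cD : {for p, continuous D}.
    have h : (fun _ : 'rV[R]_d * 'rV[R]_d => e) @ p --> e by exact: cst_continuous.
    have h2 : {for p, continuous (fun z : 'rV[R]_d * 'rV[R]_d => enorm (z.1 - z.2))}.
      apply: (@continuous_comp _ _ _ (fun z : 'rV[R]_d * 'rV[R]_d => z.1 - z.2) (@enorm R d)).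
        by apply: cvgB; [exact: cvg_fst|exact: cvg_snd].
      exact: continuous_enorm.
    exact: (cvgD h2 h).
  have D20 : D p * D p != 0 by rewrite mulf_neq0// gt_eqF.
  exact: (cvgM (@continuous_G p) (cvgV D20 (cvgM cD cD))).
pose r := Num.max (enorm x) (enorm y).
pose B := [set z : 'rV[R]_d | enorm z <= r].
have cB : compact (B `*` B) by apply: compact_setX; exact: compact_eball.
have Bxy : (B `*` B) (x, y) by split; rewrite /B/= /r le_max lexx ?orbT.
have [|p pB Hp] := compact_EVT_max _ cB (continuous_subspaceT cq).
  by exists (x, y).
have {}Hp z : (B `*` B) z -> q z <= q p by move=> h; apply: Hp; rewrite inE.
rewrite inE in pB.
suff qp : q p <= enorm la ^+ 2.
  have := le_trans (Hp _ Bxy) qp; rewrite /q /= ler_pdivrMr ?exprn_gt0//.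
  by rewrite exprMn.
case: p pB Hp => p p' [/= pB p'B] Hp.
pose n := enorm (p - p'); pose L := enorm la.
have n0 : 0 <= n := enorm_ge0 _; have L0 : 0 <= L := enorm_ge0 _.
set M := q (p, p') in Hp *.
have M0 : 0 <= M by rewrite divr_ge0// exprn_ge0// ltW.
have GM z z' : B z -> B z' -> G z z' <= M * (enorm (z - z') + e) ^+ 2.
  by move=> zB z'B; have := Hp (z, z') (conj zB z'B); rewrite {1}/q/= ler_pdivrMr// exprn_gt0// D0.
have GE : G p p' = M * (n + e) ^+ 2.
  by rewrite /M /q/= divfK// expf_neq0// gt_eqF// D0.
have h1 := is_derive_ray1 (du p); have h2 := is_derive_ray1 (dv p).
have h3 := is_derive_ray1 (du p'); have h4 := is_derive_ray1 (dv p').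
set du1 := - refl_defect u p - _ in h1; set dv1 := - refl_defect v p + _ in h2.
set du2 := - refl_defect u p' - _ in h3; set dv2 := - refl_defect v p' + _ in h4.
(* The maximum M of the quotient is multiplied out; since |s p - s p'| = s n for s >= 0, the
   subtracted term is a polynomial in [s]. *)
pose f := ((fun s : R => u (s *: p)) - (fun s : R => u (s *: p'))) *
          ((fun s : R => u (s *: p)) - (fun s : R => u (s *: p'))) +
          ((fun s : R => v (s *: p)) - (fun s : R => v (s *: p'))) *
          ((fun s : R => v (s *: p)) - (fun s : R => v (s *: p'))) -
          (fun s => M * (s * n + e) ^+ 2).
have hf : is_derive (1 : R) 1 f
   (2 * ((u p - u p') * (du1 - du2) + (v p - v p') * (dv1 - dv2)) - M * (2 * n * (n + e))).
  have e1 : is_derive (1 : R) 1 (fun s : R => M * (s * n + e) ^+ 2) (M * (2 * n * (n + e))).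
    by apply: is_derive_eq; rewrite ?scaler0 ?addr0 ?mul1r /GRing.scale/=; ring.
  have e5 := is_deriveB h1 h3; have e6 := is_deriveB h2 h4.
  have e3 := is_deriveB (is_deriveD (is_deriveM e5 e5) (is_deriveM e6 e6)) e1.
  apply: (is_derive_eq e3); rewrite !fctE !scale1r.
  by rewrite -![_ *: _]/(_ * _); ring.
have fE s : 0 <= s -> f s = G (s *: p) (s *: p') - M * (enorm (s *: p - s *: p') + e) ^+ 2.
  by move=> s0; rewrite -scalerBr enormZ ger0_norm.
have sB s z : 0 <= s <= 1 -> B z -> B (s *: z).
  move=> /andP[s0 s1]; rewrite /B/= enormZ ger0_norm//; apply: le_trans.
  by rewrite ler_piMl// enorm_ge0.
have Hf s : 0 <= s <= 1 -> f s <= f 1.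
  move=> /[dup] /andP[s0 _] s01; rewrite !fE// !scale1r GE subrr subr_le0.
  by apply: GM; exact: sB.
have := is_derive_left_max_ge0 hf Hf.
have key : 0 <= (u p - u p') * (refl_defect u p - refl_defect u p') +
                (v p - v p') * (refl_defect v p - refl_defect v p').
  have E w : refl_defect w p - refl_defect w p' =
      \sum_(a <- Pos) k a * ((w p - w p') - (w (refl a p) - w (refl a p'))).
    by rewrite /refl_defect -sumrB; apply: eq_bigr => a _; ring.
  rewrite !E; apply: (@refl_defect_sum2_ge0 _ _ _ _ k0 p (fun z => 0) (fun z => 0)
     (fun a => u (refl a p) - u (refl a p')) (fun a => v (refl a p) - v (refl a p'))).
  move=> a aP; apply: le_trans (GM _ _ _ _) _; rewrite /B/= ?enorm_refl ?norm2//.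
  by rewrite -reflB enorm_refl ?norm2// -GE.
pose g := Num.sqrt (G p p').
have g0 : 0 <= g := sqrtr_ge0 _.
have gG : g ^+ 2 = G p p' by rewrite sqr_sqrtr.
(* The cross product of the increment with the value at [p'], which is what the rotation terms
   leave; Cauchy-Schwarz and |u + i v| <= 1 bound it by the length [g] of the increment. *)
pose A := (v p - v p') * u p' - (u p - u p') * v p'.
have Ag : `|A| <= g.
  rewrite -(ler_pXn2r (n := 2))// ?nnegrE// real_normK ?num_real// gG.
  have := sqr_ge0 ((u p - u p') * u p' + (v p - v p') * v p').
  have : G p p' * (u p' ^+ 2 + v p' ^+ 2) <= G p p' by rewrite ler_piMr.
  by rewrite /A /G; move: (u p) (u p') (v p) (v p') => a b c f1; nra.
have dn : `|dot (p - p') la| <= n * L by exact: normr_dot_le.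
have -> : (u p - u p') * (du1 - du2) + (v p - v p') * (dv1 - dv2) =
   - ((u p - u p') * (refl_defect u p - refl_defect u p') +
      (v p - v p') * (refl_defect v p - refl_defect v p')) + dot (p - p') la * A.
  by rewrite /du1 /du2 /dv1 /dv2 /A dotBl; ring.
have dA : dot (p - p') la * A <= n * L * g.
  apply: (le_trans (ler_norm _)); rewrite normrM; exact: ler_pM.
move: key; move: (_ + _ : R) => key key0 H.
have H2 : M * (n * (n + e)) <= n * L * g.
  by move: H dA; move: (dot _ _ * A) => z; lra.
have gE : g ^+ 2 = M * (n + e) ^+ 2 by rewrite gG.
have ne : 0 < n + e by rewrite ltr_wpDl.
have [nz|nz] := eqVneq n 0.
  suff : g = 0 by move=> gz; move: gE; rewrite gz expr0n /= => /esym/eqP;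
    rewrite mulf_eq0 expf_eq0 /= (gt_eqF ne) orbF => /eqP ->; rewrite sqr_ge0.
  have pp : p = p' by apply/eqP; rewrite -subr_eq0 -enorm_eq0; apply/eqP.
  by rewrite /g /G pp !subrr expr0n addr0 sqrtr0.
have n1 : 0 < n by rewrite lt_def nz.
have [gz|gz] := eqVneq g 0.
  move: gE; rewrite gz expr0n /= => /esym/eqP.
  by rewrite mulf_eq0 expf_eq0 /= (gt_eqF ne) orbF => /eqP ->; rewrite sqr_ge0.
have g1 : 0 < g by rewrite lt_def gz.
have H3 : M * (n + e) <= L * g by rewrite -(ler_pM2l n1) mulrCA [X in _ <= X]mulrA.
have H4 : g <= L * (n + e).
  rewrite -(ler_pM2l g1) -expr2 gE expr2 mulrA [g * _]mulrA [g * L]mulrC.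
  by rewrite ler_pM2r.
rewrite -(ler_pM2r (exprn_gt0 2 ne)) -gE -exprMn lerXn2r ?nnegrE//.
by rewrite mulr_ge0// ltW.
Qed.

Lemma lipschitz_principle x y :
  (u x - u y) ^+ 2 + (v x - v y) ^+ 2 <= (enorm la * enorm (x - y)) ^+ 2.
Proof.
rewrite -[leLHS]/(G x y) -(sqr_sqrtr (G_ge0 x y)) lerXn2r ?nnegrE ?sqrtr_ge0 ?mulr_ge0 ?enorm_ge0//.
apply/ler_addgt0Pr => e e0.
have L1 : 0 < enorm la + 1 by rewrite ltr_wpDl// enorm_ge0.
have := lipschitz_delta x y (divr_gt0 e0 L1).
rewrite -(sqr_sqrtr (G_ge0 x y)) ler_pXn2r ?nnegrE ?sqrtr_ge0//; last first.
  by rewrite mulr_ge0 ?addr_ge0 ?enorm_ge0// divr_ge0// ltW.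
rewrite (sqr_sqrtr (G_ge0 x y)) => H; apply: (le_trans H); rewrite mulrDr lerD2l mulrCA ler_piMr ?(ltW e0)//.
by rewrite ler_pdivrMr// mul1r lerDl.
Qed.

End lipschitz_principle.

(** * Uniqueness from the radial equation and symmetry *)

Section radial_uniqueness.
Context {R : realType} {d : nat}.
Variables (Phi Pos : {fset 'rV[R]_d}) (k : 'rV[R]_d -> R).
Hypotheses (rootP : root_system Phi) (normP : normalized Phi).
Hypotheses (posP : positive_subsystem Phi Pos) (kP : multiplicity_function Phi k).
Implicit Types (x y t : 'rV[R]_d).
Local Notation refl_defect := (refl_defect Pos k).

Let k0 a : a \in Pos -> 0 <= k a. Proof. exact: (k_ge0 posP kP). Qed.
Let norm2 a : a \in Pos -> dot a a = 2. Proof. exact: (Pos_dot normP posP). Qed.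

(** The Euler identity for a real function and a real eigenvalue: differentiating at [x] in the
    direction [x] is the Euler operator. Keeping this one scalar equation makes it easy to verify
    for the transformed families below. *)
Definition radial_eigen (u : 'rV[R]_d -> R) t := continuous u /\
  forall x, is_derive x x (u : _ -> R^o) (- refl_defect u x + dot x t * u x).

(** The difference, paired with the zero function, falls under [max_principle] with be = t and la =
    0. It vanishes at the origin, hence everywhere. *)
Lemma radial_eigen_uniq (u v : 'rV[R]_d -> R) t : radial_eigen u t -> radial_eigen v t ->
  u 0 = v 0 -> forall x, u x = v x.
Proof.
move=> [cu du] [cv dv] uv0 x; apply/eqP; rewrite -subr_eq0 -sqrf_eq0.
rewrite eq_le sqr_ge0 andbT.
pose w x := u x - v x.
have cw : continuous w by move=> y; exact: (cvgB (@cu y) (@cv y)).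
have cz : continuous (fun _ : 'rV[R]_d => (0 : R)) by move=> y; exact: cst_continuous.
have dw y : is_derive y y (w : _ -> R^o) (- refl_defect w y + dot y t * w y - dot y 0 * 0).
  apply: (is_derive_eq (is_deriveB (du y) (dv y))).
  have -> : refl_defect w y = refl_defect u y - refl_defect v y.
    by rewrite /refl_defect -sumrB; apply: eq_bigr => a _; rewrite /w; ring.
  by rewrite /w mulr0 subr0; ring.
have dz y : is_derive y y ((fun _ : 'rV[R]_d => (0 : R)) : _ -> R^o)
    (- refl_defect (fun=> 0) y + dot y t * 0 + dot y 0 * w y).
  apply: (is_derive_eq (is_derive_cst _ _ _)).
  rewrite dot0r mul0r mulr0 !addr0 /refl_defect big1 ?oppr0// => a _.
  by rewrite addr0 mulr0.
have := max_principle k0 norm2 cw cz dw dz x (c := 2 * enorm t + 1).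
rewrite ltrDl => /(_ ltr01).
by rewrite /w uv0 subrr expr0n !addr0 mul0r.
Qed.

Variable W : 'rV[R]_d -> 'rV[R]_d -> R.
Hypothesis W_eigen : forall t, radial_eigen (W ^~ t) t.
Hypothesis cW : forall x, continuous (W x).
Hypothesis W0 : forall t t', W 0 t = W 0 t'.

Lemma radial_eigen_scale r x t : W (r *: x) t = W x (r *: t).
Proof.
apply: (@radial_eigen_uniq (fun x => W (r *: x) t) (W ^~ (r *: t)) (r *: t)) => //; last first.
  by rewrite scaler0.
have [c dW] := W_eigen t; split.
  move=> y; apply: (@continuous_comp _ _ _ (fun z : 'rV[R]_d => r *: z) (W ^~ t)).
    exact: scaler_continuous.
  exact: c.
move=> y; have [dw vw] := dW (r *: y).
have E : (fun h : R => h^-1 *: (((fun x => W (r *: x) t) \o shift y) (h *: y) - W (r *: y) t)) =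
  (fun h : R => h^-1 *: (((W ^~ t) \o shift (r *: y)) (h *: (r *: y)) - W (r *: y) t : R^o)).
  apply/funext => h /=; have -> : r *: (h *: y + y) = h *: (r *: y) + r *: y.
    by rewrite scalerDr !scalerA mulrC.
  by [].
apply: DeriveDef; first by rewrite /derivable E; exact: dw.
rewrite /derive E; etransitivity; first exact: vw.
rewrite dotZl -dotZr; congr (- _ + _ * _).
by apply: eq_bigr => a _; rewrite reflZ.
Qed.

(** Both sides solve the radial equation with eigenvalue [t]: conjugation by [refl b] permutes the
    reflections occurring in the defect, and [k] is constant along the permutation. *)
Lemma radial_eigen_refl b x t : b \in Phi -> W (refl b x) (refl b t) = W x t.
Proof.
move=> bP; have b2 := normP bP.
apply: (@radial_eigen_uniq (fun x => W (refl b x) (refl b t)) (W ^~ t) t) => //; last first.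
  by rewrite refl0; exact: W0.
have [c dW] := W_eigen (refl b t).
have cr : continuous (refl b : 'rV[R]_d -> 'rV[R]_d).
  move=> y; have h : {for y, continuous (fun z : 'rV[R]_d => (2 * dot b z / dot b b) *: b)}.
    have h1 : (fun _ : 'rV[R]_d => (2 : R)) @ y --> (2 : R) by exact: cst_continuous.
    have h2 : (fun _ : 'rV[R]_d => (dot b b)^-1) @ y --> (dot b b)^-1 by exact: cst_continuous.
    have hc : 2 * dot b z / dot b b @[z --> y] --> 2 * dot b y / dot b b.
      exact: (cvgM (cvgM h1 (@continuous_dot _ _ b y)) h2).
    by apply: cvgZr_tmp; [exact: nbhs_filter|exact: hc].
  have h0 : (fun z : 'rV[R]_d => z) @ y --> y by exact: cvg_id.
  exact: (cvgB h0 h).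
split.
  move=> y; apply: (@continuous_comp _ _ _ (refl b) (W ^~ (refl b t))); first exact: cr.
  exact: c.
move=> y; have [dw vw] := dW (refl b y).
have E : (fun h : R => h^-1 *: (((fun x => W (refl b x) (refl b t)) \o shift y) (h *: y) -
   W (refl b y) (refl b t))) =
  (fun h : R => h^-1 *: (((W ^~ (refl b t)) \o shift (refl b y)) (h *: (refl b y)) -
   W (refl b y) (refl b t) : R^o)).
  by apply/funext => h /=; rewrite reflD reflZ.
apply: DeriveDef; first by rewrite /derivable E; exact: dw.
rewrite /derive E; etransitivity; first exact: vw.
rewrite dot_refl2//; congr (- _ + _).
rewrite /refl_defect -(@big_Pos_refl _ _ _ _ rootP normP posP _ _ _
  (fun a => k a * (W (refl b y) (refl b t) - W (refl a (refl b y)) (refl b t))) b bP).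
  rewrite big_seq [RHS]big_seq; apply: eq_bigr => a aP; have a2 := norm2 aP.
  by rewrite (k_refl kP (Pos_sub posP aP) bP) -refl_conj.
by move=> a aP; rewrite (k_opp normP kP aP) refl_oppl// normP.
Qed.

(** As a function of its second argument [W x] satisfies the radial equation with eigenvalue [x]:
    scaling moves a dilation, and equivariance a reflection, from the second argument to the first,
    where the equation is known. Uniqueness then identifies it with the function [W ^~ x]. *)
Lemma radial_eigen_sym x t : W x t = W t x.
Proof.
apply: (@radial_eigen_uniq (W x) (W ^~ x) x) => //; last first.
  by rewrite -(scale0r x) -radial_eigen_scale scale0r; exact: W0.
split; first exact: cW.
move=> y; have [c dW] := W_eigen y; have [dw vw] := dW x.
have E : (fun h : R => h^-1 *: ((W x \o shift y) (h *: y) - W x y)) =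
  (fun h : R => h^-1 *: (((W ^~ y) \o shift x) (h *: x) - W x y : R^o)).
  apply/funext => h /=; rewrite -[X in W x (_ + X)]scale1r -scalerDl.
  by rewrite -[X in W (_ + X) _]scale1r -scalerDl radial_eigen_scale.
apply: DeriveDef; first by rewrite /derivable E; exact: dw.
rewrite /derive E; etransitivity; first exact: vw.
rewrite dotC; congr (- _ + _).
rewrite /refl_defect big_seq [RHS]big_seq; apply: eq_bigr => a aP.
rewrite -(radial_eigen_refl (refl a x) y (Pos_sub posP aP)) reflK//.
exact: norm2.
Qed.

End radial_uniqueness.

Section kernel_symmetry.
Context {R : realType} {d : nat}.
Local Notation C := R[i].
Variables (Phi Pos : {fset 'rV[R]_d}) (k : 'rV[R]_d -> R) (K : 'rV[C]_d -> 'rV[C]_d -> C).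
Hypotheses (rootP : root_system Phi) (normP : normalized Phi).
Hypotheses (posP : positive_subsystem Phi Pos) (kP : multiplicity_function Phi k).
Hypothesis (dK : dunkl_kernel Pos k K).
Implicit Types (x y t v : 'rV[R]_d).

Lemma normc_real_complex (r : R) : normc r%:C%C = `|r|.
Proof. by rewrite /= expr0n addr0 sqrtr_sqr. Qed.

Lemma kernel_continuous_along (T : topologicalType) (A B : T -> 'rV[C]_d) :
  (forall p (e : R), 0 < e -> \forall q \near p,
     forall j, normc (A p 0 j - A q 0 j) < e /\ normc (B p 0 j - B q 0 j) < e) ->
  continuous (fun p => complex.Re (K (A p) (B p))) /\
  continuous (fun p => complex.Im (K (A p) (B p))).
Proof.
move=> AB.
have H p e : 0 < e -> \forall q \near p, normc (K (A p) (B p) - K (A q) (B q)) < e.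
  move=> e0; have [r r0 Hr] := kernel_continuous dK (A p) (B p) e0.
  by apply: filterS (AB p r r0) => q h; apply: Hr => j; have [] := h j.
split=> p; apply/cvgrPdist_lt => e e0; apply: filterS (H p e e0) => q.
  by move=> h; apply: le_lt_trans h; rewrite -raddfB; exact: normc_Re_le.
by move=> h; apply: le_lt_trans h; rewrite -raddfB; exact: normc_Im_le.
Qed.

Lemma near_coord x (e : R) : 0 < e ->
  nbhs x [set y : 'rV[R]_d | forall j, `|x 0 j - y 0 j| < e].
Proof.
move=> e0; apply/nbhs_ballP; exists e => // y [_ xy] j; exact: xy.
Qed.

Lemma kernel_continuous1 (w : 'rV[C]_d) :
  continuous (fun x => complex.Re (K (toC x) w)) /\
  continuous (fun x => complex.Im (K (toC x) w)).
Proof.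
apply: (@kernel_continuous_along _ (fun x : 'rV[R]_d => toC x) (fun=> w)) => p e e0.
apply: filterS (near_coord p e0) => q pq j; split; last by rewrite subrr normc0.
by rewrite !mxE -rmorphB normc_real_complex.
Qed.

Lemma is_derive_kernel_val (z : 'rV[C]_d) x v :
  is_derive x v (fun y => complex.Re (K (toC y) z) : R^o)
    (complex.Re (deriveC (fun y => K (toC y) z) v x)) /\
  is_derive x v (fun y => complex.Im (K (toC y) z) : R^o)
    (complex.Im (deriveC (fun y => K (toC y) z) v x)).
Proof.
rewrite (deriveC_kernel dK); exact: (is_derive_kernel dK).
Qed.

Lemma cdot_real x t : cdot x (toC t) = (dot x t)%:C%C.
Proof. by rewrite /cdot rmorph_sum; apply: eq_bigr => j _; rewrite mxE rmorphM. Qed.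

Lemma cRe_sum (I : Type) (s : seq I) (F : I -> C) :
  complex.Re (\sum_(i <- s) F i) = \sum_(i <- s) complex.Re (F i).
Proof. by apply: (big_morph (@complex.Re R)) => //; case=> ? ? []. Qed.

Lemma cIm_sum (I : Type) (s : seq I) (F : I -> C) :
  complex.Im (\sum_(i <- s) F i) = \sum_(i <- s) complex.Im (F i).
Proof. by apply: (big_morph (@complex.Im R)) => //; case=> ? ? []. Qed.

Lemma cReB (z w : C) : complex.Re (z - w) = complex.Re z - complex.Re w.
Proof. by case: z w => a b []. Qed.

Lemma cReD (z w : C) : complex.Re (z + w) = complex.Re z + complex.Re w.
Proof. by case: z w => a b []. Qed.

Lemma cReMl (r : R) (z : C) : complex.Re (r%:C%C * z) = r * complex.Re z.
Proof. by case: z => a b /=; rewrite mul0r subr0. Qed.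

Lemma cImB (z w : C) : complex.Im (z - w) = complex.Im z - complex.Im w.
Proof. by case: z w => a b []. Qed.

Lemma cImD (z w : C) : complex.Im (z + w) = complex.Im z + complex.Im w.
Proof. by case: z w => a b []. Qed.

Lemma cImMl (r : R) (z : C) : complex.Im (r%:C%C * z) = r * complex.Im z.
Proof. by case: z => a b /=; rewrite mul0r addr0. Qed.

Lemma kernel_radial_eigen t :
  radial_eigen Pos k (fun x => complex.Re (K (toC x) (toC t))) t /\
  radial_eigen Pos k (fun x => complex.Im (K (toC x) (toC t))) t.
Proof.
have [c1 c2] := kernel_continuous1 (toC t).
have E x := kernel_euler dK (toC t) x.
split; split=> // x; have [h1 h2] := is_derive_kernel_val (toC t) x x.
- apply: (is_derive_eq h1); have := congr1 (@complex.Re R) (E x).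
  rewrite cdot_real cReMl cReD cRe_sum => <-.
  have -> : \sum_(a <- Pos) complex.Re ((k a)%:C%C * (K (toC x) (toC t) - K (toC (refl a x)) (toC t))) =
      refl_defect Pos k (fun x => complex.Re (K (toC x) (toC t))) x.
    by apply: eq_bigr => a _; rewrite cReMl cReB.
  by rewrite addrCA addNr addr0.
- apply: (is_derive_eq h2); have := congr1 (@complex.Im R) (E x).
  rewrite cdot_real cImMl cImD cIm_sum => <-.
  have -> : \sum_(a <- Pos) complex.Im ((k a)%:C%C * (K (toC x) (toC t) - K (toC (refl a x)) (toC t))) =
      refl_defect Pos k (fun x => complex.Im (K (toC x) (toC t))) x.
    by apply: eq_bigr => a _; rewrite cImMl cImB.
  by rewrite addrCA addNr addr0.
Qed.

Lemma kernel_real_sym x t : K (toC x) (toC t) = K (toC t) (toC x).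
Proof.
have [c1 c2] : (forall x, continuous (fun t => complex.Re (K (toC x) (toC t)))) /\
    (forall x, continuous (fun t => complex.Im (K (toC x) (toC t)))).
  suff H y : continuous (fun t => complex.Re (K (toC y) (toC t))) /\
    continuous (fun t => complex.Im (K (toC y) (toC t))).
    by split=> y; have [] := H y.
  apply: (@kernel_continuous_along _ (fun=> toC y) (fun x : 'rV[R]_d => toC x)) => p e e0.
  apply: filterS (near_coord p e0) => q pq j; split; first by rewrite subrr normc0.
  by rewrite !mxE -rmorphB normc_real_complex.
have K0 s : K (toC 0) (toC s) = 1 by rewrite /toC map_mx0 (kernel0 dK).
apply/eqP; rewrite eq_complex; apply/andP; split; apply/eqP.
- apply: (radial_eigen_sym rootP normP posP kP
    (W := fun x t => complex.Re (K (toC x) (toC t)))) => //.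
  + by move=> s; have [] := kernel_radial_eigen s.
  + by move=> s s'; rewrite !K0.
- apply: (radial_eigen_sym rootP normP posP kP
    (W := fun x t => complex.Im (K (toC x) (toC t)))) => //.
  + by move=> s; have [] := kernel_radial_eigen s.
  + by move=> s s'; rewrite !K0.
Qed.

Lemma derivable_kernel_line (v a : 'rV[C]_d * 'rV[C]_d) (z : C) :
  derivable ((fun s : C => K (s *: v.1 + a.1) (s *: v.2 + a.2)) : C^o -> C^o) z 1.
Proof.
have H : derivable (fun q : 'rV[C]_d * 'rV[C]_d => K q.1 q.2 : C^o) (z *: v + a) v.
  by apply: diff_derivable; exact: (kernel_differentiable dK).
rewrite /derivable in H *.
set f := (X in cvg (fmap X _)) in H; set g := (X in cvg (fmap X _)).
suff -> : g = f by exact: H.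
apply/funext => h; rewrite /f /g /= [h *: 1]mulr1 !scalerDl !addrA.
by [].
Qed.

(** The difference K(s y, t) - K(t, s y) is entire in the single variable [s] and vanishes for real
    [s]; [entire_zero] evaluates it at [i]. From here on the Dunkl equations can be applied in the
    variable [t]. *)
Lemma kernel_imag_sym y t : K ('i%C *: toC y) (toC t) = K (toC t) ('i%C *: toC y).
Proof.
apply/eqP; rewrite -subr_eq0; apply/eqP.
pose f (s : C) := K (s *: toC y) (toC t) - K (toC t) (s *: toC y).
apply: (@entire_zero _ f).
- move=> z.
  have h1 := @derivable_kernel_line (toC y, 0) (0, toC t) z.
  have h2 := @derivable_kernel_line (0, toC y) (toC t, 0) z.
  have H := @derivableB C C^o C^o _ _ z 1 h1 h2.
  move: H; set g := (X in derivable X _ _); suff -> : f = g by [].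
  by apply/funext => s; rewrite /f /g !fctE /= !scaler0 !addr0 !add0r.
- move=> x; rewrite /f (_ : x%:C%C *: toC y = toC (x *: y)); last first.
    by rewrite -[x *: y]addr0 toC_line /toC map_mx0 addr0.
  by rewrite kernel_real_sym subrr.
Qed.

End kernel_symmetry.

(** * The kernel at imaginary spectral parameter *)

Section tame.
Context {R : realType} {d : nat}.

(** The regularity that integration by parts uses: the bounds provide the dominating functions, and
    the Lipschitz condition also controls (g(x) - g(refl a x)) / (a,x). The components of K(., iy)
    have it with L = |y|. *)
Definition tame (L : R) (g : 'rV[R]_d -> R) := [/\ forall x, `|g x| <= 1,
  forall x y, `|g x - g y| <= L * enorm (x - y) &
  forall x v, derivable (g : _ -> R^o) x v].

Definition dquot (a : 'rV[R]_d) (g : 'rV[R]_d -> R) x : R :=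
  if dot a x == 0 then 'D_a (g : _ -> R^o) x else (g x - g (refl a x)) / dot a x.

Lemma tame_continuous L g : 0 <= L -> tame L g -> continuous g.
Proof.
move=> L0 [_ gL _] x; have F : Filter (nbhs x) by exact: nbhs_filter.
apply/cvgrPdist_le => e e0.
have c := @continuous_enorm R d 0; have F0 : Filter (nbhs (0 : 'rV[R]_d)) by exact: nbhs_filter.
have L1 : 0 < L + 1 by rewrite ltr_wpDl.
move/cvgrPdist_lt : c => /(_ (e / (L + 1)) (divr_gt0 e0 L1)) H.
have cx : (fun y : 'rV[R]_d => x - y) @ x --> x - x.
  have h : (fun _ : 'rV[R]_d => x) @ x --> x by exact: cst_continuous.
  have h' : (fun y : 'rV[R]_d => y) @ x --> x by exact: cvg_id.
  exact: (cvgB h h').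
rewrite subrr in cx.
apply: (@filterS _ _ F) (cx _ H) => y /=; rewrite enorm0 sub0r normrN ger0_norm ?enorm_ge0// => xy.
apply: (le_trans (gL _ _)); move: (enorm_ge0 (x - y)) xy; rewrite ltr_pdivlMr//.
by move: (enorm (x - y)) => z z0; nra.
Qed.

Lemma tame_derive L g x v : tame L g -> `|'D_v (g : _ -> R^o) x| <= L * enorm v.
Proof.
move=> [_ gL dg]; have /cvg_ex[/= l gl] := dg x v.
have -> : 'D_v (g : _ -> R^o) x = l by apply/cvg_lim.
apply/ler_addgt0Pr => e e0.
move/cvgrPdist_le : gl => /(_ _ e0); rewrite near_withinE => -[r /= r0 Hr].
have r2 : 0 < r / 2 by rewrite divr_gt0.
have := Hr (r / 2); rewrite /= sub0r normrN gtr0_norm//.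
rewrite ltr_pdivrMr// ltr_pMr// ltr1n gt_eqF// => /(_ isT isT).
set q := (_ *: _) => H; rewrite -(subrK q l) (le_trans (ler_normD _ _))// addrC lerD//.
rewrite /q normrM gtr0_norm ?invr_gt0// mulrC ler_pdivrMr//.
apply: (le_trans (gL _ _)); rewrite addrK enormZ (gtr0_norm r2).
by rewrite mulrCA mulrC.
Qed.

Lemma tame_scale L g r : 0 <= L -> 0 <= r <= 1 -> tame L g -> tame L (fun x => g (r *: x)).
Proof.
move=> L0 /andP[r0 r1] [g1 gL dg]; split=> [x|x y|x v]; first exact: g1.
  apply: (le_trans (gL _ _)); rewrite -scalerBr enormZ ger0_norm// ler_wpM2l//.
  by rewrite ler_piMl// enorm_ge0.
have h := dg (r *: x) (r *: v); rewrite /derivable in h *.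
set F := (X in cvg (fmap X _)) in h; set G := (X in cvg (fmap X _)).
suff -> : G = F by [].
apply/funext => s; rewrite /F /G /=.
by have -> : r *: (s *: v + x) = s *: (r *: v) + r *: x by rewrite scalerDr !scalerA mulrC.
Qed.

Lemma derive_scale (g : 'rV[R]_d -> R) r x v :
  'D_v ((fun x => g (r *: x)) : _ -> R^o) x = 'D_(r *: v) (g : _ -> R^o) (r *: x).
Proof.
rewrite /derive; set F := (X in lim (fmap X _)); set G := (X in _ = lim (fmap X _)).
suff -> : F = G by [].
apply/funext => s; rewrite /F /G /=.
by have -> : r *: (s *: v + x) = s *: (r *: v) + r *: x by rewrite scalerDr !scalerA mulrC.
Qed.

End tame.

Section kernel_imaginary.
Context {R : realType} {d : nat}.
Local Notation C := R[i].
Variables (Phi Pos : {fset 'rV[R]_d}) (k : 'rV[R]_d -> R) (K : 'rV[C]_d -> 'rV[C]_d -> C).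
Hypotheses (rootP : root_system Phi) (normP : normalized Phi).
Hypotheses (posP : positive_subsystem Phi Pos) (kP : multiplicity_function Phi k).
Hypothesis (dK : dunkl_kernel Pos k K).
Variable y : 'rV[R]_d.
Implicit Types (x t v : 'rV[R]_d).

Definition kerRe t : R := complex.Re (K (toC t) ('i%C *: toC y)).
Definition kerIm t : R := complex.Im (K (toC t) ('i%C *: toC y)).

Let f t := K (toC t) ('i%C *: toC y).

Lemma is_derive_ker x v :
  is_derive x v (kerRe : _ -> R^o) (complex.Re (deriveC f v x)) /\
  is_derive x v (kerIm : _ -> R^o) (complex.Im (deriveC f v x)).
Proof. exact: (is_derive_kernel_val dK). Qed.

Let cdot_imag x : cdot x ('i%C *: toC y) = Complex 0 (dot x y).
Proof.
rewrite /cdot (_ : Complex 0 (dot x y) = 'i%C * (dot x y)%:C%C); last first.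
  by apply/eqP; rewrite eq_complex /=; apply/andP; split; apply/eqP; ring.
rewrite /dot rmorph_sum mulr_sumr; apply: eq_bigr => j _.
by rewrite !mxE rmorphM mulrCA.
Qed.

Lemma ker_euler x :
  is_derive x x (kerRe : _ -> R^o) (- refl_defect Pos k kerRe x - dot x y * kerIm x) /\
  is_derive x x (kerIm : _ -> R^o) (- refl_defect Pos k kerIm x + dot x y * kerRe x).
Proof.
have [h1 h2] := is_derive_ker x x.
have := kernel_euler dK ('i%C *: toC y) x; rewrite -/f cdot_imag => E.
split.
- apply: (is_derive_eq h1); have := congr1 (@complex.Re R) E.
  rewrite cReD cRe_sum.
  have -> : \sum_(a <- Pos) complex.Re ((k a)%:C%C * (f x - f (refl a x))) =
      refl_defect Pos k kerRe x by apply: eq_bigr => a _; rewrite cReMl cReB.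
  have -> : complex.Re (Complex 0 (dot x y) * f x) = - (dot x y * kerIm x).
    by rewrite /kerIm -/(f x); case: (f x) => u v /=; rewrite mul0r sub0r.
  by move=> <-; rewrite addrCA addNr addr0.
- apply: (is_derive_eq h2); have := congr1 (@complex.Im R) E.
  rewrite cImD cIm_sum.
  have -> : \sum_(a <- Pos) complex.Im ((k a)%:C%C * (f x - f (refl a x))) =
      refl_defect Pos k kerIm x by apply: eq_bigr => a _; rewrite cImMl cImB.
  have -> : complex.Im (Complex 0 (dot x y) * f x) = dot x y * kerRe x.
    by rewrite /kerRe -/(f x); case: (f x) => u v /=; rewrite mul0r add0r.
  by move=> <-; rewrite addrCA addNr addr0.
Qed.

Lemma ker0 : kerRe 0 = 1 /\ kerIm 0 = 0.
Proof. by rewrite /kerRe /kerIm (_ : toC 0 = 0) ?(kernel0 dK)// /toC map_mx0. Qed.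

Lemma ker_continuous : continuous kerRe /\ continuous kerIm.
Proof. exact: (kernel_continuous1 dK ('i%C *: toC y)). Qed.

(** A purely imaginary eigenvalue means be = 0 in [max_principle], so the bound exp(c |x|) holds for
    every c > 0. If the square G exceeded 1, the choice c = ln G / (2 (|x| + 1)) would give exp(c
    |x|) < G. *)
Lemma ker_le1 x : kerRe x ^+ 2 + kerIm x ^+ 2 <= 1.
Proof.
have [c1 c2] := ker_continuous.
have k0 a : a \in Pos -> 0 <= k a := k_ge0 posP kP (a := a).
have norm2 a : a \in Pos -> dot a a = 2 := Pos_dot normP posP (a := a).
have d1 z : is_derive z z (kerRe : _ -> R^o)
    (- refl_defect Pos k kerRe z + dot z 0 * kerRe z - dot z y * kerIm z).
  by rewrite dot0r mul0r addr0; have [] := ker_euler z.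
have d2 z : is_derive z z (kerIm : _ -> R^o)
    (- refl_defect Pos k kerIm z + dot z 0 * kerIm z + dot z y * kerRe z).
  by rewrite dot0r mul0r addr0; have [] := ker_euler z.
have H c : 0 < c -> kerRe x ^+ 2 + kerIm x ^+ 2 <= expR (c * enorm x).
  move=> c0; have := max_principle k0 norm2 c1 c2 d1 d2 x (c := c).
  rewrite enorm0 mulr0 => /(_ c0); have [-> ->] := ker0.
  by rewrite expr1n expr0n addr0 mul1r.
rewrite leNgt; apply/negP => G1; set G := (X in _ < X) in G1 H *.
have lnG : 0 < ln G by rewrite ln_gt0.
have n1 : 0 < 2 * (enorm x + 1) by rewrite mulr_gt0// ltr_wpDl// enorm_ge0.
have := H _ (divr_gt0 lnG n1); rewrite leNgt => /negP; apply.
rewrite -/G -[X in _ < X](@lnK _ G) ?posrE ?(lt_trans ltr01)// ltr_expR mulrAC ltr_pdivrMr//.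
rewrite ltr_pM2l//; have := enorm_ge0 x; lra.
Qed.

Lemma ker_tame : tame (enorm y) kerRe /\ tame (enorm y) kerIm.
Proof.
have [c1 c2] := ker_continuous.
have k0 a : a \in Pos -> 0 <= k a := k_ge0 posP kP (a := a).
have norm2 a : a \in Pos -> dot a a = 2 := Pos_dot normP posP (a := a).
have d1 z : is_derive z z (kerRe : _ -> R^o)
    (- refl_defect Pos k kerRe z - dot z y * kerIm z) by have [] := ker_euler z.
have d2 z : is_derive z z (kerIm : _ -> R^o)
    (- refl_defect Pos k kerIm z + dot z y * kerRe z) by have [] := ker_euler z.
have L := lipschitz_principle k0 norm2 c1 c2 d1 d2 ker_le1.
have sq (p q r : R) : 0 <= r -> p ^+ 2 + q ^+ 2 <= r ^+ 2 -> `|p| <= r /\ `|q| <= r.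
  move=> r0 h; split; rewrite -(ler_pXn2r (n := 2)) ?nnegrE// real_normK ?num_real//;
    by apply: le_trans h; rewrite ?lerDl ?lerDr sqr_ge0.
split; split=> [x|x z|x v].
- by have [] := sq _ _ 1 ler01 (le_trans (ker_le1 x) _); rewrite ?expr1n.
- by have [] := sq _ _ _ (mulr_ge0 (enorm_ge0 _) (enorm_ge0 _)) (L x z).
- by have [[]] := is_derive_ker x v.
- by have [] := sq _ _ 1 ler01 (le_trans (ker_le1 x) _); rewrite ?expr1n.
- by have [] := sq _ _ _ (mulr_ge0 (enorm_ge0 _) (enorm_ge0 _)) (L x z).
- by have [_ []] := is_derive_ker x v.
Qed.

(** Real and imaginary parts of the equation with eigenvalue i (v,y): the Dunkl operator maps each
    component to a multiple of the other. *)
Lemma ker_dunkl x v :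
  'D_v (kerRe : _ -> R^o) x + \sum_(a <- Pos) k a * dot a v * dquot a kerRe x = - (dot v y * kerIm x) /\
  'D_v (kerIm : _ -> R^o) x + \sum_(a <- Pos) k a * dot a v * dquot a kerIm x = dot v y * kerRe x.
Proof.
have [h1 h2] := is_derive_ker x v.
rewrite (@derive_val _ _ _ _ _ _ _ h1) (@derive_val _ _ _ _ _ _ _ h2).
have := dunkl_directional dK ('i%C *: toC y) x v; rewrite -/f cdot_imag => E.
have Q a : complex.Re (dunkl_quotient a f x) = dquot a kerRe x /\
    complex.Im (dunkl_quotient a f x) = dquot a kerIm x.
  rewrite /dunkl_quotient /dquot; case: ifP => _; first by [].
  by rewrite -fmorphV mulrC cReMl cImMl cReB cImB ![_^-1 * _]mulrC.
split.
- have := congr1 (@complex.Re R) E; rewrite cReD cRe_sum.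
  have -> : complex.Re (Complex 0 (dot v y) * f x) = - (dot v y * kerIm x).
    by rewrite /kerIm -/(f x); case: (f x) => p q /=; rewrite mul0r sub0r.
  by move=> <-; congr (_ + _); apply: eq_bigr => a _; rewrite cReMl; have [-> _] := Q a.
- have := congr1 (@complex.Im R) E; rewrite cImD cIm_sum.
  have -> : complex.Im (Complex 0 (dot v y) * f x) = dot v y * kerRe x.
    by rewrite /kerRe -/(f x); case: (f x) => p q /=; rewrite mul0r add0r.
  by move=> <-; congr (_ + _); apply: eq_bigr => a _; rewrite cImMl; have [_ ->] := Q a.
Qed.

End kernel_imaginary.

(** * Lebesgue measure on R^n *)

Section lebesgue_affine.
Context {R : realType}.
Local Notation leb := (@lebesgue_measure R).
Variables (c b : R).
Hypothesis c0 : c != 0.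

Definition affine (s : measurableTypeR R) : measurableTypeR R := c * s + b.

Lemma measurable_affine : measurable_fun setT affine.
Proof.
apply: (@measurable_funD _ _ _ _ (fun s => c * s) (cst b)); last exact: measurable_cst.
by apply: measurable_funM; [exact: measurable_cst|exact: measurable_id].
Qed.

Let push : {measure set (measurableTypeR R) -> \bar R} :=
  @measure_function_pushforward__canonical__measure_function_Measure _ _ _ _ R
    leb affine measurable_affine.

Let nu : {measure set (measurableTypeR R) -> \bar R} :=
  mscale (NngNum (normr_ge0 c)) push.

Let lebesgue_scaled A : measurable A -> leb A = nu A.
Proof.
apply: lebesgue_measure_unique => X [[x y] /= xy <-].
rewrite /nu /mscale /= /pushforward.
have [yx|{}xy] := leP y x.
  rewrite set_itv_ge ?bnd_simp -?leNgt// preimage_set0 !measure0.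
  by rewrite mule0.
have [cp|cn|cz] := ltgtP c 0; last by have := c0; rewrite cz eqxx.
- have -> : affine @^-1` `]x, y] = `[(y - b) / c, (x - b) / c[%classic.
    apply/seteqP; split => s /=; rewrite !in_itv/= /affine => /andP[h1 h2]; apply/andP; split.
    + by rewrite ler_ndivrMr// mulrC; lra.
    + by rewrite ltr_ndivlMr// mulrC; lra.
    + by move: h2; rewrite ltr_ndivlMr// mulrC; lra.
    + by move: h1; rewrite ler_ndivrMr// mulrC; lra.
  rewrite !lebesgue_measure_itv/= !lte_fin xy ltr_nM2r ?invr_lt0// ltrD2r xy.
  by rewrite !EFinN -!EFinB -EFinM ltr0_norm//; congr (_%:E); field.
- have -> : affine @^-1` `]x, y] = `](x - b) / c, (y - b) / c]%classic.
    apply/seteqP; split => s /=; rewrite !in_itv/= /affine => /andP[h1 h2]; apply/andP; split.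
    + by rewrite ltr_pdivrMr// mulrC; lra.
    + by rewrite ler_pdivlMr// mulrC; lra.
    + by move: h1; rewrite ltr_pdivrMr// mulrC; lra.
    + by move: h2; rewrite ler_pdivlMr// mulrC; lra.
  rewrite !lebesgue_measure_itv/= !lte_fin xy ltr_pM2r ?invr_gt0// ltrD2r xy.
  by rewrite !EFinN -!EFinB -EFinM gtr0_norm//; congr (_%:E); field.
Qed.

Lemma integral_affine (f : measurableTypeR R -> \bar R) : measurable_fun setT f ->
  (forall x, 0 <= f x)%E ->
  (\int[leb]_x f x = `|c|%:E * \int[leb]_x f (c * x + b)%R)%E.
Proof.
move=> mf f0.
rewrite (eq_measure_integral nu); last by move=> A mA _; exact: lebesgue_scaled.
rewrite ge0_integral_mscale//; congr (_ * _)%E.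
by rewrite (ge0_integral_pushforward measurable_affine)// preimage_setT.
Qed.

End lebesgue_affine.

(** * Tonelli along coordinate lines *)

Section tuple_tonelli.
Context {R : realType}.
Local Notation leb := (@lebesgue_measure R).
Local Notation T := (measurableTypeR R).
Local Open Scope ereal_scope.

Lemma measurable_cons_r n (a : T) :
  measurable_fun setT (fun t : n.-tuple T => cons_pair (a, t)).
Proof.
apply: (measurableT_comp (measurable_cons_pair (R := R) (n := n))).
exact: pair1_measurable.
Qed.

Lemma integral_tupleS n (f : n.+1.-tuple T -> \bar R) : measurable_fun setT f ->
  (forall t, 0 <= f t) ->
  \int[lebesgue_tuple R n.+1]_t f t =
  \int[leb]_a \int[lebesgue_tuple R n]_t f (cons_pair (a, t)) /\
  \int[lebesgue_tuple R n.+1]_t f t =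
  \int[lebesgue_tuple R n]_t \int[leb]_a f (cons_pair (a, t)).
Proof.
move=> mf f0.
have E : \int[lebesgue_tuple R n.+1]_t f t =
    \int[leb \x lebesgue_tuple R n]_p f (cons_pair p).
  have := @ge0_integral_pushforward _ _ _ _ R _ (@measurable_cons_pair R n)
    (leb \x lebesgue_tuple R n) setT f measurableT mf.
  by rewrite preimage_setT; exact.
have mf' : measurable_fun setT (fun p => f (@cons_pair R n p)).
  by apply: measurableT_comp => //; exact: measurable_cons_pair.
by rewrite E; split; [rewrite fubini_tonelli1|rewrite fubini_tonelli2].
Qed.

Definition upd n (t : n.-tuple T) (j : 'I_n) (s : T) : n.-tuple T :=
  [tuple if i == j then s else tnth t i | i < n].

Lemma upd_head n a (t : n.-tuple T) s : upd (cons_pair (a, t)) ord0 s = cons_pair (s, t).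
Proof.
apply: eq_from_tnth => i; rewrite tnth_mktuple.
by case: (unliftP ord0 i) => [j|] -> //=; rewrite !tnthS.
Qed.

Lemma upd_tail n a (t : n.-tuple T) (j : 'I_n) s :
  upd (cons_pair (a, t)) (lift ord0 j) s = cons_pair (a, upd t j s).
Proof.
apply: eq_from_tnth => i; rewrite tnth_mktuple.
case: (unliftP ord0 i) => [l|] -> //=.
by rewrite !tnthS tnth_mktuple (inj_eq lift_inj).
Qed.

(** Induction on the dimension, splitting off the head coordinate: it is integrated first if it is
    the j-th one, last otherwise. Every change of variables below is thereby reduced to one real
    variable. *)
Lemma eq_integral_fibers n (j : 'I_n) (F G : n.-tuple T -> \bar R) :
  measurable_fun setT F -> measurable_fun setT G ->
  (forall t, 0 <= F t) -> (forall t, 0 <= G t) ->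
  (forall t, \int[leb]_s F (upd t j s) = \int[leb]_s G (upd t j s)) ->
  \int[lebesgue_tuple R n]_t F t = \int[lebesgue_tuple R n]_t G t.
Proof.
elim: n j F G => [[]//|n IH] j F G mF mG F0 G0 FG.
case: (unliftP ord0 j) FG => [i|] -> FG.
- rewrite (integral_tupleS mF F0).1 (integral_tupleS mG G0).1.
  apply: eq_integral => a _; apply: (IH i) => //.
  + by apply: (measurableT_comp mF); exact: measurable_cons_r.
  + by apply: (measurableT_comp mG); exact: measurable_cons_r.
  + move=> t; have := FG (cons_pair (a, t)).
    by under eq_integral do rewrite upd_tail; under [X in _ = X -> _]eq_integral do rewrite upd_tail.
- rewrite (integral_tupleS mF F0).2 (integral_tupleS mG G0).2.
  apply: eq_integral => t _; have := FG (cons_pair (0%R, t)).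
  by under eq_integral do rewrite upd_head; under [X in _ = X -> _]eq_integral do rewrite upd_head.
Qed.

End tuple_tonelli.

(** * Measurability of continuous functions of row vectors *)

Section measurable_row.
Context {R : realType}.
Local Notation T := (measurableTypeR R).

Definition rowt n (t : n.-tuple T) : 'rV[R]_n := \row_j tnth t j.

Lemma measurable_fun_countable_range d (X : measurableType d) (I : countType)
    (c : X -> I) (G : I -> R) :
  (forall i, measurable (c @^-1` [set i])) -> measurable_fun setT (fun x => G (c x)).
Proof.
move=> mc _ B mB; rewrite setTI.
rewrite (_ : _ @^-1` B = \bigcup_i (if pselect (B (G i)) then c @^-1` [set i] else set0)).
  apply: countable_bigcupT_measurable; first exact: countableP.
  by move=> i; case: pselect => h /=; [exact: mc|exact: measurable0].
apply/seteqP; split => x /=.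
  by move=> Bx; exists (c x) => //; case: pselect.
by move=> [i _]; case: pselect => //= Bi ->.
Qed.

(** The cell of side 1/(m+1) that contains [t]. Cells are measurable and countable in number, which
    links the product sigma-algebra of tuples with the topology of row vectors. *)
Definition grid n (m : nat) (t : n.-tuple T) : {ffun 'I_n -> int} :=
  [ffun j => Num.floor (m.+1%:R * tnth t j)].

Definition grid_point n (m : nat) (z : {ffun 'I_n -> int}) : 'rV[R]_n :=
  \row_j ((z j)%:~R / m.+1%:R).

Lemma measurable_grid n m (z : {ffun 'I_n -> int}) :
  measurable (@grid n m @^-1` [set z]).
Proof.
rewrite (_ : _ @^-1` _ = \bigcap_(j in [set: 'I_n])
   ((fun t : n.-tuple T => tnth t j) @^-1`
     [set` `[(z j)%:~R / m.+1%:R, ((z j)%:~R + 1) / m.+1%:R[ ])).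
  apply: fin_bigcap_measurable => // j _.
  by rewrite -[X in measurable X]setTI; exact: measurable_tnth.
have m0 : (0 : R) < m.+1%:R by [].
have E (t : n.-tuple T) j : (Num.floor (m.+1%:R * tnth t j) == z j) =
    (tnth t j \in `[(z j)%:~R / m.+1%:R, ((z j)%:~R + 1) / m.+1%:R[).
  rewrite in_itv/= ler_pdivrMr// ltr_pdivlMr// ![_ * m.+1%:R]mulrC.
  set y := (_ * tnth t j : R).
  have := floor_itv y; rewrite intrD => /andP[h1 h2].
  apply/eqP/andP => [<- //|[h3 h4]].
  apply/eqP; rewrite eq_le -!ltzD1 -!(ltr_int R) !intrD.
  by rewrite (le_lt_trans h1 h4) (le_lt_trans h3 h2).
apply/seteqP; split => t /=.
  by move=> tz j _ /=; rewrite -E; move/ffunP : tz => /(_ j); rewrite ffunE => ->.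
move=> H; apply/ffunP => j; rewrite ffunE; apply/eqP; rewrite E; exact: (H j I).
Qed.

Lemma grid_point_close n m (t : n.-tuple T) j :
  `|rowt t 0 j - grid_point m (grid m t) 0 j| <= m.+1%:R^-1.
Proof.
have m0 : (0 : R) < m.+1%:R by [].
rewrite !mxE ffunE; set y := tnth t j.
have := floor_itv (m.+1%:R * y); rewrite intrD => /andP[h1 h2].
rewrite -(ler_pM2l m0) divff ?gt_eqF// -[X in X * `|_|]gtr0_norm// -normrM mulrBr.
rewrite [m.+1%:R * (_ / _)]mulrCA divff ?gt_eqF// mulr1 ler_norml.
by move: h1 h2; move: (_ * y) (_%:~R) => a b; lra.
Qed.

Lemma grid_point_cvg n (t : n.-tuple T) (e : R) : 0 < e ->
  \forall m \near \oo, forall j, `|rowt t 0 j - grid_point m (grid m t) 0 j| < e.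
Proof.
move=> e0; exists (Num.bound e^-1) => // m /= Nm j.
apply: (le_lt_trans (grid_point_close _ _ _)).
rewrite invf_plt ?posrE//; apply: lt_le_trans (archi_boundP _) _.
  by rewrite invr_ge0 ltW.
by rewrite ler_nat (leq_trans Nm).
Qed.

Lemma nbhs_row_coord n (x : 'rV[R]_n) (A : set 'rV[R]_n) : nbhs x A ->
  exists2 e : R, 0 < e & forall y : 'rV[R]_n, (forall j, `|x 0 j - y 0 j| < e) -> A y.
Proof.
move=> /nbhs_ballP[e /= e0 He]; exists e => // y xy.
by apply: He; split => // i j; rewrite (ord1 i); exact: xy.
Qed.

(** A continuous function is the pointwise limit of its values at the corners of the grid cells, and
    each approximation takes countably many values on measurable sets. *)
Lemma measurable_continuous_row n (g : 'rV[R]_n -> R) : continuous g ->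
  measurable_fun setT (fun t : n.-tuple T => g (rowt t)).
Proof.
move=> cg; apply: (@measurable_fun_cvg _ _ _ _
  (fun m t => g (grid_point m (grid m t)))).
  move=> m; apply: (measurable_fun_countable_range (fun z => g (grid_point m z))).
  exact: measurable_grid.
move=> t _; apply/cvgrPdist_lt => e e0.
have /nbhs_row_coord[r r0 Hr] : nbhs (rowt t) [set y | `|g (rowt t) - g y| < e].
  by have /cvgrPdist_lt/(_ _ e0) := @cg (rowt t).
by apply: filterS (grid_point_cvg t r0) => m; exact: Hr.
Qed.

Lemma measurable_continuous_row2 n1 n2 (g : 'rV[R]_n1 -> 'rV[R]_n2 -> R) :
  continuous (fun p => g p.1 p.2) ->
  measurable_fun setT (fun p : (n1.-tuple T * n2.-tuple T)%type => g (rowt p.1) (rowt p.2)).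
Proof.
move=> cg; apply: (@measurable_fun_cvg _ _ _ _
  (fun m p => g (grid_point m (grid m p.1)) (grid_point m (grid m p.2)))).
  move=> m; apply: (@measurable_fun_countable_range _ _ _
     (fun p : (n1.-tuple T * n2.-tuple T)%type => (grid m p.1, grid m p.2))
     (fun z => g (grid_point m z.1) (grid_point m z.2))) => -[z1 z2].
  rewrite (_ : _ @^-1` _ = (@grid n1 m @^-1` [set z1]) `*` (@grid n2 m @^-1` [set z2])).
    by apply: measurableX; exact: measurable_grid.
  by apply/seteqP; split => -[a b] /=; [move=> [<- <-]|move=> [<- <-]].
move=> [t s] _ /=; apply/cvgrPdist_lt => e e0.
have H : nbhs (rowt t, rowt s) [set p | `|g (rowt t) (rowt s) - g p.1 p.2| < e].
  by have /cvgrPdist_lt/(_ _ e0) := @cg (rowt t, rowt s).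
have [[A B] /= [/nbhs_row_coord[r r0 Hr] /nbhs_row_coord[r' r'0 Hr']] AB] := H.
near=> m; apply: (AB (_, _)); split => /=; [apply: Hr|apply: Hr'].
  by near: m; exact: grid_point_cvg.
by near: m; exact: grid_point_cvg.
Unshelve. all: by end_near. Qed.

End measurable_row.

(** * Linear changes of variables *)

Section volume_scaling.
Context {R : realType} {n : nat}.
Local Notation T := (measurableTypeR R).
Local Notation leb := (@lebesgue_measure R).
Local Notation mu := (lebesgue_tuple R n).
Implicit Types (A B : 'rV[R]_n -> 'rV[R]_n) (G : 'rV[R]_n -> R).

(** For a linear bijection [r] is 1/|det A|. Testing on continuous nonnegative functions makes the
    notion stable under composition, so determinants are never computed: maps are factored into
    changes of one coordinate. *)
Definition scales_volume A (r : R) := [/\ 0 <= r, continuous A & forall G, continuous G ->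
  (forall x, 0 <= G x) ->
  (\int[mu]_t (G (A (rowt t)))%:E = r%:E * \int[mu]_t (G (rowt t))%:E)%E].

Lemma scales_volume_comp A B r s : scales_volume A r -> scales_volume B s ->
  scales_volume (A \o B) (s * r).
Proof.
move=> [r0 cA HA] [s0 cB HB]; split; first exact: mulr_ge0.
  by move=> x; apply: continuous_comp; [exact: cB|exact: cA].
move=> G cG G0; rewrite (HB (fun x => G (A x))) => [|x|x]; last exact: G0.
  by rewrite HA// muleA EFinM.
by apply: continuous_comp; [exact: cA|exact: cG].
Qed.

Lemma scales_volume_id : scales_volume id 1.
Proof. by split=> // [x|G _ _]; [exact: cvg_id|rewrite mul1e]. Qed.

Lemma eq_scales_volume A B r s : A =1 B -> r = s -> scales_volume A r -> scales_volume B s.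
Proof. by move=> /funext -> ->. Qed.

Lemma rowt_upd (t : n.-tuple T) j (s : T) :
  rowt (upd t j s) = rowt t + (s - tnth t j) *: delta_mx 0 j.
Proof.
apply/rowP => i; rewrite !mxE tnth_mktuple eqxx /=.
by case: eqP => [->|_]; rewrite ?mulr1 ?mulr0 ?addr0// addrC subrK.
Qed.

Lemma continuous_coord_line (x : 'rV[R]_n) (j : 'I_n) (b : R) :
  continuous (fun s : R => x + (s - b) *: delta_mx 0 j : 'rV[R]_n).
Proof.
move=> s; have h1 : (fun _ : R => x) @ s --> x by exact: cst_continuous.
have h2 : (fun s : R => s - b) @ s --> s - b.
  have h : (fun _ : R => b) @ s --> b by exact: cst_continuous.
  have h' : (fun s : R => s) @ s --> s by exact: cvg_id.
  exact: (cvgB h' h).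
have h3 : (fun s : R => (s - b) *: (delta_mx 0 j : 'rV[R]_n)) @ s --> (s - b) *: (delta_mx 0 j : 'rV[R]_n).
  by apply: cvgZr_tmp.
exact: (cvgD h1 h3).
Qed.

Definition coord_map (j : 'I_n) (c : R) (l : 'rV[R]_n -> R) (x : 'rV[R]_n) : 'rV[R]_n :=
  x + ((c - 1) * x 0 j + l x) *: delta_mx 0 j.

Lemma continuous_coord_map (j : 'I_n) (c : R) (l : 'rV[R]_n -> R) : continuous l -> continuous (coord_map j c l).
Proof.
move=> cl x; have cj : continuous (fun y : 'rV[R]_n => y 0 j) by exact: coord_continuous.
have hx : (fun y : 'rV[R]_n => y) @ x --> x by exact: cvg_id.
have hc : (fun _ : 'rV[R]_n => c - 1) @ x --> c - 1 by exact: cst_continuous.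
have h2 : (fun y : 'rV[R]_n => (c - 1) * y 0 j + l y) @ x --> (c - 1) * x 0 j + l x.
  exact: (cvgD (cvgM hc (cj x)) (@cl x)).
have h3 : (fun y : 'rV[R]_n => ((c - 1) * y 0 j + l y) *: (delta_mx 0 j : 'rV[R]_n)) @ x -->
    ((c - 1) * x 0 j + l x) *: (delta_mx 0 j : 'rV[R]_n).
  by apply: cvgZr_tmp; [exact: nbhs_filter|exact: h2].
exact: (cvgD hx h3).
Qed.

(** Along a line in the j-th direction [l] is constant, and the map is the affine map s -> c s + l
    of the real line. *)
Lemma scales_volume_coord_map (j : 'I_n) (c : R) (l : 'rV[R]_n -> R) : c != 0 -> continuous l ->
  (forall (x : 'rV[R]_n) (s : R), l (x + s *: delta_mx 0 j) = l x) ->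
  scales_volume (coord_map j c l) `|c|^-1.
Proof.
move=> c0 cl lj; split; [by rewrite invr_ge0|exact: continuous_coord_map|].
move=> G cG G0; have cA : continuous (coord_map j c l) by exact: continuous_coord_map.
have cGA : continuous (fun x => G (coord_map j c l x)).
  by move=> x; apply: continuous_comp; [exact: cA|exact: cG].
have mG := measurable_continuous_row cG; have mGA := measurable_continuous_row cGA.
have nc : `|c| != 0 by rewrite normr_eq0.
suff : (\int[mu]_t (`|c|%:E * (G (coord_map j c l (rowt t)))%:E) = \int[mu]_t (G (rowt t))%:E)%E.
  rewrite ge0_integralZl//; first by move=> <-; rewrite muleA -EFinM mulVf// mul1e.
  - exact/measurable_EFinP.
  - by move=> x _; rewrite lee_fin.
apply: (@eq_integral_fibers _ _ j).
- by apply/measurable_EFinP; apply: measurable_funM => //; exact: measurable_cst.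
- exact/measurable_EFinP.
- by move=> t; rewrite mule_ge0// lee_fin.
- by move=> t; rewrite lee_fin.
move=> t.
have cs : continuous (fun s : R => G (rowt (upd t j s))).
  under eq_fun do rewrite rowt_upd.
  by move=> s; apply: continuous_comp; [exact: continuous_coord_line|exact: cG].
have ms : measurable_fun setT (fun s : T => G (rowt (upd t j s))).
  exact: continuous_measurable_fun.
rewrite [RHS](integral_affine (l (rowt t)) c0); last 2 first.
- exact/measurable_EFinP.
- by move=> x; rewrite lee_fin.
have E s : coord_map j c l (rowt (upd t j s)) = rowt (upd t j (c * s + l (rowt t))).
  rewrite /coord_map !rowt_upd lj -addrA -scalerDl; congr (_ + _ *: _).
  by rewrite !mxE eqxx eqxx mulr1; ring.
under eq_integral do rewrite E.
rewrite ge0_integralZl//.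
- apply/measurable_EFinP; apply: (measurableT_comp ms).
  exact: measurable_affine.
- by move=> x _; rewrite lee_fin.
Qed.

Lemma scales_volume_iter (I : eqType) (s : seq I) (A : I -> 'rV[R]_n -> 'rV[R]_n) (r : R) :
  (forall i, i \in s -> scales_volume (A i) r) ->
  scales_volume (foldr (fun i f => A i \o f) id s) (r ^+ size s).
Proof.
elim: s => [|i s IH] H; first exact: scales_volume_id.
rewrite /= exprSr; apply: scales_volume_comp.
  by apply: H; rewrite inE eqxx.
by apply: IH => j js; apply: H; rewrite inE js orbT.
Qed.

Lemma scales_volume_translation (v : 'rV[R]_n) : scales_volume (fun x => x + v) 1.
Proof.
pose A (j : 'I_n) := coord_map j 1 (fun=> v 0 j).
have HA j : scales_volume (A j) 1.
  apply: (eq_scales_volume (A := A j) (r := `|1|^-1)) => //; first by rewrite normr1 invr1.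
  by apply: scales_volume_coord_map => //; move=> x; exact: cst_continuous.
have := @scales_volume_iter _ (enum 'I_n) A 1 (fun j _ => HA j).
rewrite expr1n; apply: eq_scales_volume => // x.
have E s : foldr (fun i f => A i \o f) id s x = x + \sum_(j <- s) v 0 j *: delta_mx 0 j.
  elim: s => [|j s IH] /=; first by rewrite big_nil addr0.
  by rewrite IH big_cons /A /coord_map subrr mul0r add0r -addrA [v 0 j *: _ + _]addrC.
by rewrite E big_enum /= -row_sum_delta.
Qed.

Lemma scales_volume_scale (r : R) : 0 < r -> scales_volume (fun x => r *: x) (r ^- n).
Proof.
move=> r0; pose A (j : 'I_n) := coord_map j r (fun=> 0).
have HA j : scales_volume (A j) r^-1.
  apply: (eq_scales_volume (A := A j) (r := `|r|^-1)) => //; first by rewrite gtr0_norm.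
  by apply: scales_volume_coord_map => //; [rewrite gt_eqF|move=> x; exact: cst_continuous].
have := @scales_volume_iter _ (enum 'I_n) A r^-1 (fun j _ => HA j).
apply: eq_scales_volume; last by rewrite size_enum_ord exprVn.
move=> x; apply/rowP => i.
have E s : uniq s -> foldr (fun i f => A i \o f) id s x 0 i = (if i \in s then r else 1) * x 0 i.
  elim: s => [_|j s IH] /=; first by rewrite mul1r.
  move=> /andP[js us]; move: (IH us); move: (foldr _ _ _ x) => z zi.
  rewrite /A /coord_map !mxE eqxx inE addr0.
  have [ij|ij] /= := eqVneq i j; last by rewrite mulr0 addr0.
  by rewrite -ij zi ij (negbTE js); ring.
by rewrite E ?enum_uniq// mem_enum inE mxE.
Qed.

(* In the coordinates where [x 0 j] is replaced by [dot a x], the reflection is a sign change of one coordinate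
   followed by shears. *)
Lemma scales_volume_refl (a : 'rV[R]_n) : dot a a = 2 -> scales_volume (refl a) 1.
Proof.
move=> a2; have [j aj] : exists j, a 0 j != 0.
  apply/existsP; apply: contraPT a2; rewrite negb_exists => /forallP a0.
  rewrite /dot big1; first by move=> /esym/eqP; rewrite pnatr_eq0.
  by move=> i _; have := a0 i; rewrite negbK => /eqP ->; rewrite mul0r.
have cd (b : 'rV[R]_n) : continuous (fun x => dot b x) by exact: continuous_dot.
pose e : 'rV[R]_n := delta_mx 0 j.
have dej x : dot e x = x 0 j.
  rewrite /dot (bigD1 j)//= big1 ?addr0; first by rewrite mxE !eqxx mul1r.
  by move=> i ij; rewrite mxE eqxx (negbTE ij) mul0r.
have dde (b : 'rV[R]_n) i : dot b (delta_mx 0 i) = b 0 i.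
  rewrite dotC /dot (bigD1 i)//= big1 ?addr0; first by rewrite mxE !eqxx mul1r.
  by move=> l li; rewrite mxE eqxx (negbTE li) mul0r.
pose a' := a - a 0 j *: e.
have a'j : a' 0 j = 0 by rewrite !mxE !eqxx mulr1 subrr.
have cNd (b : R) (q : 'rV[R]_n) : continuous (fun x => b * dot q x).
  move=> x; have h : (fun _ : 'rV[R]_n => b) @ x --> b by exact: cst_continuous.
  exact: (cvgM h (@cd q x)).
(* [S] replaces the j-th coordinate by (a,x) and [S'] undoes this, so their volume factors are
   inverse to each other. *)
pose S := coord_map j (a 0 j) (fun x => 1 * dot a' x).
pose S' := coord_map j (a 0 j)^-1 (fun x => - (a 0 j)^-1 * dot a' x).
have l0 b x s : b * dot a' (x + s *: delta_mx 0 j) = b * dot a' x.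
  by rewrite dotDr dotZr dde a'j mulr0 addr0.
have HS : scales_volume S `|a 0 j|^-1 by apply: scales_volume_coord_map.
have HS' : scales_volume S' `|(a 0 j)^-1|^-1.
  by apply: scales_volume_coord_map => //; rewrite invr_eq0.
pose N := coord_map j (-1) (fun=> 0).
have HN : scales_volume N `|-1|^-1.
  by apply: scales_volume_coord_map => //; move=> x; exact: cst_continuous.
(* [M i] adds a'_i times the j-th coordinate to the i-th. After the sign change that coordinate is
   -(a,x), so together these shears subtract (a,x) a' from the remaining coordinates, as the
   reflection does. *)
pose M (i : 'I_n) := coord_map i 1 (fun x => a' 0 i * dot e x).
have HM i : scales_volume (M i) 1.
  have [->|ij] := eqVneq i j.
    apply: eq_scales_volume scales_volume_id => // x.
    by rewrite /M /coord_map a'j subrr !mul0r addr0 scale0r addr0.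
  apply: (eq_scales_volume (A := M i) (r := `|1|^-1)) => //; first by rewrite normr1 invr1.
  apply: scales_volume_coord_map => //.
  by move=> x s; congr (_ * _); rewrite !dej !mxE eqxx [j == i]eq_sym (negbTE ij) mulr0 addr0.
have := @scales_volume_iter _ (enum 'I_n) M 1 (fun i _ => HM i).
set MM := foldr _ _ _; rewrite expr1n => HMM.
have MME x : MM x = x + x 0 j *: a'.
  have E s : foldr (fun i f => M i \o f) id s x = x + x 0 j *: \sum_(i <- s) a' 0 i *: delta_mx 0 i.
    elim: s => [|i s IH] /=; first by rewrite big_nil scaler0 addr0.
    rewrite IH big_cons /M /coord_map subrr mul0r add0r dej scalerDr -[LHS]addrA.
    congr (x + _).
    set z := \sum_(i <- s) _; have zj : (x + x 0 j *: z) 0 j = x 0 j.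
      rewrite !mxE [z 0 j](_ : _ = 0) ?mulr0 ?addr0// /z summxE big1// => l _; rewrite mxE.
      have [->|lj] := eqVneq l j; first by rewrite a'j mul0r.
      rewrite (_ : (delta_mx 0 l : 'rV[R]_n) 0 j = 0) ?mulr0//.
      by rewrite mxE eqxx eq_sym (negbTE lj).
    by rewrite zj addrC scalerA [x 0 j * _]mulrC.
  by rewrite /MM E big_enum /= -row_sum_delta.
have HC := scales_volume_comp HS' (scales_volume_comp HMM (scales_volume_comp HN HS)).
apply: eq_scales_volume HC; last first.
  by rewrite normrN normr1 invr1 !mulr1 normfV invrK mulVf// normr_eq0.
move=> x; rewrite /comp.
have SE : S x = x + (dot a x - x 0 j) *: e.
  rewrite /S /coord_map mul1r /a' dotBl dotZl dej; congr (_ + _ *: _); ring.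
have Sj : S x 0 j = dot a x by rewrite SE !mxE !eqxx mulr1 addrC subrK.
have NE : N (S x) = S x - (2 * dot a x) *: e.
  by rewrite /N /coord_map Sj addr0 -scaleNr; congr (_ + _ *: _); ring.
have Nj : N (S x) 0 j = - dot a x by rewrite NE SE !mxE !eqxx /= !mulr1; ring.
set u := dot a x in SE Sj NE Nj *; set y := MM _.
have yE : y = x + (- u - x 0 j) *: e - u *: a'.
  by apply/rowP => i; rewrite /y MME Nj NE SE !mxE; ring.
have a'e : dot a' e = 0 by rewrite dde.
have a'a' : dot a' a' = 2 - a 0 j ^+ 2.
  by rewrite {1}/a' dotBl dotZl dej a'j mulr0 subr0 /a' dotBr dotZr dde a2; ring.
have a'x : dot a' x = u - a 0 j * x 0 j by rewrite /a' dotBl dotZl dej.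
have a'y : dot a' y = - u - a 0 j * x 0 j + u * a 0 j ^+ 2.
  by rewrite yE dotBr dotDr !dotZr a'e a'a' a'x; ring.
have yj : y 0 j = - u by rewrite yE !mxE !eqxx /= !mulr1; ring.
apply/rowP => i; rewrite /S' /coord_map a'y yj yE reflE// -/u !mxE.
by field.
Qed.

End volume_scaling.

Section integrals_on_Rn.
Context {R : realType} {n : nat}.
Local Notation T := (measurableTypeR R).
Local Notation mu := (lebesgue_tuple R n).
Implicit Types (A : 'rV[R]_n -> 'rV[R]_n) (f g h : 'rV[R]_n -> R).

Definition Int g : R := \int[mu]_t g (rowt t).
Definition mrow g := measurable_fun setT (fun t : n.-tuple T => g (rowt t)).
Definition Lint g := mu.-integrable setT (fun t => (g (rowt t))%:E).

Lemma Lint_mrow g : Lint g -> mrow g.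
Proof. by move=> /integrableP[/measurable_EFinP]. Qed.

Lemma eq_Int f g : f =1 g -> Int f = Int g.
Proof. by move=> /funext ->. Qed.

Lemma Lint_le f g : mrow f -> (forall x, `|f x| <= g x) -> Lint g -> Lint f.
Proof.
move=> mf fg; apply: le_integrable => //; first exact/measurable_EFinP.
by move=> t _; rewrite lee_fin (le_trans (fg _))// ler_norm.
Qed.

Lemma LintD f g : Lint f -> Lint g -> Lint (fun x => f x + g x).
Proof. by move=> f1 g1; apply: (integrableD measurableT f1 g1). Qed.

Lemma LintB f g : Lint f -> Lint g -> Lint (fun x => f x - g x).
Proof. by move=> f1 g1; apply: (integrableB measurableT f1 g1). Qed.

Lemma LintZ c f : Lint f -> Lint (fun x => c * f x).
Proof. by move=> f1; apply: (integrableZl measurableT c f1). Qed.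

Lemma Lint0 : Lint (fun=> 0).
Proof. exact: integrable0. Qed.

Lemma IntD f g : Lint f -> Lint g -> Int (fun x => f x + g x) = Int f + Int g.
Proof. by move=> f1 g1; exact: RintegralD. Qed.

Lemma IntB f g : Lint f -> Lint g -> Int (fun x => f x - g x) = Int f - Int g.
Proof. by move=> f1 g1; exact: RintegralB. Qed.

Lemma IntZ c f : Lint f -> Int (fun x => c * f x) = c * Int f.
Proof. by move=> f1; exact: RintegralZl. Qed.

Lemma IntN f : Lint f -> Int (fun x => - f x) = - Int f.
Proof.
by move=> f1; rewrite -mulN1r -IntZ//; apply: eq_Int => x; rewrite mulN1r.
Qed.

Lemma Int0 : Int (fun=> 0) = 0.
Proof. by rewrite /Int /Rintegral integral0. Qed.

Lemma Int_le f g : Lint f -> Lint g -> (forall x, f x <= g x) -> Int f <= Int g.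
Proof. by move=> f1 g1 fg; apply: le_Rintegral => // t _; exact: fg. Qed.

Lemma Int_ge0 f : (forall x, 0 <= f x) -> 0 <= Int f.
Proof. by move=> f0; apply: Rintegral_ge0 => t _; exact: f0. Qed.

Lemma Lint_sum (I : eqType) (s : seq I) (F : I -> 'rV[R]_n -> R) :
  (forall i, i \in s -> Lint (F i)) -> Lint (fun x => \sum_(i <- s) F i x).
Proof.
elim: s => [_|i s IH HF].
  by under [X in Lint X]eq_fun do rewrite big_nil; exact: Lint0.
under [X in Lint X]eq_fun do rewrite big_cons; apply: LintD.
  by apply: HF; exact: mem_head.
by apply: IH => j js; apply: HF; rewrite in_cons js orbT.
Qed.

Lemma Int_sum (I : eqType) (s : seq I) (F : I -> 'rV[R]_n -> R) :
  (forall i, i \in s -> Lint (F i)) ->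
  Int (fun x => \sum_(i <- s) F i x) = \sum_(i <- s) Int (F i).
Proof.
elim: s => [_|i s IH HF].
  transitivity (Int (fun=> 0)); first by apply: eq_Int => x; rewrite big_nil.
  by rewrite Int0 big_nil.
have HF' j : j \in s -> Lint (F j) by move=> js; apply: HF; rewrite in_cons js orbT.
rewrite big_cons -(IH HF') -IntD; last exact: Lint_sum.
  by apply: eq_Int => x; rewrite big_cons.
by apply: HF; exact: mem_head.
Qed.

(** The splitting g = (|g| + g) - |g| into continuous nonnegative functions extends the defining
    property to signed integrands. *)
Lemma Int_scales_volume A r g : scales_volume A r -> continuous g -> Lint g ->
  Lint (fun x => g (A x)) /\ Int (fun x => g (A x)) = r * Int g.
Proof.
move=> [r0 cA HA] cg Lg.
have cgA : continuous (fun x => g (A x)).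
  by move=> x; apply: continuous_comp; [exact: cA|exact: cg].
have cn (f : 'rV[R]_n -> R) : continuous f -> continuous (fun x => `|f x|).
  by move=> cf x; apply: continuous_comp; [exact: cf|exact: norm_continuous].
have pos (f : 'rV[R]_n -> R) : continuous f -> (forall x, 0 <= f x) -> Lint f ->
    Lint (fun x => f (A x)) /\ Int (fun x => f (A x)) = r * Int f.
  move=> cf f0 Lf; have E := HA f cf f0.
  have fin : (\int[mu]_t (f (rowt t))%:E)%E \is a fin_num by exact: integrable_fin_num.
  split; last by rewrite /Int /Rintegral E fineM.
  apply/integrableP; split.
    apply/measurable_EFinP; apply: (@measurable_continuous_row R n (fun x => f (A x))).
    by move=> x; apply: continuous_comp; [exact: cA|exact: cf].
  under eq_integral do rewrite gee0_abs ?lee_fin//.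
  by rewrite E -(fineK fin) -EFinM ltry.
have Ln : Lint (fun x => `|g x|) by exact: integrable_norm.
have [La Ia] := pos _ (cn _ cg) (fun=> normr_ge0 _) Ln.
have cp : continuous (fun x => `|g x| + g x) by move=> x; exact: (cvgD (@cn _ cg x) (@cg x)).
have [Lb Ib] : Lint (fun x => `|g (A x)| + g (A x)) /\
    Int (fun x => `|g (A x)| + g (A x)) = r * Int (fun x => `|g x| + g x).
  apply: (pos (fun x => `|g x| + g x)) => //; last exact: LintD.
  by move=> x; have := ler_norm (- g x); rewrite normrN; lra.
have E : (fun x => g (A x)) = (fun x => (`|g (A x)| + g (A x)) - `|g (A x)|).
  by apply/funext => x; rewrite addrAC subrr add0r.
rewrite E; split; first exact: LintB.
by rewrite IntB// Ib Ia IntD//; ring.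
Qed.

Lemma dct_Int (g_ : nat -> 'rV[R]_n -> R) g h : (forall m, mrow (g_ m)) ->
  (forall x, g_ m x @[m --> \oo] --> g x) -> (forall m x, `|g_ m x| <= h x) -> Lint h ->
  Lint g /\ Int (g_ m) @[m --> \oo] --> Int g.
Proof.
move=> mg cg gh Lh.
have mg' : mrow g.
  apply: (@measurable_fun_cvg _ _ _ _ (fun m t => g_ m (rowt t))); first exact: mg.
  by move=> t _; exact: cg.
have [] := @dominated_convergence _ _ _ mu setT measurableT
  (fun m t => (g_ m (rowt t))%:E) (fun t => (g (rowt t))%:E) (fun t => (h (rowt t))%:E).
- by move=> m; apply/measurable_EFinP; exact: mg.
- exact/measurable_EFinP.
- by apply: aeW => t _; apply: cvg_EFin; [exact: nearW|exact: cg].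
- exact: Lh.
- by apply: aeW => t m _; rewrite lee_fin.
move=> Lg _ H; split=> //; apply: fine_cvg; rewrite fineK; first exact: H.
exact: integrable_fin_num.
Qed.

End integrals_on_Rn.

(** * Gaussians and functions of slow growth *)

Section gaussian.
Context {R : realType}.
Local Notation T := (measurableTypeR R).
Local Notation leb := (@lebesgue_measure R).

Definition gauss n (s : R) (x : 'rV[R]_n) : R := expR (- s * dot x x).

Lemma gauss_ge0 n s (x : 'rV[R]_n) : 0 <= gauss s x. Proof. exact: expR_ge0. Qed.

Lemma gauss_gt0 n s (x : 'rV[R]_n) : 0 < gauss s x. Proof. exact: expR_gt0. Qed.

Lemma gaussD n s r (x : 'rV[R]_n) : gauss (s + r) x = gauss s x * gauss r x.
Proof. by rewrite /gauss -expRD -mulrDl opprD. Qed.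

Lemma continuous_gauss n s : continuous (@gauss n s).
Proof.
move=> x; apply: (@continuous_comp _ _ _ (fun y : 'rV[R]_n => - s * dot y y) expR).
  have h : (fun _ : 'rV[R]_n => - s) @ x --> - s by exact: cst_continuous.
  exact: (cvgM h (@continuous_sqr_norm _ _ x)).
exact: continuous_expR.
Qed.

Lemma mrow_continuous n (g : 'rV[R]_n -> R) : continuous g -> mrow g.
Proof. exact: measurable_continuous_row. Qed.

Let gauss1 (s : R) : 0 < s -> (\int[leb]_x (expR (- s * x ^+ 2))%:E < +oo)%E.
Proof.
move=> s0; have r0 : 0 < Num.sqrt s by rewrite sqrtr_gt0.
have rn : Num.sqrt s != 0 by rewrite gt_eqF.
have := @integral_affine R (Num.sqrt s) 0 rn (fun x => (gauss_fun x)%:E).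
rewrite integralT_gauss => H; have {H} : ((Num.sqrt pi)%:E =
    `|Num.sqrt s|%:E * \int[leb]_x (expR (- s * x ^+ 2))%:E)%E.
  rewrite H; last by move=> x; rewrite lee_fin gauss_fun_ge0.
    congr (_ * _)%E; apply: eq_integral => x _.
    by rewrite /gauss_fun addr0 exprMn sqr_sqrtr ?ltW// mulNr.
  by apply/measurable_EFinP; exact: measurable_gauss_fun.
rewrite ltey; case: (\int[_]_x _)%E => // H.
by move: H; rewrite gt0_muley ?lte_fin ?normr_gt0.
Qed.

Lemma dot_cons n (a : R) (t : n.-tuple T) :
  dot (rowt (cons_pair (a, t))) (rowt (cons_pair (a, t))) = a ^+ 2 + dot (rowt t) (rowt t).
Proof.
rewrite /dot big_ord_recl; congr (_ + _); first by rewrite !mxE.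
by apply: eq_bigr => i _; rewrite !mxE !tnthS.
Qed.

(** The Gaussian factors over the coordinates, so Tonelli reduces dimension n + 1 to dimension n and
    the line; dimension 0 carries a Dirac mass. *)
Lemma Lint_gauss n s : 0 < s -> Lint (@gauss n s).
Proof.
move=> s0; apply/integrableP; split.
  by apply/measurable_EFinP; exact: mrow_continuous (@continuous_gauss n s).
under eq_integral do rewrite gee0_abs ?lee_fin ?gauss_ge0//.
elim: n => [|n IH].
  rewrite /= integral_dirac//; last first.
    by apply/measurable_EFinP; exact: mrow_continuous (@continuous_gauss 0 s).
  by rewrite diracT mul1e ltry.
have mg m : measurable_fun setT (fun t : m.-tuple T => (gauss s (rowt t))%:E).
  by apply/measurable_EFinP; exact: mrow_continuous (@continuous_gauss m s).
rewrite (integral_tupleS (mg _) _).1; last by move=> t; rewrite lee_fin gauss_ge0.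
have E a : (\int[lebesgue_tuple R n]_t (gauss s (rowt (cons_pair (a, t))))%:E =
    (expR (- s * a ^+ 2))%:E * \int[lebesgue_tuple R n]_t (gauss s (rowt t))%:E)%E.
  rewrite -ge0_integralZl//; last 2 first.
  - exact: mg.
  - by move=> t _; rewrite lee_fin gauss_ge0.
  by apply: eq_integral => t _; rewrite /gauss dot_cons mulrDr expRD EFinM.
under eq_integral do rewrite E.
have fin : (\int[lebesgue_tuple R n]_t (gauss s (rowt t))%:E)%E \is a fin_num.
  by rewrite ge0_fin_numE// integral_ge0// => t _; rewrite lee_fin gauss_ge0.
have me : measurable_fun setT (fun x : T => (expR (- s * x ^+ 2))%:E).
  apply/measurable_EFinP; apply: continuous_measurable_fun => x.
  apply: (@continuous_comp _ _ _ (fun x : R => - s * x ^+ 2) expR); last exact: continuous_expR.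
  have h : (fun _ : R => - s) @ x --> - s by exact: cst_continuous.
  have h' : (fun s : R => s) @ x --> x by exact: cvg_id.
  exact: (cvgM h (cvgM h' h')).
rewrite -(fineK fin) ge0_integralZr//.
- apply: lte_mul_pinfty; last by rewrite fineK.
  + by apply: integral_ge0 => x _; rewrite lee_fin expR_ge0.
  + by rewrite ge0_fin_numE ?gauss1// integral_ge0// => x _; rewrite lee_fin expR_ge0.
- by rewrite fineK// integral_ge0// => t _; rewrite lee_fin gauss_ge0.
Qed.

End gaussian.

Section slow_growth.
Context {R : realType} {n : nat}.
Implicit Types (f g : 'rV[R]_n -> R) (x a : 'rV[R]_n).

(** Growth below exp(b |x|^2) for every b > 0. Quantifying over all b makes the class closed under
    products, by halving b, and any Gaussian makes its measurable members integrable. *)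
Definition slow g := forall b : R, 0 < b -> exists2 C : R, 0 <= C &
  forall x, `|g x| <= C * gauss (- b) x.

Lemma gauss_opp b x : gauss (- b) x = expR (b * dot x x).
Proof. by rewrite /gauss opprK. Qed.

Lemma slow_le f g : slow g -> (forall x, `|f x| <= g x) -> slow f.
Proof.
move=> sg fg b b0; have [C C0 HC] := sg b b0; exists C => // x.
by rewrite (le_trans (fg x))// (le_trans (ler_norm _)).
Qed.

Lemma slow_cst c : slow (fun=> c).
Proof.
move=> b b0; exists `|c| => // x; rewrite ler_peMr// gauss_opp.
by rewrite -expR0 ler_expR mulr_ge0 ?dot_ge0// ltW.
Qed.

Lemma slowD f g : slow f -> slow g -> slow (fun x => f x + g x).
Proof.
move=> sf sg b b0; have [C C0 HC] := sf b b0; have [D D0 HD] := sg b b0.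
exists (C + D); first exact: addr_ge0.
by move=> x; rewrite (le_trans (ler_normD _ _))// mulrDl lerD.
Qed.

Lemma slowM f g : slow f -> slow g -> slow (fun x => f x * g x).
Proof.
move=> sf sg b b0; have b2 : 0 < b / 2 by rewrite divr_gt0.
have [C C0 HC] := sf _ b2; have [D D0 HD] := sg _ b2.
exists (C * D); first exact: mulr_ge0.
move=> x; rewrite normrM [b]splitr opprD gaussD mulrACA.
by apply: ler_pM.
Qed.

Lemma slowN f : slow f -> slow (fun x => - f x).
Proof.
by move=> sf b b0; have [C C0 HC] := sf b b0; exists C => // x; rewrite normrN.
Qed.

Lemma slow_sum (I : Type) (s : seq I) (F : I -> 'rV[R]_n -> R) :
  (forall i, slow (F i)) -> slow (fun x => \sum_(i <- s) F i x).
Proof.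
move=> HF; elim: s => [|i s IH].
  by under [X in slow X]eq_fun do rewrite big_nil; exact: slow_cst.
by under [X in slow X]eq_fun do rewrite big_cons; exact: slowD.
Qed.

Lemma slow_prod (I : eqType) (s : seq I) (F : I -> 'rV[R]_n -> R) :
  (forall i, i \in s -> slow (F i)) -> slow (fun x => \prod_(i <- s) F i x).
Proof.
elim: s => [_|i s IH HF].
  by under [X in slow X]eq_fun do rewrite big_nil; exact: slow_cst.
under [X in slow X]eq_fun do rewrite big_cons.
apply: slowM; first by apply: HF; rewrite inE eqxx.
by apply: IH => j js; apply: HF; rewrite inE js orbT.
Qed.

Lemma slow_sqr_norm : slow (fun x => 1 + dot x x).
Proof.
move=> b b0; exists (Num.max 1 b^-1); first by rewrite le_max ler01.
move=> x; have x0 := dot_ge0 x; rewrite ger0_norm ?addr_ge0// gauss_opp.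
have := expR_ge1Dx (b * dot x x); set e := expR _ => he.
have [b1|b1] := leP b 1.
  have i1 : 1 <= b^-1 by rewrite invf_ge1.
  rewrite max_r// mulrC ler_pdivlMr//; apply: le_trans he.
  by rewrite mulrDl mul1r [_ * b]mulrC lerD2r.
have i1 : b^-1 <= 1 by rewrite invf_le1// ltW.
rewrite max_l// mul1r; apply: le_trans he.
by rewrite lerD2l ler_peMl// ltW.
Qed.

Lemma normr_dot_le_sqr a x : `|dot a x| <= enorm a * (1 + dot x x).
Proof.
apply: (le_trans (normr_dot_le _ _)); rewrite ler_wpM2l ?enorm_ge0// -sqr_enorm.
have := sqr_ge0 (enorm x - 1); have := enorm_ge0 x.
by move: (enorm x) => z; nra.
Qed.

Lemma slow_dot a : slow (fun x => dot a x).
Proof.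
apply: (@slow_le _ (fun x => enorm a * (1 + dot x x))).
  by apply: slowM; [exact: slow_cst|exact: slow_sqr_norm].
exact: normr_dot_le_sqr.
Qed.

Lemma slow_sqr_dot : slow (fun x => dot x x).
Proof.
apply: (slow_le slow_sqr_norm) => x.
by rewrite ger0_norm ?dot_ge0// lerDr.
Qed.

Lemma slow_powR f p : 0 <= p -> (forall x, 0 <= f x) -> slow f -> slow (fun x => f x `^ p).
Proof.
move=> p0 f0 sf b b0.
(* Raising to the power p multiplies the exponent by p, and p/(p + 1) <= 1; dividing by p + 1 also
   covers p = 0. *)
have bp : 0 < b / (p + 1) by rewrite divr_gt0// ltr_wpDl.
have [C C0 HC] := sf _ bp; exists (C `^ p); first exact: powR_ge0.
move=> x; rewrite ger0_norm ?powR_ge0//.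
have := HC x; rewrite ger0_norm// => Hx.
apply: (@le_trans _ _ ((C * gauss (- (b / (p + 1))) x) `^ p)).
  by apply: ge0_ler_powR; rewrite ?nnegrE ?mulr_ge0 ?gauss_ge0.
rewrite powRM ?gauss_ge0// ler_wpM2l ?powR_ge0// !gauss_opp -expRM ler_expR.
rewrite mulrAC ler_wpM2r ?dot_ge0// mulrAC -mulrA ler_piMr ?(ltW b0)//.
by rewrite ler_pdivrMr ?mul1r ?lerDl// ltr_wpDl.
Qed.

Lemma Lint_slow_gauss g s : 0 < s -> mrow g -> slow g -> Lint (fun x => g x * gauss s x).
Proof.
move=> s0 mg sg; have s2 : 0 < s / 2 by rewrite divr_gt0.
have [C C0 HC] := sg _ s2.
apply: (@Lint_le _ _ _ (fun x => C * gauss (s / 2) x)).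
- apply: measurable_funM => //; exact: (mrow_continuous (@continuous_gauss _ n s)).
- move=> x; rewrite normrM [X in _ * X]ger0_norm ?gauss_ge0//.
  have -> : gauss (s / 2) x = gauss (- (s / 2)) x * gauss s x.
    by rewrite -gaussD; congr (gauss _ x); field.
  by rewrite mulrA ler_wpM2r ?gauss_ge0.
- by apply: LintZ; exact: Lint_gauss.
Qed.

End slow_growth.

(** * Integration by parts for Dunkl operators *)

Section regularized_weight.
Context {R : realType} {d : nat}.
Variables (Phi Pos : {fset 'rV[R]_d}) (k : 'rV[R]_d -> R).
Hypotheses (rootP : root_system Phi) (normP : normalized Phi).
Hypotheses (posP : positive_subsystem Phi Pos) (kP : multiplicity_function Phi k).
Implicit Types (x y t a xi : 'rV[R]_d).

Lemma continuous_normr_powR (p : R) : 0 <= p -> continuous (fun y : R => `|y| `^ p).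
Proof.
move=> p0; have [->|pn] := eqVneq p 0.
  by under [X in continuous X]eq_fun do rewrite powRr0; move=> y; exact: cst_continuous.
have pp : 0 < p by rewrite lt_def pn.
move=> y; have [->|y0] := eqVneq y 0.
  rewrite /continuous_at normr0 powR0//; apply/cvgrPdist_lt => e e0.
  have r0 : 0 < e `^ p^-1 by rewrite powR_gt0.
  exists (e `^ p^-1) => // z /=; rewrite !sub0r !normrN => zr.
  rewrite ger0_norm ?powR_ge0//.
  have -> : e = (e `^ p^-1) `^ p by rewrite -powRrM mulVf// powRr1// ltW.
  by rewrite gt0_ltr_powR ?nnegrE ?powR_ge0.
have n0 : 0 < `|y| by rewrite normr_gt0.
apply: (@continuous_comp _ _ _ (fun z : R => `|z|) (fun z => z `^ p)); first exact: norm_continuous.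
have := is_derive1_powR p n0 => -[dp _].
by apply: differentiable_continuous; apply/derivable1_diffP.
Qed.

(* Taking [e > 0] smooths the weight across the reflecting hyperplanes. *)
Definition om (e : R) x : R := \prod_(a <- Pos) (dot a x ^+ 2 + e) `^ k a.

Lemma om_ge0 e x : 0 <= om e x.
Proof. by apply: prodr_ge0 => a _; exact: powR_ge0. Qed.

Lemma dunkl_weightE x : dunkl_weight Pos k x = om 0 x.
Proof.
rewrite /dunkl_weight /om; apply: eq_bigr => a _.
by rewrite addr0 powRrM powR_mulrn// real_normK ?num_real.
Qed.

Lemma continuous_om e : 0 <= e -> continuous (om e).
Proof.
move=> e0.
have -> : om e = (fun x => \prod_(a <- Pos | a \in Pos) (dot a x ^+ 2 + e) `^ k a).
  by apply/funext => x; rewrite /om big_seq.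
apply: continuous_big => [p|a aP].
  by apply: cvgM; [exact: cvg_fst|exact: cvg_snd].
have -> : (fun x => (dot a x ^+ 2 + e) `^ k a) = (fun x => `|dot a x ^+ 2 + e| `^ k a).
  by apply/funext => x; rewrite ger0_norm// addr_ge0 ?sqr_ge0.
move=> x; have c1 : {for x, continuous (fun x : 'rV[R]_d => dot a x ^+ 2 + e)}.
  have h : (fun _ : 'rV[R]_d => e) @ x --> e by exact: cst_continuous.
  exact: (cvgD (cvgM (@continuous_dot _ _ a x) (@continuous_dot _ _ a x)) h).
exact: (continuous_comp c1 (@continuous_normr_powR _ (k_ge0 posP kP aP) _)).
Qed.

Lemma om_cvg x (u : nat -> R) : (forall m, 0 <= u m) -> u m @[m --> \oo] --> 0 ->
  om (u m) x @[m --> \oo] --> om 0 x.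
Proof.
move=> u0 cu; rewrite /om.
have E e : \prod_(a <- Pos) (dot a x ^+ 2 + e) `^ k a =
    \prod_(a <- Pos | a \in Pos) (dot a x ^+ 2 + e) `^ k a by rewrite big_seq.
rewrite E; under [X in X @ _ --> _]eq_fun do rewrite E.
apply: cvg_big => [|a aP]; first exact: mul_continuous.
have H e : 0 <= e -> (dot a x ^+ 2 + e) `^ k a = `|dot a x ^+ 2 + e| `^ k a.
  by move=> e0; rewrite ger0_norm// addr_ge0 ?sqr_ge0.
rewrite H//; under [X in X @ _ --> _]eq_fun do rewrite H//.
have c1 : (dot a x ^+ 2 + u m : R) @[m --> \oo] --> dot a x ^+ 2 + 0.
  by apply: cvgD cu; exact: cvg_cst.
have := continuous_cvg _ (@continuous_normr_powR _ (k_ge0 posP kP aP) _) c1.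
exact.
Qed.

Lemma om_refl e b x : b \in Phi -> om e (refl b x) = om e x.
Proof.
move=> bP; have b2 := normP bP.
rewrite /om -[RHS](@big_Pos_refl _ _ _ _ rootP normP posP _ _ _
  (fun a => (dot a x ^+ 2 + e) `^ k a) b bP).
  rewrite big_seq [RHS]big_seq; apply: eq_bigr => a aP.
  by rewrite (k_refl kP (Pos_sub posP aP) bP) -(dot_refl_swap b2).
by move=> a aP; rewrite dotNl sqrrN (k_opp normP kP aP).
Qed.

Lemma om_le e x : 0 <= e <= 1 -> om e x <= om 1 x.
Proof.
move=> /andP[e0 e1]; rewrite /om big_seq [leRHS]big_seq; apply: ler_prod => a aP.
rewrite powR_ge0/=; apply: ge0_ler_powR; rewrite ?nnegrE ?addr_ge0 ?sqr_ge0//.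
  exact: (k_ge0 posP kP aP).
by rewrite lerD2l.
Qed.

Lemma slow_om e : 0 <= e -> slow (om e).
Proof.
move=> e0; apply: slow_prod => a aP; apply: slow_powR; first exact: (k_ge0 posP kP aP).
  by move=> x; rewrite addr_ge0 ?sqr_ge0.
apply: slowD; last exact: slow_cst.
by apply: (@slowM _ _ (dot a) (dot a)); exact: slow_dot.
Qed.

Definition om_dlog (e : R) xi x : R :=
  \sum_(a <- Pos) 2 * k a * dot a xi * (dot a x / (dot a x ^+ 2 + e)).

Lemma is_derive_om e x xi (r : R) : 0 < e ->
  is_derive r 1 (fun s : R => om e (s *: xi + x)) (om e (r *: xi + x) * om_dlog e xi (r *: xi + x)).
Proof.
move=> e0; rewrite /om_dlog /om.
pose F a (t : R) := (dot a (t *: xi + x) ^+ 2 + e) `^ k a.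
pose G a := 2 * k a * dot a xi * (dot a (r *: xi + x) / (dot a (r *: xi + x) ^+ 2 + e)).
suff H (l : seq 'rV[R]_d) : is_derive r 1 (fun t : R => \prod_(a <- l) F a t)
    (\prod_(a <- l) F a r * \sum_(a <- l) G a) by exact: H.
elim: l => [|a l IH].
  have -> : (fun t : R => \prod_(a <- [::]) F a t) = (fun=> 1) by apply/funext => t; rewrite big_nil.
  by rewrite !big_nil mulr0; exact: is_derive_cst.
have -> : (fun t : R => \prod_(b <- a :: l) F b t) = (fun t : R => F a t * \prod_(b <- l) F b t).
  by apply/funext => t; rewrite big_cons.
rewrite !big_cons; move: IH; pose P (t : R) := \prod_(b <- l) F b t.
move: (\sum_(b <- l) G b) => S.
change (is_derive r 1 P (P r * S) ->
  is_derive r 1 (fun t : R => F a t * P t) (F a r * P r * (G a + S))); move: P => P IH.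
set b := dot a (r *: xi + x).
have be : 0 < b ^+ 2 + e by rewrite ltr_wpDl// sqr_ge0.
have h1 : is_derive r 1 (fun s : R => dot a (s *: xi + x)) (dot a xi).
  have -> : (fun s : R => dot a (s *: xi + x)) = (fun s : R => dot a xi * s + dot a x).
    by apply/funext => z; rewrite dotDr dotZr mulrC.
  by apply: is_derive_eq; rewrite addr0 [_ *: _]mulr1 /GRing.scale/=; ring.
have h2 : is_derive r 1 (fun s : R => dot a (s *: xi + x) ^+ 2 + e) (2 * b * dot a xi).
  apply: (is_derive_eq (is_deriveD (is_deriveM h1 h1) (is_derive_cst e _ _))).
  by rewrite addr0 -/b -![_ *: _]/(_ * _); ring.
have h3 := @is_derive1_comp R (fun z : R => z `^ k a) (fun s : R => dot a (s *: xi + x) ^+ 2 + e) r _ _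
  (is_derive1_powR (k a) be) h2.
apply: (is_derive_eq (is_deriveM h3 IH)); rewrite /comp -/b -![_ *: _]/(_ * _).
have -> : (b ^+ 2 + e) `^ (k a - 1) = (b ^+ 2 + e) `^ k a / (b ^+ 2 + e).
  by rewrite powRB ?powRr1 ?(ltW be)// (gt_eqF be) implybT.
rewrite /F /G -/b; move: ((b ^+ 2 + e) `^ k a) (P r) => z q.
by field; rewrite gt_eqF.
Qed.

End regularized_weight.

Lemma is_derive_Int {R : realType} {d : nat} (f df : R -> 'rV[R]_d -> R) (h : 'rV[R]_d -> R)
    (a b r : R) : a < r < b ->
  (forall u, a < u < b -> Lint (f u)) ->
  (forall u x, a < u < b -> is_derive u 1 (f ^~ x) (df u x)) ->
  (forall u x, a < u < b -> `|df u x| <= h x) -> Lint h ->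
  is_derive r 1 (fun u => Int (f u)) (Int (df r)).
Proof.
move=> rab Lf Df Hf Lh.
pose F (u : R) (t : d.-tuple (measurableTypeR R)) := f u (rowt t).
have I0 : `]a, b[%classic r by rewrite /= in_itv.
have iF (u : R) : `]a, b[%classic u ->
    (lebesgue_tuple R d).-integrable setT (fun t => (F u t)%:E).
  by rewrite /= in_itv; exact: Lf.
have dF (u : R) (t : d.-tuple (measurableTypeR R)) : `]a, b[%classic u -> setT t ->
    derivable (F ^~ t) u 1.
  by rewrite /= in_itv => u0 _; have [] := Df u (rowt t) u0.
have P (u : R) (t : d.-tuple (measurableTypeR R)) : a < u < b -> partial1of2 F u t = df u (rowt t).
  by move=> u0; rewrite partial1of2E (@derive_val _ _ _ _ _ _ _ (Df u (rowt t) u0)).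
have h0 (t : d.-tuple (measurableTypeR R)) : 0 <= h (rowt t).
  by rewrite (le_trans _ (Hf r (rowt t) rab)).
have hF (u : R) (t : d.-tuple (measurableTypeR R)) : `]a, b[%classic u -> setT t ->
    `|partial1of2 F u t| <= h (rowt t).
  by rewrite /= in_itv/= => u0 _; rewrite P//; exact: Hf.
apply: DeriveDef; first exact: (derivable_under_integral measurableT I0 iF dF h0 Lh hF).
rewrite -derive1E (differentiation_under_integral measurableT I0 iF dF h0 Lh hF).
by apply: eq_Rintegral => t _; exact: P.
Qed.

Section integration_by_parts.
Context {R : realType} {d : nat}.
Variables (Phi Pos : {fset 'rV[R]_d}) (k : 'rV[R]_d -> R).
Hypotheses (rootP : root_system Phi) (normP : normalized Phi).
Hypotheses (posP : positive_subsystem Phi Pos) (kP : multiplicity_function Phi k).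
Implicit Types (x y a xi : 'rV[R]_d).
Local Notation om := (om Pos k).
Local Notation om_dlog := (om_dlog Pos k).
Local Notation mu := (lebesgue_tuple R d).

Variable s : R.
Hypothesis s0 : 0 < s.

Definition rho (e : R) x : R := om e x * gauss s x.
Definition drho (e : R) xi x : R := om e x * (om_dlog e xi x - 2 * s * dot xi x) * gauss s x.

Lemma scaleRE (p q : R) : p *: (q : R^o) = p * q. Proof. by []. Qed.

Lemma rho_ge0 e x : 0 <= rho e x.
Proof. by rewrite mulr_ge0 ?om_ge0 ?gauss_ge0. Qed.

Lemma continuous_rho e : 0 <= e -> continuous (rho e).
Proof.
move=> e0 x; exact: (cvgM (@continuous_om _ _ _ _ _ posP kP e e0 x) (@continuous_gauss _ _ s x)).
Qed.

Lemma rho_refl e b x : b \in Phi -> rho e (refl b x) = rho e x.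
Proof.
move=> bP; rewrite /rho (om_refl rootP normP posP kP)//.
by rewrite /gauss dot_refl2// normP.
Qed.

Lemma Lint_rho_mul e g : 0 <= e -> mrow g -> slow g -> Lint (fun x => g x * rho e x).
Proof.
move=> e0 mg sg.
have -> : (fun x => g x * rho e x) = (fun x => (g x * om e x) * gauss s x).
  by apply/funext => x; rewrite mulrA.
apply: Lint_slow_gauss => //; last by apply: slowM => //; exact: (slow_om posP kP).
by apply: measurable_funM => //; apply: mrow_continuous; exact: (continuous_om posP kP).
Qed.

Lemma Lint_rho e : 0 <= e -> Lint (rho e).
Proof.
move=> e0; have := Lint_rho_mul e0 (measurable_cst (1 : R)) (slow_cst 1).
by under [X in Lint X -> _]eq_fun do rewrite mul1r.
Qed.

Lemma is_derive_rho e x xi (r : R) : 0 < e ->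
  is_derive r 1 (fun h : R => rho e (h *: xi + x)) (drho e xi (r *: xi + x)).
Proof.
move=> e0; have h1 := is_derive_om Pos k x xi r e0.
have hd : is_derive r 1 (fun h : R => - s * dot (h *: xi + x) (h *: xi + x))
    (- s * (2 * dot xi (r *: xi + x))).
  have -> : (fun h : R => - s * dot (h *: xi + x) (h *: xi + x)) =
     (fun h : R => - s * (h * h * dot xi xi + 2 * h * dot xi x + dot x x)).
    by apply/funext => h; rewrite !(dotDl, dotDr, dotZl, dotZr) (dotC x xi); ring.
  have -> : - s * (2 * dot xi (r *: xi + x)) = - s * ((r + r) * dot xi xi + 2 * dot xi x + 0).
    by rewrite dotDr dotZr; ring.
  apply: is_derive_eq; rewrite !(scaler0, addr0, add0r) !scaleRE.
  by ring.
have h2 := @is_derive1_comp R expR (fun h : R => - s * dot (h *: xi + x) (h *: xi + x)) r _ _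
  (is_derive_expR _) hd.
apply: (is_derive_eq (is_deriveM h1 h2)); rewrite /drho /gauss /comp; rewrite !scaleRE.
by ring.
Qed.

Lemma slow_inv_sqrD (e : R) a : 0 < e -> slow (fun x => (dot a x ^+ 2 + e)^-1).
Proof.
move=> e0; apply: (slow_le (slow_cst e^-1)) => x.
have h : 0 < dot a x ^+ 2 + e by rewrite ltr_wpDl ?sqr_ge0.
rewrite ger0_norm ?invr_ge0 ?(ltW h)// lef_pV2 ?posrE//.
by rewrite lerDr sqr_ge0.
Qed.

Lemma slow_om_dlog e xi : 0 < e -> slow (om_dlog e xi).
Proof.
move=> e0; apply: slow_sum => a; apply: slowM; first exact: slow_cst.
by apply: slowM; [exact: slow_dot|exact: slow_inv_sqrD].
Qed.

Lemma drho_bound e xi : 0 < e -> exists2 C, 0 <= C & forall (r : R) x, `|r| <= 1 ->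
  `|drho e xi (r *: xi + x)| <= C * gauss (s / 4) x.
Proof.
move=> e0; have s2 : 0 < s / 2 by rewrite divr_gt0.
have sw : slow (fun x => om e x * (om_dlog e xi x - 2 * s * dot xi x)).
  apply: slowM; first exact: (slow_om posP kP (ltW e0)).
  apply: slowD; first exact: slow_om_dlog.
  by apply: slowN; apply: slowM; [exact: slow_cst|exact: slow_dot].
have [C C0 HC] := sw _ s2.
exists (C * expR (s / 2 * dot xi xi)); first by rewrite mulr_ge0 ?expR_ge0.
move=> r x r1; rewrite /drho normrM [X in _ * X]ger0_norm ?gauss_ge0//.
apply: (@le_trans _ _ (C * gauss (s / 2) (r *: xi + x))).
  have -> : gauss (s / 2) (r *: xi + x) = gauss (- (s / 2)) (r *: xi + x) * gauss s (r *: xi + x).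
    by rewrite -gaussD; have -> : - (s / 2) + s = s / 2 by lra.
  by rewrite mulrA ler_wpM2r ?gauss_ge0.
rewrite -[leRHS]mulrA ler_wpM2l// /gauss -expRD ler_expR.
(* The square |x + 2 r xi|^2 >= 0 yields |r xi + x|^2 >= |x|^2/2 - r^2 |xi|^2. This is the origin of
   s/4 and of the factor exp(s |xi|^2/2), and it makes the bound uniform in |r| <= 1. *)
have := dot_ge0 (x + (2 * r) *: xi).
rewrite !(dotDl, dotDr, dotZl, dotZr) (dotC x xi).
have r2 : r ^+ 2 <= 1 by rewrite -(@real_normK _ r) ?num_real// expr_le1.
have := dot_ge0 xi; move: (dot xi xi) (dot xi x) (dot x x) => p q w p0 H.
have H2 : r ^+ 2 * p <= p by rewrite ler_piMl.
have H1 : 0 <= (s / 4) * (w + 4 * r * q + 4 * (r ^+ 2 * p)).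
  rewrite mulr_ge0 ?divr_ge0 ?(ltW s0)// (le_trans H)// le_eqVlt; apply/orP; left.
  by apply/eqP; ring.
have : 0 <= s / 2 * (p - r ^+ 2 * p) by rewrite mulr_ge0 ?subr_ge0// ltW.
set z := s / 2 * _ => z0.
rewrite -subr_ge0 (le_trans (addr_ge0 H1 z0))// le_eqVlt; apply/orP; left.
by apply/eqP; rewrite /z; field.
Qed.

Variables (L : R) (g : 'rV[R]_d -> R).
Hypotheses (L0 : 0 <= L) (tg : tame L g).

Let cg : continuous g. Proof. exact: tame_continuous tg. Qed.

(** The derivative is the pointwise limit of the continuous difference quotients with steps
    1/(m+1). *)
Lemma mrow_derive xi : mrow (fun x => 'D_xi (g : _ -> R^o) x).
Proof.
have mq (m : nat) : mrow (fun x => m.+1%:R * (g (m.+1%:R^-1 *: xi + x) - g x)).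
  apply: mrow_continuous => x.
  have h : (fun _ : 'rV[R]_d => m.+1%:R^-1 *: xi) @ x --> m.+1%:R^-1 *: xi by exact: cst_continuous.
  have h' : (fun y : 'rV[R]_d => y) @ x --> x by exact: cvg_id.
  have h1 : {for x, continuous (fun x => g (m.+1%:R^-1 *: xi + x))}.
    by apply: continuous_comp; [exact: (cvgD h h')|exact: cg].
  have h2 : (fun _ : 'rV[R]_d => m.+1%:R : R) @ x --> (m.+1%:R : R) by exact: cst_continuous.
  exact: (cvgM h2 (cvgB h1 (@cg x))).
have n0 (m : nat) : (m.+1%:R^-1 : R) != 0 by rewrite invr_eq0.
apply: (measurable_fun_cvg (fun m => mq m)) => t _.
have [_ _ dg] := tg.
have := dg (rowt t) xi; rewrite /derivable => h.
have h' : (h^-1 * (g (h *: xi + rowt t) - g (rowt t))) @[h --> (0 : R)^'] -->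
   'D_xi (g : _ -> R^o) (rowt t) by exact: h.
move/cvgr_dnbhsP : h' => /(_ (fun m : nat => m.+1%:R^-1) (conj n0 cvg_harmonic)).
by under eq_fun do rewrite invrK.
Qed.

(** Translation invariance equates the integral of g(x + h xi) rho_e(x) with that of g(x) rho_e(x -
    h xi). Both are differentiated at h = 0 under the integral sign, dominated on the left by the
    Lipschitz bound of [g] and on the right by [drho_bound]. *)
Lemma int_derive_rho e xi : 0 < e ->
  Int (fun x => 'D_xi (g : _ -> R^o) x * rho e x) = Int (fun x => g x * drho e (- xi) x).
Proof.
move=> e0; have e1 := ltW e0.
have crho := continuous_rho e1; have [g1 gL dg] := tg.
have cshift (v : 'rV[R]_d) : continuous (fun x => v + x).
  move=> x; have h : (fun _ : 'rV[R]_d => v) @ x --> v by exact: cst_continuous.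
  have h' : (fun y : 'rV[R]_d => y) @ x --> x by exact: cvg_id.
  exact: (cvgD h h').
pose f1 (h : R) x := g (h *: xi + x) * rho e x.
pose f2 (h : R) x := g x * rho e (h *: (- xi) + x).
have D1 (h : R) x : is_derive h 1 (f1 ^~ x)
    (('D_xi (g : 'rV[R]_d -> R^o) (h *: xi + x) : R) * rho e x).
  have h1 : is_derive (h *: xi + x) xi (g : _ -> R^o) ('D_xi (g : _ -> R^o) (h *: xi + x)).
    exact: DeriveDef (dg _ _) erefl.
  have h2 := is_derive_line h1.
  apply: (is_derive_eq (is_deriveM h2 (is_derive_cst (rho e x) _ _))).
  by rewrite !scaleRE; rewrite mulr0 add0r mulrC.
have D2 (h : R) x : is_derive h 1 (f2 ^~ x) (g x * drho e (- xi) (h *: (- xi) + x)).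
  apply: (is_derive_eq (is_deriveM (is_derive_cst (g x) _ _) (is_derive_rho x (- xi) h e0))).
  by rewrite !scaleRE; rewrite mulr0 addr0.
have mf1 h : continuous (fun x => g (h *: xi + x) * rho e x).
  move=> x; have c1 : {for x, continuous (fun x => g (h *: xi + x))}.
    by apply: continuous_comp; [exact: cshift|exact: cg].
  exact: (cvgM c1 (@crho x)).
have mf2 h : continuous (fun x => g x * rho e (h *: (- xi) + x)).
  move=> x; have c1 : {for x, continuous (fun x => rho e (h *: (- xi) + x))}.
    by apply: continuous_comp; [exact: cshift|exact: crho].
  exact: (cvgM (@cg x) c1).
have L1 h : Lint (fun x => g (h *: xi + x) * rho e x).
  apply: Lint_rho_mul => //; last by apply: (slow_le (slow_cst 1)) => x.
  by apply: mrow_continuous => x; apply: continuous_comp; [exact: cshift|exact: cg].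
have Lrho := Lint_rho e1.
have LI h : Lint (fun x => g x * rho e (h *: (- xi) + x)) /\
    Int (fun x => g (h *: xi + x) * rho e x) = Int (fun x => g x * rho e (h *: (- xi) + x)).
  have [H1 H2] := Int_scales_volume (scales_volume_translation (- (h *: xi))) (mf1 h) (L1 h).
  move: H1 H2; rewrite mul1r.
  have -> : (fun x => g (h *: xi + (x - h *: xi)) * rho e (x - h *: xi)) =
    (fun x => g x * rho e (h *: - xi + x)).
    by apply/funext => x; rewrite addrC subrK scalerN [X in rho e X]addrC.
  by move=> ? <-.
have [C C0 HC] := drho_bound (- xi) e0.
have I0 : -1 < (0 : R) < 1 by rewrite ltrN10 ltr01.
have E1 := is_derive_Int I0 (fun h _ => L1 h) (fun h x _ => D1 h x) _ (LintZ (L * enorm xi) Lrho).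
have E2 := is_derive_Int I0 (fun h _ => (LI h).1) (fun h x _ => D2 h x) _
  (LintZ C (Lint_gauss d (divr_gt0 s0 (ltr0Sn R 3)))).
have <- : 'D_1 (fun h : R => Int (f1 h)) (0 : R) = Int (fun x => 'D_xi (g : _ -> R^o) x * rho e x).
  rewrite (@derive_val _ _ _ _ _ _ _ (E1 _)).
    by apply: eq_Int => x; rewrite scale0r add0r.
  move=> h x _; rewrite normrM [X in _ * X]ger0_norm ?rho_ge0// ler_wpM2r ?rho_ge0//.
  exact: tame_derive.
have -> : (fun h : R => Int (f1 h)) = (fun h : R => Int (f2 h)).
  by apply/funext => h; exact: (LI h).2.
rewrite (@derive_val _ _ _ _ _ _ _ (E2 _)).
  by apply: eq_Int => x; rewrite scale0r add0r.
move=> h x /andP[h1 h2]; rewrite normrM -[leRHS]mul1r; apply: ler_pM => //.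
by apply: HC; rewrite ler_norml !ltW.
Qed.

End integration_by_parts.

Section dunkl_integration_by_parts.
Context {R : realType} {d : nat}.
Variables (Phi Pos : {fset 'rV[R]_d}) (k : 'rV[R]_d -> R).
Hypotheses (rootP : root_system Phi) (normP : normalized Phi).
Hypotheses (posP : positive_subsystem Phi Pos) (kP : multiplicity_function Phi k).
Implicit Types (x y a xi : 'rV[R]_d).
Variable s : R.
Hypothesis s0 : 0 < s.
Local Notation om := (om Pos k).
Local Notation rho := (rho Pos k s).
Local Notation drho := (drho Pos k s).
Variables (L : R) (g : 'rV[R]_d -> R).
Hypotheses (L0 : 0 <= L) (tg : tame L g).

Let cg : continuous g. Proof. exact: tame_continuous tg. Qed.

Let crefl a : dot a a = 2 -> continuous (fun x => refl a x).
Proof. by move=> /scales_volume_refl[]. Qed.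

Let cgr a : dot a a = 2 -> continuous (fun x => g (refl a x)).
Proof.
by move=> a2 x; apply: continuous_comp; [exact: crefl|exact: cg].
Qed.

Let crho e : 0 <= e -> continuous (rho e).
Proof. move=> e0; exact: (continuous_rho posP kP). Qed.

Let Lrho e f : 0 <= e -> continuous f -> slow f -> Lint (fun x => f x * rho e x).
Proof. by move=> e0 cf sf; apply: (Lint_rho_mul posP kP s0) => //; exact: mrow_continuous. Qed.

Let sg : slow g.
Proof. by apply: (slow_le (slow_cst 1)) => x; case: tg. Qed.

Let sgr a : slow (fun x => g (refl a x)).
Proof. by apply: (slow_le (slow_cst 1)) => x; case: tg. Qed.

(** A regularization of 1/(a,x), odd under the reflection in [a]; it is what differentiating the
    factor ((a,x)^2 + e)^k(a) of [om e] produces. *)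
Definition pole e a x : R := dot a x / (dot a x ^+ 2 + e).

Lemma slow_pole e a : 0 < e -> slow (pole e a).
Proof. by move=> e0; apply: slowM; [exact: slow_dot|exact: slow_inv_sqrD]. Qed.

Lemma continuous_pole e a : 0 < e -> continuous (pole e a).
Proof.
move=> e0 x; have c := @continuous_dot _ _ a x.
have h : (fun _ : 'rV[R]_d => e) @ x --> e by exact: cst_continuous.
have h2 : (fun y => dot a y ^+ 2 + e) @ x --> dot a x ^+ 2 + e by exact: (cvgD (cvgM c c) h).
have n0 : dot a x ^+ 2 + e != 0 by rewrite gt_eqF// ltr_wpDl ?sqr_ge0.
have h3 : (fun y => (dot a y ^+ 2 + e)^-1) @ x --> (dot a x ^+ 2 + e)^-1 by exact: (cvgV n0 h2).
exact: (cvgM c h3).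
Qed.

Let cpole (f : 'rV[R]_d -> R) (e : R) a : 0 < e -> continuous f -> continuous (fun x => f x * pole e a x).
Proof. by move=> e0 cf x; exact: (cvgM (@cf x) (@continuous_pole e a e0 x)). Qed.

(** The reflection preserves Lebesgue measure and [rho e] and changes the sign of the pole, so the
    reflected term contributes as much as the first. *)
Lemma Int_pole_refl e a : 0 < e -> a \in Pos ->
  Int (fun x => (g x - g (refl a x)) * pole e a x * rho e x) =
  2 * Int (fun x => g x * pole e a x * rho e x).
Proof.
move=> e0 aP; have e1 := ltW e0; have aPhi := Pos_sub posP aP; have a2 := normP aPhi.
have L1 : Lint (fun x => g x * pole e a x * rho e x).
  by apply: Lrho => //; [exact: cpole|apply: slowM => //; exact: slow_pole].
have L2 : Lint (fun x => g (refl a x) * pole e a x * rho e x).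
  by apply: Lrho => //; [apply: cpole => //; exact: cgr|apply: slowM => //; exact: slow_pole].
have c2 : continuous (fun x => g (refl a x) * pole e a x * rho e x).
  move=> x; apply: (cvgM _ (crho e1 (x := x))).
  by apply: (cpole e0 (cgr a2)).
have [_ H] := Int_scales_volume (scales_volume_refl a2) c2 L2.
transitivity (Int (fun x => g x * pole e a x * rho e x - g (refl a x) * pole e a x * rho e x)).
  by apply: eq_Int => x; ring.
rewrite IntB//.
have -> : Int (fun x => g (refl a x) * pole e a x * rho e x) =
    - Int (fun x => g x * pole e a x * rho e x); last by move: (Int _) => z; ring.
rewrite -[LHS]mul1r -H -IntN//; apply: eq_Int => x.
rewrite (reflK a2) (rho_refl rootP normP posP kP)// /pole (dot_refl a2) sqrrN mulNr.
by rewrite mulrN mulNr.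
Qed.

Lemma drhoE e xi x : drho e (- xi) x =
  2 * s * dot xi x * rho e x - \sum_(a <- Pos) 2 * k a * dot a xi * (pole e a x * rho e x).
Proof.
rewrite /drho /rho /om_dlog dotNl.
have -> : \sum_(a <- Pos) 2 * k a * dot a xi * (pole e a x * (om e x * gauss s x)) =
  (\sum_(a <- Pos) 2 * k a * dot a xi * pole e a x) * (om e x * gauss s x).
  by rewrite mulr_suml; apply: eq_bigr => a _; rewrite mulrA.
have -> : \sum_(a <- Pos) 2 * k a * dot a (- xi) * (dot a x / (dot a x ^+ 2 + e)) =
    - \sum_(a <- Pos) 2 * k a * dot a xi * pole e a x.
  by rewrite -sumrN; apply: eq_bigr => a _; rewrite dotNr /pole mulrN mulNr.
move: (\sum_(a <- Pos) _) (om e x) (gauss s x) (dot xi x) => A B D E.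
by ring.
Qed.

(** The logarithmic derivative of the weight contributes -2 k(a) (a,xi) times the integral of g
    against the pole, and by [Int_pole_refl] the difference terms cancel it exactly. Only the
    derivative of the Gaussian remains. *)
Lemma int_dunkl_regularized e xi : 0 < e ->
  Int (fun x => 'D_xi (g : _ -> R^o) x * rho e x) +
  \sum_(a <- Pos) k a * dot a xi * Int (fun x => (g x - g (refl a x)) * pole e a x * rho e x) =
  2 * s * Int (fun x => dot xi x * g x * rho e x).
Proof.
move=> e0; have e1 := ltW e0; rewrite (int_derive_rho posP kP s0 L0 tg)//.
have L1 : Lint (fun x => dot xi x * g x * rho e x).
  apply: Lrho => //; last by apply: slowM => //; exact: slow_dot.
  by move=> x; exact: (cvgM (@continuous_dot _ _ xi x) (@cg x)).
have L2 a : Lint (fun x => g x * pole e a x * rho e x).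
  by apply: Lrho => //; [exact: cpole|apply: slowM => //; exact: slow_pole].
have -> : Int (fun x => g x * drho e (- xi) x) =
   2 * s * Int (fun x => dot xi x * g x * rho e x) -
   \sum_(a <- Pos) 2 * k a * dot a xi * Int (fun x => g x * pole e a x * rho e x).
  rewrite -IntZ//.
  have -> : \sum_(a <- Pos) 2 * k a * dot a xi * Int (fun x => g x * pole e a x * rho e x) =
    \sum_(a <- Pos) Int (fun x => 2 * k a * dot a xi * (g x * pole e a x * rho e x)).
    by apply: eq_bigr => a _; rewrite IntZ.
  have L3 a : Lint (fun x => 2 * k a * dot a xi * (g x * pole e a x * rho e x)) by exact: LintZ.
  rewrite -Int_sum// -IntB; [|exact: LintZ|exact: Lint_sum].
  apply: eq_Int => x; rewrite drhoE mulrBr; congr (_ - _); first by ring.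
  by rewrite mulr_sumr; apply: eq_bigr => a _; ring.
rewrite -addrA addrC -[RHS]add0r; congr (_ + _).
rewrite -sumrN -big_split/= big_seq big1// => a aP.
by rewrite Int_pole_refl//; move: (Int _) => z; ring.
Qed.

Let u (m : nat) : R := m.+1%:R^-1.
Let u0 m : 0 < u m. Proof. by rewrite invr_gt0. Qed.
Let cu : u m @[m --> \oo] --> 0. Proof. exact: cvg_harmonic. Qed.
Let u1 m : 0 <= u m <= 1. Proof. by rewrite ltW//= invf_le1// ler1n. Qed.

Let rho_cvg x : rho (u m) x @[m --> \oo] --> rho 0 x.
Proof.
have h : om (u m) x @[m --> \oo] --> om 0 x by apply: (om_cvg posP kP) => // m; exact: ltW.
have h' : gauss s x @[m --> \oo] --> gauss s x by exact: cvg_cst.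
exact: (cvgM h h').
Qed.

Let rho_le m x : rho (u m) x <= rho 1 x.
Proof. by rewrite ler_wpM2r ?gauss_ge0// (om_le posP kP)// u1. Qed.

Lemma Int_rho_cvg f : mrow f -> slow f ->
  Lint (fun x => f x * rho 0 x) /\
  Int (fun x => f x * rho (u m) x) @[m --> \oo] --> Int (fun x => f x * rho 0 x).
Proof.
move=> mf sf; apply: (@dct_Int _ _ _ _ (fun x => `|f x * rho 1 x|)).
- by move=> m; apply: measurable_funM => //; apply: mrow_continuous; exact: crho (ltW (u0 m)).
- move=> x; have h : f x @[m --> \oo] --> f x by exact: cvg_cst.
  exact: (cvgM h (rho_cvg (x := x))).
- move=> m x; rewrite normrM [leRHS]normrM ler_wpM2l//.
  by rewrite !ger0_norm ?(rho_ge0 Pos k)// rho_le.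
- have := Lint_rho_mul posP kP s0 ler01 mf sf; exact: integrable_norm.
Qed.

Lemma Int_pole_cvg a : a \in Pos ->
  Lint (fun x => k a * (dquot a g x * rho 0 x)) /\
  k a * Int (fun x => (g x - g (refl a x)) * pole (u m) a x * rho (u m) x) @[m --> \oo] -->
  Int (fun x => k a * (dquot a g x * rho 0 x)).
Proof.
move=> aP; have a2 : dot a a = 2 := normP (Pos_sub posP aP).
have [->|ka] := eqVneq (k a) 0.
  have -> : (fun x => 0 * (dquot a g x * rho 0 x)) = (fun=> 0) by apply/funext => x; rewrite mul0r.
  split; first exact: Lint0.
  by under eq_fun do rewrite mul0r; rewrite Int0; exact: cvg_cst.
have cdiff : continuous (fun x => g x - g (refl a x)).
  by move=> x; exact: (cvgB (@cg x) (@cgr a a2 x)).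
have sdiff : slow (fun x => g x - g (refl a x)) by apply: slowD => //; exact: slowN.
have Lm m : Lint (fun x => (g x - g (refl a x)) * pole (u m) a x * rho (u m) x).
  apply: Lrho; [exact: ltW|exact: (cpole (u0 m) cdiff)|apply: slowM => //; exact: slow_pole].
have [Lg Cg] : Lint (fun x => dquot a g x * rho 0 x) /\
  Int (fun x => (g x - g (refl a x)) * pole (u m) a x * rho (u m) x) @[m --> \oo] -->
  Int (fun x => dquot a g x * rho 0 x).
  apply: (@dct_Int _ _ _ _ (fun x => L * enorm a * rho 1 x)).
  - by move=> m; exact: Lint_mrow.
  - move=> x; rewrite /dquot; case: ifPn => [/eqP ax|ax].
      have -> : rho 0 x = 0.
        rewrite /rho /om (big_rem a aP)/= ax expr0n/= addr0 powR0// mul0r mul0r.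
        by [].
      rewrite mulr0; have -> : (fun m => (g x - g (refl a x)) * pole (u m) a x * rho (u m) x) = (fun=> 0).
        by apply/funext => m; rewrite /pole ax mul0r mulr0 mul0r.
      exact: cvg_cst.
    have h : g x - g (refl a x) @[m --> \oo] --> g x - g (refl a x) by exact: cvg_cst.
    have h2 : dot a x @[m --> \oo] --> dot a x by exact: cvg_cst.
    have h3 : (dot a x ^+ 2 : R) @[m --> \oo] --> dot a x ^+ 2 by exact: cvg_cst.
    have n0 : dot a x ^+ 2 + 0 != 0 by rewrite addr0 expf_neq0.
    have -> : (g x - g (refl a x)) / dot a x * rho 0 x =
      (g x - g (refl a x)) * (dot a x * (dot a x ^+ 2 + 0)^-1) * rho 0 x.
      by congr (_ * _); rewrite addr0; field.
    have h4 : dot a x ^+ 2 + u m @[m --> \oo] --> dot a x ^+ 2 + 0 by exact: (cvgD h3 cu).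
    have h5 : (dot a x ^+ 2 + u m)^-1 @[m --> \oo] --> (dot a x ^+ 2 + 0)^-1.
      by exact: (cvgV n0 h4).
    exact: (cvgM (cvgM h (cvgM h2 h5)) (rho_cvg (x := x))).
  - move=> m x; rewrite normrM [X in _ * X]ger0_norm ?(rho_ge0 Pos k)//.
    apply: ler_pM => //; first exact: (rho_ge0 Pos k).
    have h : 0 < dot a x ^+ 2 + u m by rewrite ltr_wpDl ?sqr_ge0.
    have [_ gL _] := tg; have := gL x (refl a x).
    have -> : x - refl a x = dot a x *: a by rewrite reflE// opprB addrC subrK.
    rewrite enormZ => H.
    rewrite /pole normrM normrM normfV (gtr0_norm h) mulrA ler_pdivrMr//.
    rewrite (le_trans (ler_wpM2r (normr_ge0 (dot a x)) H))//.
    have -> : L * (`|dot a x| * enorm a) * `|dot a x| = L * enorm a * `|dot a x| ^+ 2 by ring.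
    by rewrite real_normK ?num_real// ler_wpM2l ?mulr_ge0 ?enorm_ge0// lerDl ltW.
  - by apply: LintZ; exact: (Lint_rho posP kP s0 ler01).
split; first exact: LintZ.
by rewrite IntZ//; apply: cvgM Cg; exact: cvg_cst.
Qed.

(** The regularized identity in the limit e = 1/(m+1) -> 0. It expresses that Dunkl operators are
    antisymmetric for the weight [om 0], tested on [g] and a Gaussian, whose Dunkl derivative in the
    direction xi is -2 s (xi,x) times itself. *)
Lemma int_dunkl xi :
  Lint (fun x => ('D_xi (g : _ -> R^o) x + \sum_(a <- Pos) k a * dot a xi * dquot a g x) * rho 0 x) /\
  Int (fun x => ('D_xi (g : _ -> R^o) x + \sum_(a <- Pos) k a * dot a xi * dquot a g x) * rho 0 x) =
  2 * s * Int (fun x => dot xi x * g x * rho 0 x).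
Proof.
have [L1 C1] := @Int_rho_cvg (fun x => 'D_xi (g : _ -> R^o) x) (mrow_derive L0 tg xi)
  (slow_le (slow_cst (L * enorm xi)) (fun x => tame_derive x xi tg)).
have cxg : continuous (fun x => dot xi x * g x).
  by move=> x; exact: (cvgM (@continuous_dot _ _ xi x) (@cg x)).
have [_ C2] := Int_rho_cvg (mrow_continuous cxg) (slowM (slow_dot xi) sg).
have LS a : a \in Pos -> Lint (fun x => dot a xi * (k a * (dquot a g x * rho 0 x))).
  by move=> /Int_pole_cvg[? _]; exact: LintZ.
have E : (fun x => ('D_xi (g : _ -> R^o) x + \sum_(a <- Pos) k a * dot a xi * dquot a g x) * rho 0 x) =
  (fun x => 'D_xi (g : _ -> R^o) x * rho 0 x + \sum_(a <- Pos) dot a xi * (k a * (dquot a g x * rho 0 x))).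
  apply/funext => x; rewrite mulrDl mulr_suml; congr (_ + _); apply: eq_bigr => a _.
  by ring.
rewrite E; split; first by apply: LintD => //; exact: Lint_sum.
rewrite IntD//; last exact: Lint_sum.
rewrite Int_sum//.
have CS : \sum_(a <- Pos) k a * dot a xi * Int (fun x => (g x - g (refl a x)) * pole (u m) a x * rho (u m) x)
    @[m --> \oo] --> \sum_(a <- Pos) Int (fun x => dot a xi * (k a * (dquot a g x * rho 0 x))).
  rewrite big_seq; under eq_fun do rewrite big_seq.
  apply: cvg_big => [p|a aP]; first by apply: cvgD; [exact: cvg_fst|exact: cvg_snd].
  have [La Ca] := Int_pole_cvg aP.
  rewrite IntZ//; under eq_fun do rewrite [k a * _]mulrC -mulrA.
  by apply: cvgM Ca; exact: cvg_cst.
have h : (2 * s : R) @[m --> \oo] --> 2 * s by exact: cvg_cst.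
pose B m := Int (fun x => 'D_xi (g : _ -> R^o) x * rho (u m) x) +
  \sum_(a <- Pos) k a * dot a xi * Int (fun x => (g x - g (refl a x)) * pole (u m) a x * rho (u m) x).
have c1 : B m @[m --> \oo] --> Int (fun x => 'D_xi (g : _ -> R^o) x * rho 0 x) +
    \sum_(a <- Pos) Int (fun x => dot a xi * (k a * (dquot a g x * rho 0 x))).
  exact: (cvgD C1 CS).
have c2 : B m @[m --> \oo] --> 2 * s * Int (fun x => dot xi x * g x * rho 0 x).
  have -> : B = (fun m => 2 * s * Int (fun x => dot xi x * g x * rho (u m) x)).
    by apply/funext => m; exact: int_dunkl_regularized.
  exact: (cvgM h C2).
by rewrite -(cvg_lim _ c1)// (cvg_lim _ c2).
Qed.

End dunkl_integration_by_parts.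

(** * The Dunkl transform of the Gaussian *)

Section kernel_gauss.
Context {R : realType} {d : nat}.
Local Notation C := R[i].
Variables (Phi Pos : {fset 'rV[R]_d}) (k : 'rV[R]_d -> R) (K : 'rV[C]_d -> 'rV[C]_d -> C).
Hypotheses (rootP : root_system Phi) (normP : normalized Phi).
Hypotheses (posP : positive_subsystem Phi Pos) (kP : multiplicity_function Phi k).
Hypothesis (dK : dunkl_kernel Pos k K).
Implicit Types (x y a xi : 'rV[R]_d).

Lemma derive_dirZ (g : 'rV[R]_d -> R) (r : R) (v z : 'rV[R]_d) :
  derivable (g : _ -> R^o) z v -> 'D_(r *: v) (g : _ -> R^o) z = r * 'D_v (g : _ -> R^o) z.
Proof.
move=> dg; have h0 : is_derive (0 *: v + z) v (g : _ -> R^o) ('D_v (g : _ -> R^o) z).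
  by rewrite scale0r add0r; exact: DeriveDef dg erefl.
have h1 := is_derive_line h0.
have h2 : is_derive (0 : R) 1 (fun h : R => h * r) r.
  apply: (is_derive_eq (is_deriveM (is_derive_id _ _) (is_derive_cst r _ _))).
  by rewrite !scaleRE; rewrite mulr0 add0r mulr1.
have h3 : is_derive (0 * r : R) 1 (fun h : R => g (h *: v + z)) ('D_v (g : _ -> R^o) z).
  by rewrite mul0r.
have h4 := @is_derive1_comp R (fun h : R => g (h *: v + z)) (fun h : R => h * r) 0 _ _ h3 h2.
rewrite mulrC -(@derive_val _ _ _ _ _ _ _ h4) /derive.
set F := (X in lim (fmap X _)); set G := (X in _ = lim (fmap X _)).
suff -> : F = G by [].
apply/funext => h; rewrite /F /G /comp /shift /= addr0 mul0r scale0r add0r.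
by rewrite scalerA (_ : h *: (1 : R^o) = h)// /GRing.scale/= mulr1.
Qed.

Variable s : R.
Hypothesis s0 : 0 < s.
Local Notation rho := (rho Pos k s 0).

Let crho : continuous rho.
Proof. exact: (continuous_rho posP kP). Qed.

Let Lrho f : continuous f -> slow f -> Lint (fun x => f x * rho x).
Proof. by move=> cf sf; apply: (Lint_rho_mul posP kP s0) => //; exact: mrow_continuous. Qed.

Lemma Int_rho_refl f a : a \in Phi -> continuous f -> slow f ->
  Lint (fun x => f (refl a x) * rho x) /\
  Int (fun x => f (refl a x) * rho x) = Int (fun x => f x * rho x).
Proof.
move=> aP cf sf; have cfr : continuous (fun x => f x * rho x).
  by move=> x; exact: (cvgM (@cf x) (@crho x)).
have := Int_scales_volume (scales_volume_refl (normP aP)) cfr (Lrho cf sf).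
have -> : (fun x => f (refl a x) * rho (refl a x)) = (fun x => f (refl a x) * rho x).
  by apply/funext => x; rewrite (rho_refl rootP normP posP kP).
by rewrite mul1r.
Qed.

(** Each reflection preserves [rho] and Lebesgue measure, so every difference in the defect
    integrates to zero. *)
Lemma Int_refl_defect f : continuous f -> slow f ->
  Lint (fun x => refl_defect Pos k f x * rho x) /\
  Int (fun x => refl_defect Pos k f x * rho x) = 0.
Proof.
move=> cf sf.
have E : (fun x => refl_defect Pos k f x * rho x) =
    (fun x => \sum_(a <- Pos) k a * (f x * rho x - f (refl a x) * rho x)).
  apply/funext => x; rewrite /refl_defect mulr_suml; apply: eq_bigr => a _.
  by rewrite -mulrA mulrBl.
have H a : a \in Pos -> Lint (fun x => k a * (f x * rho x - f (refl a x) * rho x)) /\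
    Int (fun x => k a * (f x * rho x - f (refl a x) * rho x)) = 0.
  move=> /(Pos_sub posP) aP; have [L1 I1] := Int_rho_refl aP cf sf.
  have L2 := Lrho cf sf; split; first by apply: LintZ; exact: LintB.
  by rewrite IntZ ?IntB ?I1 ?subrr ?mulr0//; exact: LintB.
rewrite E; split; first by apply: Lint_sum => a /H[].
by rewrite Int_sum => [|a /H[]//]; rewrite big_seq big1// => a /H[].
Qed.

Section scaled_tame.
Variables (L : R) (g : 'rV[R]_d -> R).
Hypotheses (L0 : 0 <= L) (tg : tame L g).

Let cg : continuous g. Proof. exact: tame_continuous tg. Qed.

Lemma continuous_scaled (r : R) : continuous (fun x => g (r *: x)).
Proof.
move=> x; apply: continuous_comp; last exact: cg.
have h : (fun _ : 'rV[R]_d => r) @ x --> r by exact: cst_continuous.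
have h' : (fun y : 'rV[R]_d => y) @ x --> x by exact: cvg_id.
exact: (cvgZ h h').
Qed.

Lemma slow_scaled (r : R) : slow (fun x => g (r *: x)).
Proof. by apply: (slow_le (slow_cst 1)) => x; case: tg. Qed.

Let dg x v : is_derive x v (g : _ -> R^o) ('D_v (g : _ -> R^o) x).
Proof. by have [_ _ h] := tg; exact: DeriveDef (h _ _) erefl. Qed.

Lemma slow_enorm : slow (fun x => enorm x).
Proof.
apply: (slow_le slow_sqr_norm) => x; rewrite ger0_norm ?enorm_ge0//.
rewrite -sqr_enorm; have := sqr_ge0 (enorm x - 1); move: (enorm x) (enorm_ge0 x) => z; nra.
Qed.

Lemma is_derive_Int_scaled (r : R) :
  is_derive r 1 (fun u => Int (fun x => g (u *: x) * rho x))
    (Int (fun x => 'D_x (g : _ -> R^o) (r *: x) * rho x)).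
Proof.
have rr : r - 1 < r < r + 1 by rewrite ltrBlDr !ltrDl ltr01.
apply: (@is_derive_Int _ _ (fun u x => g (u *: x) * rho x)
  (fun u x => 'D_x (g : _ -> R^o) (u *: x) * rho x) (fun x => L * enorm x * rho x) _ _ _ rr).
- by move=> u _; apply: Lrho; [exact: continuous_scaled|exact: slow_scaled].
- move=> u x _; have h := is_derive_ray (dg (u *: x) x).
  apply: (is_derive_eq (is_deriveM h (is_derive_cst (rho x) _ _))).
  by rewrite !scaleRE; rewrite mulr0 add0r mulrC.
- move=> u x _; rewrite normrM [X in _ * X]ger0_norm ?(rho_ge0 Pos k)//.
  by rewrite ler_wpM2r ?(rho_ge0 Pos k)//; exact: tame_derive.
- apply: Lrho; last by apply: slowM; [exact: slow_cst|exact: slow_enorm].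
  move=> x; have h : (fun _ : 'rV[R]_d => L) @ x --> L by exact: cst_continuous.
  exact: (cvgM h (@continuous_enorm _ _ x)).
Qed.

(** The Euler identity at r x is divided by r, since the derivative in the direction r x is r times
    that in the direction x; then the defect disappears under the integral. *)
Lemma Int_euler (r : R) (h : 'rV[R]_d -> R) : 0 < r ->
  continuous h -> slow h ->
  (forall x, 'D_(r *: x) (g : _ -> R^o) (r *: x) = - refl_defect Pos k g (r *: x) + r * h x) ->
  Int (fun x => 'D_x (g : _ -> R^o) (r *: x) * rho x) = Int (fun x => h x * rho x).
Proof.
move=> r0 ch sh E; have [L1 I1] := Int_refl_defect (@continuous_scaled r) (slow_scaled r).
have L2 := Lrho ch sh.
transitivity (Int (fun x => - r^-1 * (refl_defect Pos k (fun x => g (r *: x)) x * rho x) + h x * rho x)).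
  apply: eq_Int => x; rewrite [- r^-1 * _]mulrA -[RHS]mulrDl; congr (_ * _).
  have := E x; rewrite derive_dirZ; last by have [] := dg (r *: x) x.
  have -> : refl_defect Pos k g (r *: x) = refl_defect Pos k (fun x => g (r *: x)) x.
    by apply: eq_bigr => a _; rewrite /refl_defect reflZ.
  move/(canRL (mulKf (lt0r_neq0 r0))) => ->.
  by rewrite mulrDr mulrN mulNr mulKf// lt0r_neq0.
rewrite IntD//; last exact: LintZ.
by rewrite IntZ// I1 mulr0 add0r.
Qed.

(** Dunkl operators are homogeneous of degree -1, so applied to g(r x) they give r times their value
    on [g] at r x; the rest is [int_dunkl]. The restriction r <= 1 keeps the Lipschitz constant of
    the scaled function below [L]. *)
Lemma Int_dunkl_scaled (r : R) xi (h : 'rV[R]_d -> R) : 0 < r <= 1 ->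
  (forall x, 'D_xi (g : _ -> R^o) x + \sum_(a <- Pos) k a * dot a xi * dquot a g x = h x) ->
  continuous h -> slow (fun x => h (r *: x)) ->
  r * Int (fun x => h (r *: x) * rho x) = 2 * s * Int (fun x => dot xi x * g (r *: x) * rho x).
Proof.
move=> /andP[r0 r1] E ch sh; have r01 : 0 <= r <= 1 by rewrite ltW.
have [_ <-] := int_dunkl rootP normP posP kP s0 L0 (tame_scale L0 r01 tg) xi.
have chr : continuous (fun x => h (r *: x)).
  move=> x; apply: continuous_comp; last exact: ch.
  have h1 : (fun _ : 'rV[R]_d => r) @ x --> r by exact: cst_continuous.
  have h' : (fun y : 'rV[R]_d => y) @ x --> x by exact: cvg_id.
  exact: (cvgZ h1 h').
rewrite -IntZ; last exact: Lrho.
apply: eq_Int => x; rewrite mulrA; congr (_ * _); rewrite -E mulrDr mulr_sumr.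
have dz v : 'D_v ((fun x => g (r *: x)) : _ -> R^o) x = r * 'D_v (g : _ -> R^o) (r *: x).
  by rewrite derive_scale derive_dirZ//; have [] := dg (r *: x) v.
rewrite dz; congr (_ + _); apply: eq_bigr => a _; rewrite mulrCA; congr (_ * _).
rewrite /dquot dotZr mulf_eq0 gt_eqF//=; case: ifPn => [_|ax]; first by rewrite dz.
by rewrite reflZ; field; rewrite ax lt0r_neq0.
Qed.

End scaled_tame.

(** J(r) exp(b r^2) has derivative zero inside ]0,1[. The equation is asked only there, because
    [Int_euler] divides by r; continuity reaches the end points. *)
Lemma gauss_ode (J : R -> R) (b : R) : (forall r : R, derivable (J : R -> R^o) r 1) ->
  (forall r : R, 0 < r < 1 -> is_derive r 1 (J : R -> R^o) (- (2 * b * r) * J r)) ->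
  J 1 = J 0 * expR (- b).
Proof.
move=> dJ HJ; pose f (r : R) := J r * expR (b * r * r).
have he (r : R) : is_derive r 1 (fun r : R => expR (b * r * r)) (expR (b * r * r) * (2 * b * r)).
  have h : is_derive r 1 (fun r : R => b * r * r) (2 * b * r).
    have -> : 2 * b * r = b * r * 1 + r * (b * 1 + r * 0) by ring.
    exact: is_deriveM.
  exact: (@is_derive1_comp R expR (fun r : R => b * r * r) r _ _ (is_derive_expR _) h).
have hf (r : R) : r \in `]0, 1[ -> is_derive r 1 (f : R -> R^o) 0.
  rewrite in_itv/= => r01; apply: (is_derive_eq (is_deriveM (HJ _ r01) (he r))).
  by rewrite !scaleRE; ring.
have cf : {within `[0, 1], continuous f}.
  apply: derivable_within_continuous => r _.
  by apply: derivableM; [exact: dJ|have [] := he r].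
have [c _] := MVT ltr01 hf cf.
rewrite mul0r => /eqP; rewrite subr_eq0 /f !mulr1 !mulr0 expR0 mulr1 => /eqP <-.
by rewrite -mulrA -expRD subrr expR0 mulr1.
Qed.

Variable y : 'rV[R]_d.

(* [u] and [v] are, up to order, the real and imaginary part of the kernel at
   [i y]; [e] is [1] or [-1] accordingly. *)
Lemma Int_conj_pair_gauss (L e : R) (u v : 'rV[R]_d -> R) :
  0 <= L -> tame L u -> tame L v -> e * e = 1 ->
  (forall x, 'D_x (u : _ -> R^o) x = - refl_defect Pos k u x - e * dot x y * v x) ->
  (forall x, 'D_y (v : _ -> R^o) x + \sum_(a <- Pos) k a * dot a y * dquot a v x =
     e * dot y y * u x) ->
  Int (fun x => u x * rho x) = u 0 * expR (- (dot y y / (4 * s))) * Int rho.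
Proof.
move=> L0 tu tv ee Eu Ev; pose b := dot y y / (4 * s).
have sn0 : s != 0 by rewrite gt_eqF.
have cv r := continuous_scaled L0 tv (r := r); have sv r := slow_scaled tv r.
have cu r := continuous_scaled L0 tu (r := r); have su r := slow_scaled tu r.
have Lu r : Lint (fun x => u (r *: x) * rho x) by exact: Lrho (cu r) (su r).
have cyv r : continuous (fun x => dot y x * v (r *: x)).
  by move=> x; exact: (cvgM (@continuous_dot _ _ y x) (@cv r x)).
have syv r : slow (fun x => dot y x * v (r *: x)) by apply: slowM => //; exact: slow_dot.
(* The radial equation turns the derivative into -e times the integral of (y,x) v(r x). Integration
   by parts in the direction [y] turns that back into the integral of u(r x), with total factor -r
   |y|^2/(2s) = -2 b r. *)
have HJ (r : R) : 0 < r < 1 -> is_derive r 1 (fun r : R => Int (fun x => u (r *: x) * rho x) : R^o)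
    (- (2 * b * r) * Int (fun x => u (r *: x) * rho x)).
  move=> /andP[r0 r1]; apply: (is_derive_eq (is_derive_Int_scaled L0 tu r)).
  have ch : continuous (fun x => - e * (dot y x * v (r *: x))).
    move=> x; have h : (fun _ : 'rV[R]_d => - e) @ x --> - e by exact: cst_continuous.
    exact: (cvgM h (@cyv r x)).
  rewrite (@Int_euler _ _ L0 tu r (fun x => - e * (dot y x * v (r *: x))))//.
  - have r01 : 0 < r <= 1 by rewrite r0 ltW.
    have cyu : continuous (fun x => e * dot y y * u x).
      move=> x; have h : (fun _ : 'rV[R]_d => e * dot y y) @ x --> e * dot y y by exact: cst_continuous.
      exact: (cvgM h (tame_continuous L0 tu (x := x))).
    have syu : slow (fun x => e * dot y y * u (r *: x)) by apply: slowM => //; exact: slow_cst.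
    have := Int_dunkl_scaled L0 tv r01 Ev cyu syu.
    have -> : (fun x => e * dot y y * u (r *: x) * rho x) = (fun x => e * dot y y * (u (r *: x) * rho x)).
      by apply/funext => x; rewrite -[LHS]mulrA.
    rewrite IntZ//.
    have -> : (fun x => - e * (dot y x * v (r *: x)) * rho x) = (fun x => - e * (dot y x * v (r *: x) * rho x)).
      by apply/funext => x; rewrite -[LHS]mulrA.
    rewrite IntZ; last exact: Lrho (cyv r) (syv r).
    rewrite /b; move: (Int _) (Int _) => B A H.
    have -> : B = r * (e * dot y y * A) / (2 * s) by rewrite H; field.
    have -> : - e * (r * (e * dot y y * A) / (2 * s)) = - (e * e) * (r * dot y y * A / (2 * s)) by ring.
    by rewrite ee; field.
  - by apply: slowM => //; exact: slow_cst.
  - by move=> x; rewrite Eu dotZl (dotC x y); ring.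
have dJ (r : R) : derivable (fun r : R => Int (fun x => u (r *: x) * rho x) : R^o) r 1.
  by have [] := is_derive_Int_scaled L0 tu r.
have := gauss_ode dJ HJ.
have -> : (fun x => u (1 *: x) * rho x) = (fun x => u x * rho x) by apply/funext => x; rewrite scale1r.
move=> ->; rewrite mulrAC; congr (_ * _).
rewrite -IntZ; first by apply: eq_Int => x; rewrite scale0r.
exact: (Lint_rho posP kP s0).
Qed.

Lemma Int_ker_gauss :
  Int (fun x => kerRe K y x * rho x) = expR (- (dot y y / (4 * s))) * Int rho /\
  Int (fun x => kerIm K y x * rho x) = 0.
Proof.
have [tU tV] := ker_tame normP posP kP dK y; have L0 := enorm_ge0 y.
have [U0 V0] := ker0 dK y; split.
- rewrite (@Int_conj_pair_gauss (enorm y) 1 _ _ L0 tU tV) ?mul1r ?U0 ?mul1r// => x.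
    have [h _] := ker_euler dK y x; rewrite (@derive_val _ _ _ _ _ _ _ h); ring.
  by rewrite (ker_dunkl dK y x y).2.
- rewrite (@Int_conj_pair_gauss (enorm y) (-1) _ _ L0 tV tU) ?mulrNN ?V0 ?mul0r ?mul1r// => x.
    have [_ h] := ker_euler dK y x; rewrite (@derive_val _ _ _ _ _ _ _ h); ring.
  by rewrite (ker_dunkl dK y x y).1; ring.
Qed.

End kernel_gauss.

(** * Homogeneity of the weight and integrability *)

Section dilation.
Context {R : realType} {d : nat}.
Variables (Phi Pos : {fset 'rV[R]_d}) (k : 'rV[R]_d -> R).
Hypotheses (posP : positive_subsystem Phi Pos) (kP : multiplicity_function Phi k).
Implicit Types (x y a : 'rV[R]_d).
Local Notation om := (om Pos k).
Local Notation rho0 s := (rho Pos k s 0).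
Local Notation homdim := (2 * dunkl_gamma Pos k + d%:R).

Lemma om_scale (r : R) x : 0 < r -> om 0 (r *: x) = r `^ (2 * dunkl_gamma Pos k) * om 0 x.
Proof.
move=> r0; rewrite /om /dunkl_gamma; elim: (enum_fset Pos) => [|a l IH].
  by rewrite !big_nil mulr0 powRr0 mulr1.
rewrite !big_cons IH mulrDr powRD; last by rewrite (gt_eqF r0) implybT.
have -> : (dot a (r *: x) ^+ 2 + 0) `^ k a = r `^ (2 * k a) * (dot a x ^+ 2 + 0) `^ k a.
  rewrite !addr0 dotZr exprMn powRM ?sqr_ge0//; congr (_ * _).
  by rewrite powRrM powR_mulrn// ltW.
by rewrite mulrACA.
Qed.

Lemma Int_rho_dilate (f : 'rV[R]_d -> R) (r : R) : 0 < r -> continuous f -> slow f ->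
  Int (fun x => f x * rho0 (r ^- 2) x) = r `^ homdim * Int (fun x => f (r *: x) * rho0 1 x).
Proof.
move=> r0 cf sf; have s0 : 0 < r ^- 2 by rewrite invr_gt0 exprn_gt0.
have rn : r != 0 by rewrite gt_eqF.
have cG : continuous (fun x => f x * rho0 (r ^- 2) x).
  by move=> x; exact: (cvgM (@cf x) (continuous_rho posP kP (lexx 0) (x := x))).
have LG : Lint (fun x => f x * rho0 (r ^- 2) x).
  exact: (Lint_rho_mul posP kP s0 (lexx 0) (mrow_continuous cf) sf).
have [L1 E] := Int_scales_volume (scales_volume_scale r0) cG LG.
have H x : f (r *: x) * rho0 (r ^- 2) (r *: x) = r `^ (2 * dunkl_gamma Pos k) * (f (r *: x) * rho0 1 x).
  rewrite /rho om_scale// /gauss dotZl dotZr.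
  have -> : - r ^- 2 * (r * (r * dot x x)) = - 1 * dot x x by field.
  by rewrite -[X in f _ * X]mulrA [LHS]mulrCA.
have L2 : Lint (fun x => f (r *: x) * rho0 1 x).
  have p0 : r `^ (2 * dunkl_gamma Pos k) != 0 by rewrite gt_eqF// powR_gt0.
  have := LintZ (r `^ (2 * dunkl_gamma Pos k))^-1 L1.
  by under [X in Lint X -> _]eq_fun do rewrite H mulKf//.
move: E; rewrite (eq_Int H) (IntZ _ L2) => E.
rewrite powRD; last by rewrite rn implybT.
have rd : r ^+ d != 0 by rewrite expf_neq0.
by rewrite (powR_mulrn _ (ltW r0)) mulrAC E mulrAC (mulVf rd) mul1r.
Qed.

Lemma Int_rho_mass (r : R) : 0 < r -> Int (rho0 (r ^- 2)) = r `^ homdim * Int (rho0 1).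
Proof.
move=> r0; have c1 : continuous (fun _ : 'rV[R]_d => 1 : R) by move=> x; exact: cst_continuous.
have := Int_rho_dilate r0 c1 (slow_cst 1).
by under eq_Int do rewrite mul1r; move=> ->; under eq_Int do rewrite mul1r.
Qed.

(** Take the least m with 1 + |x|^2 <= 4^(m+1). Minimality gives 4^m <= 1 + |x|^2, hence the decay
    4^(-p m), while the Gaussian of width 2^(m+1) is still at least 1/e at x; the factor [expR 1]
    compensates. *)
Lemma inv_weight_le_series (p : nat) x :
  exists m : nat, (1 + dot x x)^-1 ^+ p <= expR 1 * ((4^-1) ^+ p) ^+ m * gauss ((2 ^+ m.+1) ^- 2) x.
Proof.
have x0 := dot_ge0 x; pose P m := (1 + dot x x <= 4 ^+ m.+1).
have [m Pm] : exists m, P m.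
  have := archi_boundP (addr_ge0 ler01 x0); set N := Num.bound _ => HN.
  exists N; rewrite /P (le_trans (ltW HN))// -natrX ler_nat.
  by rewrite (leq_trans _ (ltnW (ltn_expl N.+1 _)))//.
have [m0 Pm0 Hm] := ex_minnP (ex_intro P m Pm).
exists m0; have q0 : 0 < 1 + dot x x by rewrite ltr_pwDl.
have h1 : 4 ^+ m0 <= 1 + dot x x.
  case: m0 Pm0 Hm => [|m0] _ Hm; first by rewrite expr0 lerDl.
  by rewrite leNgt; apply/negP => /ltW /Hm; rewrite ltnn.
have h2 : (1 + dot x x)^-1 ^+ p <= (4^-1 ^+ p) ^+ m0.
  rewrite exprAC; apply: lerXn2r; rewrite ?nnegrE ?exprn_ge0 ?invr_ge0// ?(ltW q0)//.
  by rewrite exprVn lef_pV2 ?posrE ?exprn_gt0.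
rewrite (le_trans h2)// mulrAC ler_peMl ?exprn_ge0 ?invr_ge0//.
rewrite /gauss -expRD -[leLHS]expR0 ler_expR mulNr subr_ge0 mulrC ler_pdivrMr ?exprn_gt0//.
rewrite mul1r -exprM mulnC exprM (_ : 2 ^+ 2 = 4 :> R) ?(le_trans _ Pm0) ?lerDr//.
by rewrite -natrX.
Qed.

(** The integrand is dominated by a series of dilated Gaussians, and homogeneity of the weight makes
    the m-th integral at most A (2^homdim 4^(-p))^m. The hypothesis says homdim <= 2 p - 2, so the
    ratio is at most 1/4. *)
Lemma Lint_inv_weight (p : nat) : homdim / 2 + 1 <= p%:R ->
  Lint (fun x => (1 + dot x x)^-1 ^+ p * om 0 x).
Proof.
move=> Hp.
have c0 : continuous (fun x : 'rV[R]_d => (1 + dot x x)^-1 ^+ p).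
  move=> x; have h : (fun _ : 'rV[R]_d => 1 : R) @ x --> (1 : R) by exact: cst_continuous.
  have h2 : (fun y => 1 + dot y y) @ x --> 1 + dot x x by exact: (cvgD h (@continuous_sqr_norm _ _ x)).
  have n0 : 1 + dot x x != 0 by rewrite gt_eqF// ltr_pwDl ?dot_ge0.
  have h3 : (fun y => (1 + dot y y)^-1) @ x --> (1 + dot x x)^-1 by exact: (cvgV n0 h2).
  exact: (continuous_comp h3 (@exprn_continuous _ p _)).
have mw : mrow (fun x => (1 + dot x x)^-1 ^+ p * om 0 x).
  by apply: mrow_continuous => x; exact: (cvgM (@c0 x) (continuous_om posP kP (lexx 0) (x := x))).
have w0 x : 0 <= (1 + dot x x)^-1 ^+ p * om 0 x.
  by rewrite mulr_ge0 ?om_ge0// exprn_ge0// invr_ge0 addr_ge0 ?dot_ge0.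
pose f (m : nat) x := expR 1 * ((4^-1) ^+ p) ^+ m * rho0 ((2 ^+ m.+1) ^- 2) x.
have f0 m x : 0 <= f m x.
  by rewrite mulr_ge0 ?rho_ge0// mulr_ge0 ?expR_ge0 ?exprn_ge0 ?invr_ge0.
have s0 m : 0 < (2 ^+ m.+1) ^- 2 :> R by rewrite invr_gt0 exprn_gt0 ?exprn_gt0.
have Lf m : Lint (f m) by apply: LintZ; exact: (Lint_rho posP kP (s0 m)).
pose A := expR 1 * 2 `^ homdim * Int (rho0 1).
have A0 : 0 <= A by rewrite !mulr_ge0 ?expR_ge0 ?powR_ge0// Int_ge0// => x; exact: rho_ge0.
have If m : Int (f m) <= A * 4^-1 ^+ m.
  rewrite /f IntZ; last exact: (Lint_rho posP kP (s0 m)).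
  have t0 : 0 < 2 ^+ m.+1 :> R by rewrite exprn_gt0.
  rewrite Int_rho_mass// /A.
  have q4 : 2 `^ homdim * 4^-1 ^+ p <= 4^-1 :> R.
    rewrite exprVn ler_pdivrMr ?exprn_gt0// -ler_pdivrMl ?invr_gt0// invrK.
    have e4 : 4 = 2 `^ 2 :> R by rewrite powR_mulrn// -natrX.
    rewrite [X in X * _]e4 -powRD; last by rewrite pnatr_eq0 implybT.
    rewrite -powR_mulrn// e4 -powRrM ler_powR ?ler1n//.
    by move: Hp; set h := homdim; lra.
  have pw (h : R) : (2 ^+ m.+1) `^ h = 2 `^ h * (2 `^ h) ^+ m.
    by rewrite -exprS -(powR_mulrn _ (ler0n R 2)) -(powR_mulrn _ (powR_ge0 2 h)) powRAC.
  rewrite pw.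
  have -> : expR 1 * 4^-1 ^+ p ^+ m * (2 `^ homdim * 2 `^ homdim ^+ m * Int (rho0 1)) =
     expR 1 * 2 `^ homdim * Int (rho0 1) * (2 `^ homdim * 4^-1 ^+ p) ^+ m.
    by rewrite [(2 `^ homdim * 4^-1 ^+ p) ^+ m]exprMn; move: (Int _) => z; ring.
  by rewrite ler_wpM2l// lerXn2r ?nnegrE ?mulr_ge0 ?powR_ge0 ?exprn_ge0 ?invr_ge0.
have geom N : \sum_(0 <= m < N) A * 4^-1 ^+ m <= 2 * A.
  rewrite -mulr_sumr mulrC ler_wpM2r//.
  suff : \sum_(0 <= m < N) 4^-1 ^+ m <= 2 - 2 * 4^-1 ^+ N :> R.
    by move=> /le_trans; apply; rewrite gerBl mulr_ge0 ?exprn_ge0 ?invr_ge0.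
  elim: N => [|N IH]; first by rewrite big_nil expr0 mulr1 subrr.
  rewrite big_nat_recr//= (le_trans (lerD IH (lexx _)))// exprS.
  have : 0 <= 4^-1 ^+ N :> R by rewrite exprn_ge0 ?invr_ge0.
  by move: (4^-1 ^+ N : R) => z; lra.
apply/integrableP; split; first exact/measurable_EFinP.
under eq_integral do rewrite gee0_abs ?lee_fin//.
have mf m : measurable_fun setT (fun t : d.-tuple (measurableTypeR R) => (f m (rowt t))%:E).
  by apply/measurable_EFinP; exact: Lint_mrow (Lf m).
have Ef m : (\int[lebesgue_tuple R d]_t (f m (rowt t))%:E)%E = (Int (f m))%:E.
  by rewrite /Int /Rintegral fineK//; exact: integrable_fin_num (Lf m).
apply: (@le_lt_trans _ _ (\int[lebesgue_tuple R d]_t (\sum_(m <oo) (f m (rowt t))%:E))%E).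
  apply: ge0_le_integral => //.
  - by move=> t _; rewrite lee_fin.
  - exact/measurable_EFinP.
  - by apply: ge0_emeasurable_sum => // m t _ _; rewrite lee_fin.
  - move=> t _; have [m Hm] := inv_weight_le_series p (rowt t).
    apply: (@le_trans _ _ (\sum_(0 <= i < m.+1) (f i (rowt t))%:E)%E); last first.
      by apply: nneseries_lim_ge => i _ _; rewrite lee_fin.
    rewrite big_nat_recr//= (@le_trans _ _ (f m (rowt t))%:E)//.
      rewrite lee_fin (le_trans (ler_wpM2r (om_ge0 _ _ _ _) Hm))// /f /rho.
      by rewrite -[leLHS]mulrA [X in _ * X]mulrC.
    by rewrite leeDr// sume_ge0// => i _; rewrite lee_fin.
rewrite integral_nneseries//; last by move=> m t _; rewrite lee_fin.
under eq_eseriesr do rewrite Ef.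
apply: (@le_lt_trans _ _ (2 * A)%:E); last exact: ltry.
apply: lime_le; first by apply: is_cvg_nneseries => m _ _; rewrite lee_fin Int_ge0.
apply: nearW => N; rewrite sumEFin lee_fin (le_trans _ (geom N))//.
by apply: ler_sum => m _; exact: If.
Qed.

Definition row_box n (b : 'rV[R]_n) (e : R) : set (n.-tuple (measurableTypeR R)) :=
  [set t | forall j, `|b 0 j - tnth t j| < e].

Lemma measurable_row_box n (b : 'rV[R]_n) (e : R) : measurable (row_box b e).
Proof.
have -> : row_box b e =
    \bigcap_(j in [set: 'I_n]) ((fun t => tnth t j) @^-1` `]b 0 j - e, b 0 j + e[%classic).
  apply/seteqP; split => t /= H j; [move=> _|]; have := H j; rewrite /= in_itv/= ltr_distlC//.
  exact.
apply: fin_bigcap_measurable => // j _; rewrite -[X in measurable X]setTI.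
by apply: measurable_tnth.
Qed.

Lemma row_box_gt0 n (b : 'rV[R]_n) (e : R) : 0 < e -> (0 < lebesgue_tuple R n (row_box b e))%E.
Proof.
move=> e0; elim: n b => [|n IH] b.
  by rewrite /= diracE mem_set ?lte01// => -[].
rewrite /= /lebesgue_cons /pushforward.
have -> : @cons_pair R n @^-1` (row_box b e) =
    `]b 0 ord0 - e, b 0 ord0 + e[ `*` row_box (\row_j b 0 (lift ord0 j)) e.
  apply/seteqP; split => -[a t] /=.
    move=> H; split; first by have := H ord0; rewrite /= in_itv/= ltr_distlC.
    by move=> j; have := H (lift ord0 j); rewrite tnthS mxE.
  rewrite in_itv/= -ltr_distlC => -[H1 H2] j; case: (unliftP ord0 j) => [i ->|->//].
  by have := H2 i; rewrite tnthS mxE.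
rewrite product_measure1E//; last exact: measurable_row_box.
apply: mule_gt0; last exact: IH.
rewrite [X in (_ < X)%E](lebesgue_measure_itv `]b 0 ord0 - e, b 0 ord0 + e[)/= lte_fin.
by rewrite ifT ?lte_fin; lra.
Qed.

(** The vector [b] defining the positive subsystem lies off all reflecting hyperplanes, so the
    integrand is positive there and exceeds half its value on a box of positive measure. *)
Lemma Int_rho_gt0 : 0 < Int (rho0 1).
Proof.
have [b [bN0 Hb]] := posP.
have r0 : 0 < rho0 1 b.
  rewrite /rho mulr_gt0 ?gauss_gt0// /om big_seq prodr_gt0// => a; rewrite Hb => /andP[aP ab].
  by rewrite powR_gt0// addr0 exprn_gt0.
have L1 := Lint_rho posP kP ltr01 (lexx 0).
have /cvgrPdist_lt/(_ _ (divr_gt0 r0 (ltr0Sn R 1))) : {for b, continuous (rho0 1)}.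
  exact: (continuous_rho posP kP).
move=> /nbhs_row_coord[e e0 He].
have mB := measurable_row_box b e; have muB := row_box_gt0 b e0.
have mrho : measurable_fun setT (fun t : d.-tuple (measurableTypeR R) => (rho0 1 (rowt t))%:E).
  by apply/measurable_EFinP; exact: Lint_mrow L1.
rewrite /Int /Rintegral fine_gt0//; apply/andP; split; last first.
  rewrite -ge0_fin_numE; first exact: integrable_fin_num L1.
  by apply: integral_ge0 => t _; rewrite lee_fin rho_ge0.
apply: (@lt_le_trans _ _ (\int[lebesgue_tuple R d]_(t in row_box b e) (rho0 1 b / 2)%:E)%E).
  by rewrite integral_cst// mule_gt0// lte_fin divr_gt0.
apply: (@le_trans _ _ (\int[lebesgue_tuple R d]_(t in row_box b e) (rho0 1 (rowt t))%:E)%E).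
  apply: ge0_le_integral => //.
  - by move=> t _; rewrite lee_fin ltW// divr_gt0.
  - exact: measurable_funTS.
  - move=> t Bt; rewrite lee_fin; have : `|rho0 1 b - rho0 1 (rowt t)| < rho0 1 b / 2.
      by apply: He => j; rewrite mxE; exact: Bt.
    by rewrite ltr_distlC => /andP[+ _]; move: (rho0 1 b) => z; lra.
by apply: ge0_subset_integral => // t _; rewrite lee_fin rho_ge0.
Qed.

End dilation.

Section fubini_rows.
Context {R : realType} {d : nat}.
Local Notation mu := (lebesgue_tuple R d).

Lemma continuous_pair_l (G : 'rV[R]_d -> 'rV[R]_d -> R) (t : 'rV[R]_d) :
  continuous (fun p => G p.1 p.2) -> continuous (G t).
Proof.
move=> cG y; have h : (fun y' : 'rV[R]_d => (t, y')) @ y --> (t, y).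
  have h1 : (fun _ : 'rV[R]_d => t) @ y --> t by exact: cst_continuous.
  have h2 : (fun y' : 'rV[R]_d => y') @ y --> y by exact: cvg_id.
  exact: (cvg_pair h1 h2).
exact: (continuous_comp h (@cG (t, y))).
Qed.

Lemma continuous_pair_r (G : 'rV[R]_d -> 'rV[R]_d -> R) (y : 'rV[R]_d) :
  continuous (fun p => G p.1 p.2) -> continuous (G ^~ y).
Proof.
move=> cG t; have h : (fun t' : 'rV[R]_d => (t', y)) @ t --> (t, y).
  have h1 : (fun _ : 'rV[R]_d => y) @ t --> y by exact: cst_continuous.
  have h2 : (fun t' : 'rV[R]_d => t') @ t --> t by exact: cvg_id.
  exact: (cvg_pair h2 h1).
exact: (continuous_comp h (@cG (t, y))).
Qed.

Lemma Int_fubini (G : 'rV[R]_d -> 'rV[R]_d -> R) (A B : 'rV[R]_d -> R) :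
  continuous (fun p => G p.1 p.2) -> (forall t y, `|G t y| <= A t * B y) ->
  (forall t, 0 <= A t) -> (forall y, 0 <= B y) -> Lint A -> Lint B ->
  Lint (fun t => Int (G t)) /\ Int (fun t => Int (G t)) = Int (fun y => Int (G ^~ y)).
Proof.
move=> cG GAB A0 B0 LA LB.
pose f (p : (d.-tuple (measurableTypeR R) * d.-tuple (measurableTypeR R))%type) :=
  (G (rowt p.1) (rowt p.2))%:E.
have mf : measurable_fun setT f by apply/measurable_EFinP; exact: measurable_continuous_row2.
have LG (t : 'rV[R]_d) : Lint (G t).
  apply: (Lint_le _ (GAB t) (LintZ _ LB)); apply: mrow_continuous.
  exact: continuous_pair_l.
have LG' (y : 'rV[R]_d) : Lint (G ^~ y).
  apply: (@Lint_le _ _ _ (fun t => B y * A t)); last exact: LintZ.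
    by apply: mrow_continuous; exact: continuous_pair_r.
  by move=> t; rewrite mulrC.
have E1 (t : d.-tuple (measurableTypeR R)) : (\int[mu]_y f (t, y))%E = (Int (G (rowt t)))%:E.
  by rewrite /Int /Rintegral fineK//; exact: integrable_fin_num (LG _).
have E2 (y : d.-tuple (measurableTypeR R)) : (\int[mu]_t f (t, y))%E = (Int (G ^~ (rowt y)))%:E.
  by rewrite /Int /Rintegral fineK//; exact: integrable_fin_num (LG' _).
have fin : (mu \x mu)%E.-integrable setT f.
  apply/integrable12ltyP => //.
  apply: (@le_lt_trans _ _ (\int[mu]_t (Int B * A (rowt t))%:E)%E); last first.
    have := LintZ (Int B) LA => /integrableP[_]; apply: le_lt_trans.
    by under [X in (_ <= X)%E]eq_integral do rewrite gee0_abs ?lee_fin ?mulr_ge0 ?Int_ge0//.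
  apply: ge0_le_integral => //.
  - by move=> t _; exact: integral_ge0.
  - apply: (measurable_fun_fubini_tonelli_F (abse \o f)) => //.
      exact: measurableT_comp.
    by move=> z; exact: abse_ge0.
  - by apply/measurable_EFinP; exact: Lint_mrow (LintZ (Int B) LA).
  - move=> t _; rewrite /f/=.
    apply: (@le_trans _ _ (\int[mu]_y (A (rowt t) * B (rowt y))%:E)%E).
      apply: ge0_le_integral => //.
      + by apply/measurable_EFinP; apply: measurableT_comp => //; exact: Lint_mrow.
      + by apply/measurable_EFinP; exact: Lint_mrow (LintZ _ LB).
      + by move=> y _; rewrite lee_fin.
    rewrite -(fineK (integrable_fin_num measurableT (LintZ (A (rowt t)) LB))) lee_fin mulrC.
    by rewrite -(IntZ _ LB).
have F1 := integrable_fubini_F fin; have F2 := integral12_prod_meas1 fin.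
have F3 := integral21_prod_meas1 fin.
split.
  by move: F1; congr (integrable _ _ _); apply/funext => t; exact: E1.
rewrite /Int /Rintegral; congr fine; rewrite -/Int.
transitivity (\int[mu]_t fubini_F mu f t)%E; first by apply: eq_integral => t _; rewrite /fubini_F E1.
by rewrite F2 -F3; apply: eq_integral => t _; rewrite /fubini_G E2.
Qed.

End fubini_rows.

(** * Pairing the real part of the transform with Gaussians *)

Section real_part_of_transform.
Context {R : realType} {d : nat}.
Local Notation C := R[i].
Variables (Phi Pos : {fset 'rV[R]_d}) (k : 'rV[R]_d -> R) (K : 'rV[C]_d -> 'rV[C]_d -> C).
Hypotheses (rootP : root_system Phi) (normP : normalized Phi).
Hypotheses (posP : positive_subsystem Phi Pos) (kP : multiplicity_function Phi k).
Hypothesis (dK : dunkl_kernel Pos k K).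
Variables (p : nat) (x : 'rV[R]_d).
Hypothesis hp : (2 * dunkl_gamma Pos k + d%:R) / 2 + 1 <= p%:R.
Local Notation om := (om Pos k 0).
Local Notation rho0 s := (rho Pos k s 0).

Definition bessel_weight (q : nat) (y : 'rV[R]_d) : R := (1 + dot y y)^-1 ^+ q.
Local Notation bw := bessel_weight.

Lemma bessel_weight_ge0 q y : 0 <= bw q y.
Proof. by rewrite exprn_ge0// invr_ge0 addr_ge0 ?dot_ge0. Qed.

Lemma bessel_weight_le1 q y : bw q y <= 1.
Proof.
have h : 0 <= dot y y := dot_ge0 y.
by rewrite exprn_ile1 ?invr_ge0 ?addr_ge0// invf_le1 ?lerDl// ltr_pwDl.
Qed.

Lemma continuous_bessel_weight q : continuous (bw q).
Proof.
move=> y; have h : (fun _ : 'rV[R]_d => 1 : R) @ y --> (1 : R) by exact: cst_continuous.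
have h2 : (fun z => 1 + dot z z) @ y --> 1 + dot y y by exact: (cvgD h (@continuous_sqr_norm _ _ y)).
have n0 : 1 + dot y y != 0 by rewrite gt_eqF// ltr_pwDl ?dot_ge0.
have h3 : (fun z => (1 + dot z z)^-1) @ y --> (1 + dot y y)^-1 by exact: (cvgV n0 h2).
exact: (continuous_comp h3 (@exprn_continuous _ q _)).
Qed.

(** The real part of exp(-i (x,y)) K(t, iy). *)
Definition wave (t y : 'rV[R]_d) : R :=
  cos (dot x y) * kerRe K y t + sin (dot x y) * kerIm K y t.

Definition transform_re (t : 'rV[R]_d) : R :=
  Int (fun y => wave t y * (bw p y * om y)).

Lemma Re_F_x t : complex.Re (F_x Pos k K p%:Z x t) = transform_re t.
Proof.
have -> : complex.Re (F_x Pos k K p%:Z x t) = Int (fun y => complex.Re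
    (f_x p%:Z x y * K ('i%C *: toC y) (toC t) * (dunkl_weight Pos k y)%:C%C)) by [].
apply: eq_Int => y.
rewrite /f_x (kernel_imag_sym rootP normP posP kP dK) dunkl_weightE /wave /kerRe /kerIm.
case: (K (toC t) _) => u v /=; rewrite /bessel_weight.
have -> : (1 + dot y y) ^ p%:Z = (1 + dot y y) ^+ p by [].
rewrite !expr0n/= !addr0.
have e0 : (1 + dot y y) ^+ p != 0 by rewrite expf_neq0// gt_eqF// ltr_pwDl ?dot_ge0.
rewrite exprVn; move: ((1 + dot y y) ^+ p) e0 (om y) => a a0 b.
by field.
Qed.

Lemma wave_le2 t y : `|wave t y| <= 2.
Proof.
have := ker_le1 normP posP kP dK y t; rewrite /wave.
move: (kerRe K y t) (kerIm K y t) => u v uv.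
have c1 := cos_le1 (dot x y); have c2 := cos_geN1 (dot x y).
have s1 := sin_le1 (dot x y); have s2 := sin_geN1 (dot x y).
have hu : `|u| <= 1 by rewrite -(@expr_le1 _ 2)// real_normK ?num_real//; nra.
have hv : `|v| <= 1 by rewrite -(@expr_le1 _ 2)// real_normK ?num_real//; nra.
have hc : `|cos (dot x y)| <= 1 by rewrite ler_norml c2.
have hs : `|sin (dot x y)| <= 1 by rewrite ler_norml s2.
rewrite (le_trans (ler_normD _ _))// !normrM (_ : 2 = 1 + 1 :> R)//.
by rewrite lerD// mulr_ile1.
Qed.

Let cdot : continuous (fun y => dot x y).
Proof. by move=> y; exact: (@continuous_dot _ _ x y). Qed.

Lemma continuous_wave : continuous (fun q : 'rV[R]_d * 'rV[R]_d => wave q.1 q.2).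
Proof.
have [c1 c2] : continuous (fun q : 'rV[R]_d * 'rV[R]_d => kerRe K q.2 q.1) /\
    continuous (fun q : 'rV[R]_d * 'rV[R]_d => kerIm K q.2 q.1).
  apply: (kernel_continuous_along dK (A := fun q : 'rV[R]_d * 'rV[R]_d => toC q.1)
     (B := fun q : 'rV[R]_d * 'rV[R]_d => 'i%C *: toC q.2)) => -[q1 q2] e e0.
  set q := (q1, q2).
  have n1 : nbhs q [set q' : 'rV[R]_d * 'rV[R]_d | forall j, `|q.1 0 j - q'.1 0 j| < e].
    exact: (cvg_fst (near_coord q1 e0)).
  have n2 : nbhs q [set q' : 'rV[R]_d * 'rV[R]_d | forall j, `|q.2 0 j - q'.2 0 j| < e].
    exact: (cvg_snd (near_coord q2 e0)).
  apply: filterS (filterI n1 n2) => q' [h1 h2] j; rewrite !mxE -mulrBr -!rmorphB.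
  have ni (r : R) : normc ('i%C * r%:C%C) = `|r|.
    by rewrite /= (_ : _ ^+ 2 + _ ^+ 2 = r ^+ 2) ?sqrtr_sqr//; ring.
  by rewrite normc_real_complex ni; split.
have c3 : continuous (fun q : 'rV[R]_d * 'rV[R]_d => dot x q.2).
  move=> q; have h : (fun q : 'rV[R]_d * 'rV[R]_d => q.2) @ q --> q.2 by exact: cvg_snd.
  exact: (continuous_comp h (@cdot q.2)).
move=> q.
have h1 : (fun q : 'rV[R]_d * 'rV[R]_d => cos (dot x q.2)) @ q --> cos (dot x q.2).
  exact: (continuous_comp (@c3 q) (@continuous_cos R _)).
have h2 : (fun q : 'rV[R]_d * 'rV[R]_d => sin (dot x q.2)) @ q --> sin (dot x q.2).
  exact: (continuous_comp (@c3 q) (@continuous_sin R _)).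
exact: (cvgD (cvgM h1 (@c1 q)) (cvgM h2 (@c2 q))).
Qed.

Let cwl t : continuous (wave t).
Proof. exact: (@continuous_pair_l _ _ wave t continuous_wave). Qed.

Let cwr y : continuous (wave ^~ y).
Proof. exact: (@continuous_pair_r _ _ wave y continuous_wave). Qed.

Let W y := bw p y * om y.

Let W0 y : 0 <= W y. Proof. by rewrite mulr_ge0 ?bessel_weight_ge0 ?om_ge0. Qed.

Let LW : Lint W. Proof. exact: (Lint_inv_weight posP kP). Qed.

Let cW : continuous W.
Proof.
move=> y; exact: (cvgM (@continuous_bessel_weight p y) (continuous_om posP kP (lexx 0) (x := y))).
Qed.

Lemma transform_re_bounded t : `|transform_re t| <= 2 * Int W.
Proof.
have Lt : Lint (fun y => wave t y * W y).
  apply: (@Lint_le _ _ _ (fun y => 2 * W y)); last exact: LintZ.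
    apply: mrow_continuous => y.
    exact: (cvgM (@cwl t y) (@cW y)).
  by move=> y; rewrite normrM (ger0_norm (W0 y)); exact: (ler_wpM2r (W0 y) (wave_le2 t y)).
rewrite ler_norml /transform_re; apply/andP; split.
  rewrite -mulrN -IntN// -IntZ; last by have := LintZ (-1) LW; under eq_fun do rewrite mulN1r.
  apply: Int_le => //.
    by apply: LintZ; have := LintZ (-1) LW; under eq_fun do rewrite mulN1r.
  move=> y; rewrite mulrN -mulNr ler_wpM2r//.
  by have := wave_le2 t y; rewrite ler_norml => /andP[].
rewrite -IntZ//; apply: Int_le => //; first exact: LintZ.
move=> y; apply: ler_wpM2r; first exact: W0.
by have := wave_le2 t y; rewrite ler_norml => /andP[].
Qed.

Lemma transform_re_fubini (f : 'rV[R]_d -> R) : continuous f -> Lint f -> (forall t, 0 <= f t) ->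
  Lint (fun t => transform_re t * f t) /\
  Int (fun t => transform_re t * f t) = Int (fun y => Int (fun t => wave t y * f t) * W y).
Proof.
move=> cf Lf f0; pose G t y := wave t y * W y * f t.
have cG : continuous (fun q => G q.1 q.2).
  move=> q; have h1 : (fun q : 'rV[R]_d * 'rV[R]_d => W q.2) @ q --> W q.2.
    have h : (fun q : 'rV[R]_d * 'rV[R]_d => q.2) @ q --> q.2 by exact: cvg_snd.
    exact: (continuous_comp h (@cW q.2)).
  have h2 : (fun q : 'rV[R]_d * 'rV[R]_d => f q.1) @ q --> f q.1.
    have h : (fun q : 'rV[R]_d * 'rV[R]_d => q.1) @ q --> q.1 by exact: cvg_fst.
    exact: (continuous_comp h (@cf q.1)).
  exact: (cvgM (cvgM (@continuous_wave q) h1) h2).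
have Gle t y : `|G t y| <= f t * (2 * W y).
  rewrite normrM normrM (ger0_norm (W0 y)) (ger0_norm (f0 t)) mulrC ler_wpM2l//.
  by rewrite ler_wpM2r// wave_le2.
have W2 y : 0 <= 2 * W y by rewrite mulr_ge0.
have [H1 H2] := Int_fubini cG Gle f0 W2 Lf (LintZ 2 LW).
have LWt t : Lint (fun y => wave t y * W y).
  apply: (@Lint_le _ _ _ (fun y => 2 * W y)); last exact: LintZ.
    apply: mrow_continuous => y.
    exact: (cvgM (@cwl t y) (@cW y)).
  by move=> y; rewrite normrM (ger0_norm (W0 y)); exact: (ler_wpM2r (W0 y) (wave_le2 t y)).
have Lwf y : Lint (fun t => wave t y * f t).
  apply: (@Lint_le _ _ _ (fun t => 2 * f t)); last exact: LintZ.
    apply: mrow_continuous => t.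
    exact: (cvgM (@cwr y t) (@cf t)).
  by move=> t; rewrite normrM (ger0_norm (f0 t)); exact: (ler_wpM2r (f0 t) (wave_le2 t y)).
have E1 : (fun t => Int (G t)) = (fun t => transform_re t * f t).
  apply/funext => t; rewrite /transform_re mulrC -IntZ//.
  by apply: eq_Int => y; rewrite mulrC.
rewrite E1 in H1 H2; split => //; rewrite H2; apply: eq_Int => y.
by rewrite mulrC -IntZ//; apply: eq_Int => t; rewrite /G [RHS]mulrA [W y * _]mulrC.
Qed.

(** Fubini with the test function exp(-|t|^2) gives an integrable, hence measurable, product;
    multiplying by exp(|t|^2) recovers the transform. *)
Lemma mrow_transform_re : mrow transform_re.
Proof.
have [H _] := transform_re_fubini (@continuous_gauss R d 1) (Lint_gauss d ltr01) (@gauss_ge0 R d 1).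
have -> : transform_re = (fun t => transform_re t * gauss 1 t * gauss (-1) t).
  by apply/funext => t; rewrite -mulrA -gaussD subrr /gauss oppr0 mul0r expR0 mulr1.
by apply: measurable_funM; [exact: Lint_mrow H|exact: mrow_continuous (@continuous_gauss R d (-1))].
Qed.

(** After the exchange the inner integral is the transform of a Gaussian: its sine part vanishes,
    and exp(-|y|^2/(4s)) merges with [om] into the Gaussian weight of parameter 1/(4s). *)
Lemma transform_re_gauss (s : R) : 0 < s ->
  Int (fun t => transform_re t * rho0 s t) =
  Int (rho0 s) * Int (fun y => cos (dot x y) * bw p y * rho0 (4 * s)^-1 y).
Proof.
move=> s0; have crho : continuous (rho0 s) by exact: (continuous_rho posP kP).
have Lr := Lint_rho posP kP s0 (lexx 0).
have [_ ->] := transform_re_fubini crho Lr (rho_ge0 Pos k s 0).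
have H y : Int (fun t => wave t y * rho0 s t) = cos (dot x y) * (gauss (4 * s)^-1 y * Int (rho0 s)).
  have [U V] := Int_ker_gauss rootP normP posP kP dK s0 y.
  have [tU tV] := ker_tame normP posP kP dK y; have L0 := enorm_ge0 y.
  have LU : Lint (fun t => kerRe K y t * rho0 s t).
    apply: (Lint_rho_mul posP kP s0 (lexx 0)); first exact: mrow_continuous (tame_continuous L0 tU).
    by apply: (slow_le (slow_cst 1)) => t; case: tU.
  have LV : Lint (fun t => kerIm K y t * rho0 s t).
    apply: (Lint_rho_mul posP kP s0 (lexx 0)); first exact: mrow_continuous (tame_continuous L0 tV).
    by apply: (slow_le (slow_cst 1)) => t; case: tV.
  transitivity (cos (dot x y) * Int (fun t => kerRe K y t * rho0 s t) +
      sin (dot x y) * Int (fun t => kerIm K y t * rho0 s t)).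
    rewrite -IntZ// -[in X in _ = _ + X]IntZ// -IntD; [|exact: LintZ|exact: LintZ].
    by apply: eq_Int => t; rewrite [LHS]mulrDl -[X in X + _ = _]mulrA -[X in _ + X = _]mulrA.
  by rewrite U V mulr0 addr0 /gauss mulNr [dot y y / _]mulrC.
have Lc : Lint (fun y => cos (dot x y) * bw p y * rho0 (4 * s)^-1 y).
  have s4 : 0 < (4 * s)^-1 by rewrite invr_gt0 mulr_gt0.
  apply: (Lint_rho_mul posP kP s4 (lexx 0)).
    apply: mrow_continuous => y.
    exact: (cvgM (continuous_comp (@cdot y) (@continuous_cos R _)) (@continuous_bessel_weight p y)).
  apply: (slow_le (slow_cst 1)) => y; rewrite normrM mulr_ile1//.
    by rewrite ler_norml cos_geN1 cos_le1.
  by rewrite ger0_norm ?bessel_weight_ge0 ?bessel_weight_le1.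
rewrite -IntZ//; apply: eq_Int => y; rewrite H /W /rho.
by move: (gauss _ y) (om y) (bw p y) (cos _) (Int _) => a b c e f; ring.
Qed.

End real_part_of_transform.

(** * Power series and the contradiction *)

Section entire_series.
Context {R : realType}.
Implicit Types (c e : nat -> R) (v : R).

(** The associated entire function is bounded by A exp(B |v|). Quantifying over A and B makes the
    class stable under every operation of the descent. *)
Definition exp_type c := exists A B : R,
  [/\ 0 <= A, 0 <= B & forall n, `|c n| <= A * (B ^+ n / n`!%:R)].

Definition psum c v : R := limn (pseries c v).

Definition coef_shift c (n : nat) : R := if n is m.+1 then c m else 0.

Lemma is_cvg_exp_type c v : exp_type c -> cvgn (pseries c v).
Proof.
move=> [A [B [A0 B0 H]]]; apply: normed_cvg.
apply: (@series_le_cvg _ _ (fun n => A * exp_coeff (B * `|v|) n)).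
- by move=> n; exact: normr_ge0.
- by move=> n; rewrite mulr_ge0// /exp_coeff/= divr_ge0// exprn_ge0// mulr_ge0.
- move=> n /=; rewrite normrM normrX /exp_coeff/= exprMn.
  have -> : A * (B ^+ n * `|v| ^+ n / n`!%:R) = A * (B ^+ n / n`!%:R) * `|v| ^+ n by ring.
  by rewrite ler_wpM2r// exprn_ge0.
- have -> : series (fun n => A * exp_coeff (B * `|v|) n) = (fun n => A * series (exp_coeff (B * `|v|)) n).
    by apply/funext => n; rewrite /series/= mulr_sumr.
  by apply: is_cvgMr; exact: is_cvg_series_exp_coeff.
Qed.

Lemma cvg_psum v c : exp_type c -> pseries c v N @[N --> \oo] --> psum c v.
Proof. exact: is_cvg_exp_type. Qed.

Lemma exp_typeZ a c : exp_type c -> exp_type (fun n => a * c n).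
Proof.
move=> [A [B [A0 B0 H]]]; exists (`|a| * A), B; split=> // [|n]; first exact: mulr_ge0.
by rewrite normrM -mulrA ler_wpM2l.
Qed.

Lemma exp_typeD c e : exp_type c -> exp_type e -> exp_type (fun n => c n + e n).
Proof.
move=> [A [B [A0 B0 H]]] [A' [B' [A'0 B'0 H']]]; exists (A + A'), (B + B'); split=> [||n].
- exact: addr_ge0.
- exact: addr_ge0.
rewrite (le_trans (ler_normD _ _))// mulrDl lerD//.
  rewrite (le_trans (H n))// ler_wpM2l// ler_wpM2r ?invr_ge0// lerXn2r ?nnegrE ?addr_ge0//.
  by rewrite lerDl.
rewrite (le_trans (H' n))// ler_wpM2l// ler_wpM2r ?invr_ge0// lerXn2r ?nnegrE ?addr_ge0//.
by rewrite lerDr.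
Qed.

Lemma exp_type_diffs c : exp_type c -> exp_type (pseries_diffs c).
Proof.
move=> [A [B [A0 B0 H]]]; exists (A * B), B; split=> // [|n]; first exact: mulr_ge0.
rewrite /pseries_diffs normrM ger0_norm//.
have -> : A * B * (B ^+ n / n`!%:R) = n.+1%:R * (A * (B ^+ n.+1 / n.+1`!%:R)).
  have n1 : n.+1%:R != 0 :> R by rewrite pnatr_eq0.
  have n2 : n`!%:R != 0 :> R by rewrite pnatr_eq0 -lt0n fact_gt0.
  rewrite factS natrM exprS; move: (n.+1%:R : R) (n`!%:R : R) (B ^+ n) n1 n2 => a b z a0 b0.
  by field; rewrite a0 b0.
by rewrite ler_wpM2l.
Qed.

Lemma exp_type_tail c : exp_type c -> exp_type (fun n => c n.+1).
Proof.
move=> /exp_type_diffs[A [B [A0 B0 H]]]; exists A, B; split=> // n.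
apply: le_trans (H n); rewrite /pseries_diffs normrM ger0_norm// ler_peMl//.
by rewrite ler1n.
Qed.

(** Shifting trades 1/n! for (n+1)/(n+1)!, and n + 1 <= 2^(n+1) is absorbed into the new base 2 (B +
    1); adding 1 makes the base large enough to bound B^n by (B + 1)^(n+1). *)
Lemma exp_type_shift c : exp_type c -> exp_type (coef_shift c).
Proof.
move=> [A [B [A0 B0 H]]]; have B1 : 0 <= 2 * (B + 1) by rewrite mulr_ge0 ?addr_ge0.
exists A, (2 * (B + 1)); split=> // -[|n] /=.
  by rewrite normr0 mulr_ge0// divr_ge0// exprn_ge0.
rewrite (le_trans (H n))// ler_wpM2l//.
have n1 : n.+1%:R != 0 :> R by rewrite pnatr_eq0.
have n2 : n`!%:R != 0 :> R by rewrite pnatr_eq0 -lt0n fact_gt0.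
have -> : B ^+ n / n`!%:R = n.+1%:R * B ^+ n / n.+1`!%:R.
  rewrite factS natrM; move: (n.+1%:R : R) (n`!%:R : R) (B ^+ n) n1 n2 => a b z a0 b0.
  by field; rewrite a0 b0.
rewrite ler_wpM2r ?invr_ge0// exprMn ler_pM// ?exprn_ge0//.
  by rewrite -natrX ler_nat ltnW// ltn_expl.
rewrite (@le_trans _ _ ((B + 1) ^+ n))//.
  by rewrite lerXn2r ?nnegrE ?addr_ge0// lerDl.
by rewrite exprS ler_peMl ?exprn_ge0 ?addr_ge0// lerDr.
Qed.

Lemma psumD c e v : exp_type c -> exp_type e -> psum (fun n => c n + e n) v = psum c v + psum e v.
Proof.
move=> hc he; apply/cvg_lim => //.
have -> : pseries (fun n => c n + e n) v = (fun N => pseries c v N + pseries e v N).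
  apply/funext => N; rewrite /pseries /series/= -big_split/=.
  by apply: eq_bigr => i _; rewrite mulrDl.
by apply: cvgD; exact: cvg_psum.
Qed.

Lemma psumZ a c v : exp_type c -> psum (fun n => a * c n) v = a * psum c v.
Proof.
move=> hc; apply/cvg_lim => //.
have -> : pseries (fun n => a * c n) v = (fun N => a * pseries c v N).
  apply/funext => N; rewrite /pseries /series/= mulr_sumr.
  by apply: eq_bigr => i _; rewrite mulrA.
by apply: cvgM; [exact: cvg_cst|exact: cvg_psum].
Qed.

Lemma psum_shift c v : exp_type c -> psum (coef_shift c) v = v * psum c v.
Proof.
move=> hc; apply/cvg_lim => //; rewrite -cvg_shiftS.
have -> : (fun N => pseries (coef_shift c) v N.+1) = (fun N => v * pseries c v N).
  apply/funext => N; rewrite /pseries /series/= big_nat_recl//= mul0r add0r mulr_sumr.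
  by apply: eq_bigr => i _; rewrite exprS mulrCA.
by apply: cvgM; [exact: cvg_cst|exact: cvg_psum].
Qed.

Lemma psum_tail c v : exp_type c -> psum c v = c 0 + v * psum (fun n => c n.+1) v.
Proof.
move=> hc; have ht := exp_type_tail hc; apply/cvg_lim => //; rewrite -cvg_shiftS.
have -> : (fun N => pseries c v N.+1) = (fun N => c 0 + v * pseries (fun n => c n.+1) v N).
  apply/funext => N; rewrite /pseries /series/= big_nat_recl//= expr0 mulr1 mulr_sumr.
  by congr (_ + _); apply: eq_bigr => i _; rewrite exprS mulrCA.
apply: cvgD; first exact: cvg_cst.
by apply: cvgM; [exact: cvg_cst|exact: cvg_psum].
Qed.

Lemma is_derive_psum c v : exp_type c -> is_derive v 1 (psum c) (psum (pseries_diffs c) v).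
Proof.
move=> hc; have hd := exp_type_diffs hc; have hdd := exp_type_diffs hd.
apply: (@pseries_snd_diffs _ c (`|v| + 1)); [exact: is_cvg_exp_type..|].
by rewrite [ltRHS]ger0_norm ?addr_ge0// ltrDl.
Qed.

(** Continuity at 0 along the points 1/(m+1) kills the constant term; the tail, divided by v > 0,
    satisfies the same hypotheses. *)
Lemma psum_eq0 c : exp_type c -> (forall v, 0 < v -> psum c v = 0) -> forall n, c n = 0.
Proof.
have H0 e : exp_type e -> (forall v, 0 < v -> psum e v = 0) -> e 0 = 0.
  move=> he He; have [dp _] := is_derive_psum 0 he.
  have cp : {for 0, continuous (psum e)} by apply: differentiable_continuous; exact/derivable1_diffP.
  have h := cvg_comp _ _ (@cvg_harmonic R) cp.
  have p0 : psum e 0 = e 0 by rewrite psum_tail// mul0r addr0.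
  rewrite -p0 -(cvg_lim _ h)//.
  have -> : psum e \o @harmonic R = (fun=> 0).
    by apply/funext => m; rewrite /= He// invr_gt0.
  by rewrite lim_cst.
move=> hc Hc n; elim: n c hc Hc => [|n IH] c hc Hc; first exact: H0.
apply: (IH (fun n => c n.+1)); first exact: exp_type_tail.
move=> v v0; have := psum_tail v hc; rewrite Hc// H0// add0r => /esym/eqP.
by rewrite mulf_eq0 gt_eqF//= => /eqP.
Qed.

End entire_series.

Section bessel_gauss_integral.
Context {R : realType} {d : nat}.
Variables (Phi Pos : {fset 'rV[R]_d}) (k : 'rV[R]_d -> R).
Hypotheses (posP : positive_subsystem Phi Pos) (kP : multiplicity_function Phi k).
Variable (x : 'rV[R]_d).
Local Notation rho0 s := (rho Pos k s 0).
Local Notation bw := bessel_weight.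
Local Notation lam := ((2 * dunkl_gamma Pos k + d%:R) / 2).

(** The function Phi_q of the overview. *)
Definition bessel_gauss (q : nat) (w : R) : R :=
  Int (fun y => cos (dot x y) * bw q y * rho0 w y).

Let cosw q y := cos (dot x y) * bw q y.

Let cosw_le1 q y : `|cosw q y| <= 1.
Proof.
rewrite normrM mulr_ile1// ?ler_norml ?cos_geN1 ?cos_le1// bessel_weight_le1 andbT.
by rewrite (le_trans _ (bessel_weight_ge0 q y))// lerN10.
Qed.

Let continuous_cosw q : continuous (cosw q).
Proof.
move=> y; have h : (fun y => cos (dot x y)) @ y --> cos (dot x y).
  exact: (continuous_comp (@continuous_dot _ _ x y) (@continuous_cos R _)).
exact: (cvgM h (@continuous_bessel_weight _ _ q y)).
Qed.

Let slow_cosw q : slow (cosw q).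
Proof. exact: (slow_le (slow_cst 1) (cosw_le1 q)). Qed.

Let Lcosw q w : 0 < w -> Lint (fun y => cosw q y * rho0 w y).
Proof. by move=> w0; apply: (Lint_rho_mul posP kP w0) => //; exact: mrow_continuous. Qed.

Let cdd : continuous (fun y : 'rV[R]_d => dot y y).
Proof. by move=> y; exact: continuous_sqr_norm. Qed.

Let Lcoswd q w : 0 < w -> Lint (fun y => cosw q y * dot y y * rho0 w y).
Proof.
move=> w0; apply: (Lint_rho_mul posP kP w0) => //.
  by apply: mrow_continuous => y; exact: (cvgM (@continuous_cosw q y) (@cdd y)).
by apply: slowM => //; exact: slow_sqr_dot.
Qed.

Lemma is_derive_bessel_gauss q (w : R) : 0 < w -> is_derive w 1 (bessel_gauss q)
  (- Int (fun y => cosw q y * dot y y * rho0 w y)).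
Proof.
move=> w0; have w2 : 0 < w / 2 by rewrite divr_gt0.
have ww : w / 2 < w < w + 1 by lra.
rewrite -(IntN (Lcoswd q w0)).
apply: (@is_derive_Int _ _ (fun u y => cosw q y * rho0 u y)
  (fun u y => - (cosw q y * dot y y * rho0 u y)) (fun y => dot y y * rho0 (w / 2) y) _ _ _ ww).
- by move=> u /andP[u0 _]; apply: Lcosw; exact: lt_trans u0.
- move=> u y _.
  have h1 : is_derive u 1 (fun u : R => - u * dot y y) (- dot y y).
    have -> : (fun u : R => - u * dot y y) = (fun u : R => u * - dot y y).
      by apply/funext => z; rewrite mulrN mulNr.
    apply: (is_derive_eq (is_deriveM (is_derive_id _ _) (is_derive_cst (- dot y y) _ _))).
    by rewrite !scaleRE; rewrite mulr0 add0r mulr1.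
  have h2 := @is_derive1_comp R expR (fun u : R => - u * dot y y) u _ _ (is_derive_expR _) h1.
  have h3 : is_derive u 1 (fun u => om Pos k 0 y * gauss u y) (om Pos k 0 y * (gauss u y * - dot y y)).
    apply: (is_derive_eq (is_deriveM (is_derive_cst (om Pos k 0 y) _ _) h2)).
    by rewrite !scaleRE; rewrite mulr0 addr0.
  apply: (is_derive_eq (is_deriveM (is_derive_cst (cosw q y) _ _) h3)).
  rewrite !scaleRE mulr0 addr0 /rho /cst.
  by move: (cosw q y) (om Pos k 0 y) (gauss u y) (dot y y) => a b c e; ring.
- move=> u y /andP[u1 u2]; rewrite normrN normrM [X in _ * X]ger0_norm ?rho_ge0//.
  apply: ler_pM; [by []|exact: rho_ge0| |].
    by rewrite normrM (ger0_norm (dot_ge0 y)) ler_piMl ?dot_ge0.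
  rewrite /rho ler_wpM2l ?om_ge0// /gauss ler_expR.
  by rewrite ler_wpM2r ?dot_ge0// lerN2 ltW.
- apply: (Lint_rho_mul posP kP w2) => //; first exact: mrow_continuous.
  exact: slow_sqr_dot.
Qed.

Lemma bessel_gauss_rec q w : 0 < w ->
  bessel_gauss q w = bessel_gauss q.+1 w + Int (fun y => cosw q.+1 y * dot y y * rho0 w y).
Proof.
move=> w0; rewrite /bessel_gauss -IntD; [|exact: Lcosw|exact: Lcoswd].
apply: eq_Int => y; rewrite -mulrDl /cosw.
have -> : bw q y = bw q.+1 y * (1 + dot y y).
  rewrite /bw exprSr mulfVK// gt_eqF// ltr_pwDl ?dot_ge0//.
by congr (_ * _); ring.
Qed.

Definition series_of (q : nat) (H : nat -> R) := exp_type H /\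
  forall w, 0 < w -> bessel_gauss q w = w `^ (- lam) * psum H w^-1.

(** With v = 1/w, the derivative of w^(-lam) H(v) is -w^(-lam) v (lam H + v H')(v). Subtracting it
    from Phi_(q+1) adds to H the shifted coefficients (lam + m) H_m. *)
Lemma series_of_pred q H : series_of q.+1 H ->
  series_of q (fun n => H n + coef_shift (fun m => (lam + m%:R) * H m) n).
Proof.
set l := lam; move=> [hH EH].
have hdH := exp_type_diffs hH; have hsd := exp_type_shift hdH; have hl := exp_typeZ l hH.
have E : (fun m => (l + m%:R) * H m) = (fun m => l * H m + coef_shift (pseries_diffs H) m).
  apply/funext => -[|m]; first by rewrite /= !addr0.
  by rewrite mulrDl.
have hE : exp_type (fun m => (l + m%:R) * H m) by rewrite E; exact: exp_typeD.
have hS := exp_type_shift hE.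
split; first exact: exp_typeD.
move=> w w0; have wn : w != 0 by rewrite gt_eqF.
rewrite psumD// psum_shift// E psumD// psum_shift// psumZ//.
rewrite bessel_gauss_rec// (EH w w0).
(* The same function is differentiated through its expansion and, in [D2], under the integral sign;
   comparison evaluates the integral with the factor |y|^2. *)
have D1 : is_derive w 1 (fun w : R => w `^ (- l) * psum H w^-1)
    (w `^ (- l) * (psum (pseries_diffs H) w^-1 * - w ^- 2) + psum H w^-1 * (- l * w `^ (- l - 1))).
  have h1 : is_derive w 1 (fun w : R => w^-1 : R^o) (- w ^- 2).
    have := @is_deriveV R (fun w => w) w 1 1 wn (is_derive_id _ _).
    by rewrite scaleRE mulr1.
  have h2 := @is_derive1_comp R (psum H) (fun w : R => w^-1) w _ _ (is_derive_psum w^-1 hH) h1.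
  exact: (is_deriveM (is_derive1_powR (- l) w0) h2).
have D2 : is_derive w 1 (fun w : R => w `^ (- l) * psum H w^-1)
    (- Int (fun y => cosw q.+1 y * dot y y * rho0 w y)).
  apply: (near_eq_is_derive _ (is_derive_bessel_gauss q.+1 w0)).
  have N : nbhs w [set u : R | 0 < u] by exact: lt_nbhsr.
  by apply: filterS N => u; exact: EH.
have := @derive_val _ _ _ _ _ _ _ D1; rewrite (@derive_val _ _ _ _ _ _ _ D2).
move/(canRL opprK) => ->.
have -> : w `^ (- l - 1) = w `^ (- l) * w^-1.
  by rewrite powRD ?wn ?implybT// powR_inv1// ltW.
move: (w `^ (- l)) (psum H _) (psum (pseries_diffs H) _) => A B D.
by field.
Qed.

End bessel_gauss_integral.

Section base_series.
Context {R : realType} {d : nat}.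
Local Notation C := R[i].
Variables (Phi Pos : {fset 'rV[R]_d}) (k : 'rV[R]_d -> R) (K : 'rV[C]_d -> 'rV[C]_d -> C).
Hypotheses (rootP : root_system Phi) (normP : normalized Phi).
Hypotheses (posP : positive_subsystem Phi Pos) (kP : multiplicity_function Phi k).
Hypothesis (dK : dunkl_kernel Pos k K).
Variable (x : 'rV[R]_d).
Local Notation rho0 s := (rho Pos k s 0).
Local Notation om := (om Pos k 0).
Local Notation homdim := (2 * dunkl_gamma Pos k + d%:R).
Local Notation lam := (homdim / 2).
Local Notation m1 := (Int (rho0 1)).

Lemma series_exp_coeff_le (z : R) N : 0 <= z -> series (exp_coeff z) N <= expR z.
Proof.
move=> z0; apply: nondecreasing_cvgn_le; last exact: is_cvg_series_exp_coeff.
by apply/nondecreasing_seqP => n; rewrite seriesSr lerDl /exp_coeff/= divr_ge0// exprn_ge0.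
Qed.

Lemma Int_rho_powR (s : R) : 0 < s -> Int (rho0 s) = s `^ (- lam) * m1.
Proof.
move=> s0; pose r := s `^ (- 2^-1); have r0 : 0 < r by rewrite powR_gt0.
have rs : r ^- 2 = s.
  rewrite /r -powR_mulrn ?powR_ge0// -powRrM mulNr mulVf// powR_inv1 ?ltW//.
  by rewrite invrK.
have := Int_rho_mass posP kP r0; rewrite rs => ->; congr (_ * _).
by rewrite /r -powRrM; congr (_ `^ _); rewrite mulNr mulrC.
Qed.

Lemma exp_type_dilate (r : R) (c : nat -> R) : 0 <= r -> exp_type c ->
  exp_type (fun n => r ^+ n * c n).
Proof.
move=> r0 [A [B [A0 B0 H]]]; exists A, (r * B); split=> // [|n]; first exact: mulr_ge0.
rewrite normrM ger0_norm ?exprn_ge0// exprMn.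
have -> : A * (r ^+ n * B ^+ n / n`!%:R) = r ^+ n * (A * (B ^+ n / n`!%:R)) by ring.
by rewrite ler_wpM2l ?exprn_ge0.
Qed.

Lemma psum_dilate (r v : R) (c : nat -> R) : psum (fun n => r ^+ n * c n) v = psum c (r * v).
Proof.
rewrite /psum; congr (limn _); apply/funext => N; rewrite /pseries /series/=.
by apply: eq_bigr => i _; rewrite exprMn mulrAC mulrA [_ * c i]mulrC !mulrA.
Qed.

(** Compact support enters here: where the transform is nonzero, |t|^2 <= B, so exp(-s |t|^2) may be
    expanded and integrated termwise. The n-th coefficient is a moment of order at most B^n over n!,
    whence exponential type. *)
Lemma transform_series p (B : R) : lam + 1 <= p%:R -> 0 <= B ->
  (forall t, B < dot t t -> transform_re Pos k K p x t = 0) ->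
  exists2 c, exp_type c & forall s, 0 < s ->
    Int (fun t => transform_re Pos k K p x t * rho0 s t) = psum c s.
Proof.
move=> hp B0 supp; set tr := transform_re Pos k K p x.
have mtr : mrow tr by exact: (mrow_transform_re normP posP kP dK x hp).
have bnd := transform_re_bounded normP posP kP dK x hp.
set M := (2 * Int _) in bnd.
have com : continuous om by exact: (continuous_om posP kP).
have om0 t : 0 <= om t by exact: om_ge0.
have M0 : 0 <= M by rewrite (le_trans _ (bnd 0)).
have L1 : Lint (fun t => tr t * om t).
  apply: (@Lint_le _ _ _ (fun t => M * expR B * rho0 1 t)).
  - by apply: measurable_funM => //; exact: mrow_continuous.
  - move=> t; rewrite normrM (ger0_norm (om0 t)).
    have [tB|tB] := ltP B (dot t t).
      by rewrite /tr supp// normr0 mul0r mulr_ge0 ?rho_ge0// mulr_ge0 ?expR_ge0.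
    rewrite /rho (_ : M * _ * _ = M * (expR B * gauss 1 t) * om t); last by ring.
    apply: ler_wpM2r; first exact: om0.
    apply: (le_trans (bnd t)); rewrite ler_peMr//.
    by rewrite /gauss -expRD -[leLHS]expR0 ler_expR mulN1r subr_ge0.
  - by apply: LintZ; exact: (Lint_rho posP kP).
pose A := Int (fun t => `|tr t * om t|).
have LA : Lint (fun t => `|tr t * om t|) by exact: integrable_norm L1.
pose mom n t := tr t * om t * dot t t ^+ n.
have momle n t : `|mom n t| <= B ^+ n * `|tr t * om t|.
  rewrite normrM; have [tB|tB] := ltP B (dot t t).
    by rewrite /tr supp// mul0r normr0 mul0r mulr0.
  by rewrite mulrC ler_wpM2r// normrX ger0_norm ?dot_ge0// lerXn2r ?nnegrE ?dot_ge0.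
have mmom n : mrow (mom n).
  apply: measurable_funM; first exact: Lint_mrow L1.
  apply: (@mrow_continuous _ _ (fun t => dot t t ^+ n)) => t.
  exact: (continuous_comp (@continuous_sqr_norm _ _ t) (@exprn_continuous _ n _)).
have Lmom n : Lint (mom n) by exact: Lint_le (mmom n) (momle n) (LintZ _ LA).
pose c n := (-1) ^+ n * Int (mom n) / n`!%:R.
exists c.
  exists A, B; split => // [|n]; first by apply: Int_ge0 => t; exact: normr_ge0.
  rewrite /c normrM normrM normrX normrN1 expr1n mul1r normfV normr_nat mulrA.
  rewrite ler_wpM2r ?invr_ge0// mulrC -(IntZ _ LA).
  rewrite ler_norml; apply/andP; split; last first.
    by apply: Int_le => // [|t]; [exact: LintZ|exact: le_trans (ler_norm _) (momle n t)].
  rewrite -IntN; last exact: LintZ.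
  apply: Int_le => // [|t].
    by under [X in Lint X]eq_fun do rewrite -mulN1r; do 2 apply: LintZ.
  by have := momle n t; rewrite ler_norml => /andP[].
move=> s s0.
pose g N t := \sum_(0 <= n < N) ((- s) ^+ n / n`!%:R) * mom n t.
have Lg N : Lint (g N) by apply: Lint_sum => n _; exact: LintZ.
have gE N t : g N t = tr t * om t * series (exp_coeff (- s * dot t t)) N.
  rewrite /g /series/= mulr_sumr; apply: eq_bigr => n _.
  by rewrite /exp_coeff/= /mom exprMn; ring.
have [_ Cg] : Lint (fun t => tr t * rho0 s t) /\ Int (g N) @[N --> \oo] --> Int (fun t => tr t * rho0 s t).
  apply: (@dct_Int _ _ _ _ (fun t => expR (s * B) * `|tr t * om t|)).
  - by move=> N; exact: Lint_mrow.
  - move=> t; under eq_fun do rewrite gE.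
    rewrite /rho mulrA; apply: cvgM; first exact: cvg_cst.
    rewrite /gauss /expR; exact: is_cvg_series_exp_coeff.
  - move=> N t; rewrite gE normrM; have [tB|tB] := ltP B (dot t t).
      by rewrite /tr supp// mul0r normr0 mul0r mulr0.
    rewrite mulrC ler_wpM2r//.
    apply: (@le_trans _ _ (series (exp_coeff (s * dot t t)) N)).
      rewrite /series/= (le_trans (ler_norm_sum _ _ _))//; apply: ler_sum => n _.
      rewrite /exp_coeff/= normrM normrX normfV normr_nat normrM normrN (gtr0_norm s0).
      by rewrite ger0_norm ?dot_ge0.
    rewrite (le_trans (series_exp_coeff_le _ _)) ?mulr_ge0 ?dot_ge0 ?(ltW s0)//.
    by rewrite ler_expR ler_wpM2l// ltW.
  - exact: LintZ.
rewrite -(cvg_lim _ Cg)// /psum; congr (limn _); apply/funext => N.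
rewrite /g Int_sum; last by move=> n _; exact: LintZ.
rewrite /pseries /series/=; apply: eq_bigr => n _; rewrite IntZ// /c.
have -> : (- s) ^+ n = (-1) ^+ n * s ^+ n by rewrite -exprMn mulN1r.
by move: (Int _) ((-1) ^+ n) (s ^+ n) => a b e; ring.
Qed.

(** [transform_re_gauss] at s = 1/(4w) is solved for Phi_p. The mass of rho_s is s^(-lam) times that
    of rho_1, which yields the prefactor w^(-lam) and the constant 4^(-lam). *)
Lemma series_of_transform p (B : R) : lam + 1 <= p%:R -> 0 <= B ->
  (forall t, B < dot t t -> transform_re Pos k K p x t = 0) ->
  exists H, series_of Pos k x p H.
Proof.
move=> hp B0 supp; have [c hc Hc] := transform_series hp B0 supp.
have m0 := Int_rho_gt0 posP kP.
exists (fun n => (4^-1) `^ lam / m1 * ((4^-1) ^+ n * c n)).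
have hc4 : exp_type (fun n => (4^-1) ^+ n * c n) by apply: exp_type_dilate => //; rewrite invr_ge0.
split; first exact: exp_typeZ.
move=> w w0; rewrite psumZ// psum_dilate.
have s0 : 0 < 4^-1 * w^-1 by rewrite mulr_gt0 ?invr_gt0.
have := transform_re_gauss rootP normP posP kP dK x hp s0; rewrite Hc// Int_rho_powR//.
have -> : (4 * (4^-1 * w^-1))^-1 = w by rewrite mulrA divff ?mul1r ?invrK// pnatr_eq0.
rewrite -/(bessel_gauss Pos k x p w) => ->.
rewrite powRM ?invr_ge0 ?(ltW w0)//.
have wV (h : R) : w^-1 `^ h = (w `^ h)^-1.
  by rewrite -(powR_inv1 (ltW w0)) -powRrM mulN1r powRN.
rewrite wV.
rewrite [(4^-1) `^ (- _)]powRN.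
have n1 : (4^-1 : R) `^ lam != 0 by rewrite gt_eqF// powR_gt0// invr_gt0.
have n2 : w `^ (- lam) != 0 by rewrite gt_eqF// powR_gt0.
have n3 : m1 != 0 by rewrite gt_eqF.
move: (4^-1 `^ _) (w `^ _) m1 (bessel_gauss _ _ _ _ _) n1 n2 n3 => a b e f a0 b0 e0.
by field; rewrite a0 b0 e0.
Qed.

End base_series.

(** * The expansion at q = 0 and its incompatibility with the descent *)

Section contradiction.
Context {R : realType} {d : nat}.
Variables (Phi Pos : {fset 'rV[R]_d}) (k : 'rV[R]_d -> R).
Hypotheses (posP : positive_subsystem Phi Pos) (kP : multiplicity_function Phi k).
Variable (x : 'rV[R]_d).
Local Notation rho0 s := (rho Pos k s 0).
Local Notation homdim := (2 * dunkl_gamma Pos k + d%:R).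
Local Notation lam := (homdim / 2).
Local Notation m1 := (Int (rho0 1)).

Lemma expn_le_expR (u : R) n : 0 <= u -> u ^+ n <= n`!%:R * expR u.
Proof.
move=> u0; have f0 : 0 < n`!%:R :> R by rewrite ltr0n fact_gt0.
rewrite mulrC -ler_pdivrMr// (le_trans _ (series_exp_coeff_le n.+1 u0))//.
rewrite seriesSr lerDr /series/= sumr_ge0// => i _.
by rewrite /exp_coeff/= divr_ge0// exprn_ge0.
Qed.

Lemma cos_partial_le (u : R) N : `|series (cos_coeff' u) N| <= expR `|u|.
Proof.
apply: (@le_trans _ _ (series (exp_coeff `|u|) N.*2)); last exact: series_exp_coeff_le.
elim: N => [|N IH]; first by rewrite /series/= !big_geq// normr0.
rewrite doubleS !seriesSr (le_trans (ler_normD _ _))// -addrA lerD//.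
apply: (@le_trans _ _ (exp_coeff `|u| N.*2)); last by rewrite lerDl /exp_coeff/= divr_ge0// exprn_ge0.
by rewrite /cos_coeff' !normrM !normrX normfV normr_nat normrN1 expr1n mul1r.
Qed.

(** Completing the square, |r| |x| |y| <= r^2 |x|^2/(4b) + b |y|^2. This function dominates all
    partial sums of the cosine series. *)
Lemma slow_expR_dot (r : R) : slow (fun y => expR `|r * dot x y|).
Proof.
move=> b b0; exists (expR (r ^+ 2 * dot x x / (4 * b))); first exact: expR_ge0.
move=> y; rewrite ger0_norm ?expR_ge0// gauss_opp -expRD ler_expR normrM.
have h : `|r| * `|dot x y| <= `|r| * (enorm x * enorm y) by rewrite ler_wpM2l// normr_dot_le.
apply: (le_trans h); rewrite -!sqr_enorm -(@real_normK _ r) ?num_real//.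
move: (`|r|) (enorm x) (enorm y) => u v w.
have e : u ^+ 2 * v ^+ 2 / (4 * b) + b * w ^+ 2 - u * (v * w) = (u * v / 2 - b * w) ^+ 2 / b.
  by field; rewrite gt_eqF.
by rewrite -subr_ge0 e divr_ge0 ?sqr_ge0 ?ltW.
Qed.

Let cdot : continuous (fun y => dot x y).
Proof. by move=> y; exact: (@continuous_dot _ _ x y). Qed.

Let dot_mom n : 'rV[R]_d -> R := fun y => dot x y ^+ n.*2.

Let cmom n : continuous (dot_mom n).
Proof. by move=> y; exact: (continuous_comp (@cdot y) (@exprn_continuous _ n.*2 _)). Qed.

Let mom0 n y : 0 <= dot_mom n y.
Proof. by rewrite /dot_mom -mul2n exprM exprn_ge0// sqr_ge0. Qed.

(** The Gaussian is split into two equal factors: one absorbs |y|^(2n), since (|y|^2/2)^n <= n!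
    exp(|y|^2/2), and the other keeps the right-hand side integrable. *)
Let mom_le n y : dot_mom n y * rho0 1 y <= (2 * dot x x) ^+ n * n`!%:R * rho0 2^-1 y.
Proof.
have e : 2^-1 + 2^-1 = 1 :> R by field.
have h1 : dot_mom n y <= dot x x ^+ n * dot y y ^+ n.
  rewrite /dot_mom -mul2n exprM -exprMn; apply: lerXn2r; rewrite ?nnegrE ?sqr_ge0 ?mulr_ge0 ?dot_ge0//.
  rewrite -!sqr_enorm -exprMn -(@real_normK _ (dot x y)) ?num_real// lerXn2r ?nnegrE ?mulr_ge0 ?enorm_ge0//.
  exact: normr_dot_le.
have h2 : dot y y ^+ n * gauss 2^-1 y <= 2 ^+ n * n`!%:R.
  have := expn_le_expR n (divr_ge0 (dot_ge0 y) (ler0n R 2)).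
  rewrite exprMn exprVn ler_pdivrMr ?exprn_gt0// => h.
  apply: (le_trans (ler_wpM2r (gauss_ge0 2^-1 y) h)).
  have -> : gauss 2^-1 y = (expR (dot y y / 2))^-1 by rewrite /gauss mulNr expRN mulrC.
  rewrite le_eqVlt; apply/orP; left; apply/eqP; have := lt0r_neq0 (expR_gt0 (dot y y / 2)).
  by move: (expR _) (2 ^+ n) => a b a0; field.
have -> : rho0 1 y = om Pos k 0 y * gauss 2^-1 y * gauss 2^-1 y.
  by rewrite /rho -mulrA -gaussD e.
set g := gauss 2^-1 y in h2 *; set o := om Pos k 0 y.
have g0 : 0 <= g := gauss_ge0 _ _; have o0 : 0 <= o := om_ge0 _ _ _ _.
have og : 0 <= o * g by rewrite mulr_ge0.
rewrite (le_trans (ler_wpM2r (mulr_ge0 og g0) h1))// exprMn.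
have -> : dot x x ^+ n * dot y y ^+ n * (o * g * g) = dot x x ^+ n * (o * g) * (dot y y ^+ n * g) by ring.
have -> : 2 ^+ n * dot x x ^+ n * n`!%:R * (o * g) = dot x x ^+ n * (o * g) * (2 ^+ n * n`!%:R) by ring.
by rewrite ler_wpM2l// mulr_ge0// exprn_ge0// dot_ge0.
Qed.

Let Lmom n : Lint (fun y => dot_mom n y * rho0 1 y).
Proof.
apply: (@Lint_le _ _ _ (fun y => (2 * dot x x) ^+ n * n`!%:R * rho0 2^-1 y)).
- by apply: mrow_continuous => y; exact: (cvgM (@cmom n y) (continuous_rho posP kP (lexx 0) (x := y))).
- by move=> y; rewrite ger0_norm; [exact: mom_le|exact: (mulr_ge0 (mom0 n y) (rho_ge0 _ _ _ _ _))].
- by apply: LintZ; apply: (Lint_rho posP kP) => //; rewrite invr_gt0.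
Qed.

Let mom n := Int (fun y => dot_mom n y * rho0 1 y).

Let mom_ge0 n : 0 <= mom n.
Proof. by apply: Int_ge0 => y; exact: (mulr_ge0 (mom0 n y) (rho_ge0 _ _ _ _ _)). Qed.

Let cosc n : R := (-1) ^+ n * (mom n / n.*2`!%:R).

(** The moments grow at most like (2 |x|^2)^n n!, and (2n)! >= n!^2 leaves a factor 1/n!. *)
Let exp_type_cosc : exp_type cosc.
Proof.
exists (Int (rho0 2^-1)), (2 * dot x x); split => [||n].
- by apply: Int_ge0 => y; exact: rho_ge0.
- by rewrite mulr_ge0 ?dot_ge0.
have f0 m : 0 < m`!%:R :> R by rewrite ltr0n fact_gt0.
rewrite /cosc normrM normrX normrN1 expr1n mul1r ger0_norm ?divr_ge0//.
rewrite ler_pdivrMr//.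
have Lr : Lint (rho0 2^-1) by apply: (Lint_rho posP kP) => //; rewrite invr_gt0.
have h : mom n <= (2 * dot x x) ^+ n * n`!%:R * Int (rho0 2^-1).
  by rewrite -IntZ//; apply: Int_le => //; exact: LintZ.
apply: (le_trans h).
have hf : n`!%:R * n`!%:R <= n.*2`!%:R :> R.
  rewrite -natrM ler_nat -(@bin_fact n.*2 n); last by rewrite -addnn leq_addr.
  by rewrite -addnn addnK leq_pmull// bin_gt0 leq_addr.
have -> : (2 * dot x x) ^+ n * n`!%:R * Int (rho0 2^-1) =
    Int (rho0 2^-1) * ((2 * dot x x) ^+ n / n`!%:R) * (n`!%:R * n`!%:R).
  have := lt0r_neq0 (f0 n); move: (Int _) (n`!%:R : R) (_ ^+ n) => a b c b0; field.
  exact: b0.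
rewrite ler_wpM2l// mulr_ge0 ?divr_ge0 ?exprn_ge0 ?mulr_ge0 ?dot_ge0//.
by apply: Int_ge0 => y; exact: rho_ge0.
Qed.

(** Dilating by r = w^(-1/2) moves the parameter from the Gaussian into the cosine, whose series is
    integrated termwise; r^(2n) = w^(-n). The moments are integrals of even powers, so the signs are
    those of the cosine series. *)
Lemma series_of0 : exists c, [/\ series_of Pos k x 0 c, (forall n, 0 <= (-1) ^+ n * c n) & c 0 = m1].
Proof.
exists cosc; split; last 2 first.
- by move=> n; rewrite /cosc mulrA -exprMn mulrNN mulr1 expr1n mul1r divr_ge0.
- rewrite /cosc expr0 mul1r double0 fact0 divr1; apply: eq_Int => y.
  by rewrite /dot_mom double0 expr0 mul1r.
split => // w w0; pose r := w `^ (- 2^-1); have r0 : 0 < r by rewrite powR_gt0.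
have r2 : r ^+ 2 = w^-1 by rewrite /r -powR_mulrn ?powR_ge0// -powRrM mulNr mulVf// powR_inv1 ?ltW.
have rs : r ^- 2 = w by rewrite r2 invrK.
have -> : w `^ (- lam) = r `^ homdim by rewrite /r -powRrM; congr (_ `^ _); rewrite mulNr mulrC.
have ccos : continuous (fun y => cos (dot x y)).
  by move=> y; exact: (continuous_comp (@cdot y) (@continuous_cos R _)).
have scos : slow (fun y => cos (dot x y)).
  by apply: (slow_le (slow_cst 1)) => y; rewrite ler_norml cos_geN1 cos_le1.
transitivity (Int (fun y => cos (dot x y) * rho0 (r ^- 2) y)).
  by rewrite rs; apply: eq_Int => y; rewrite /bessel_weight expr0 mulr1.
rewrite (Int_rho_dilate posP kP r0 ccos scos); congr (_ * _).
pose g N y := \sum_(0 <= n < N) ((-1) ^+ n * w^-1 ^+ n / n.*2`!%:R) * (dot_mom n y * rho0 1 y).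
have Lg N : Lint (g N) by apply: Lint_sum => n _; exact: LintZ.
have gE N y : g N y = series (cos_coeff' (r * dot x y)) N * rho0 1 y.
  rewrite /g /series/= mulr_suml; apply: eq_bigr => n _.
  rewrite /cos_coeff' -exprnP exprMn -r2 -exprM mul2n /dot_mom.
  by move: (rho0 1 y) => z; ring.
have [_ Cg] : Lint (fun y => cos (dot x (r *: y)) * rho0 1 y) /\
    Int (g N) @[N --> \oo] --> Int (fun y => cos (dot x (r *: y)) * rho0 1 y).
  apply: (@dct_Int _ _ _ _ (fun y => expR `|r * dot x y| * rho0 1 y)).
  - by move=> N; exact: Lint_mrow.
  - move=> y; under eq_fun do rewrite gE.
    apply: cvgM; last exact: cvg_cst.
    by rewrite dotZr; exact: cvg_cos_coeff'.
  - move=> N y; rewrite gE normrM [X in _ * X]ger0_norm ?rho_ge0//.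
    by rewrite ler_wpM2r ?rho_ge0// cos_partial_le.
  - apply: (Lint_rho_mul posP kP ltr01 (lexx 0)); last exact: slow_expR_dot.
    apply: mrow_continuous => y; apply: continuous_comp; last exact: continuous_expR.
    apply: continuous_comp; last exact: norm_continuous.
    have h : (fun _ : 'rV[R]_d => r) @ y --> r by exact: cst_continuous.
    exact: (cvgM h (@cdot y)).
rewrite -(cvg_lim _ Cg)// /psum; congr (limn _); apply/funext => N.
rewrite /g Int_sum; last by move=> n _; exact: LintZ.
rewrite /pseries /series/=; apply: eq_bigr => n _; rewrite IntZ// /cosc.
by rewrite -/(mom n); move: (mom n) => z; ring.
Qed.

Lemma series_of_1_absurd H : 0 < dunkl_gamma Pos k -> series_of Pos k x 1 H -> False.
Proof.
move=> gam0 [hH EH]; have l0 : 0 < lam by rewrite divr_gt0// ltr_wpDr// mulr_gt0.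
have [c [[hc Ec] c_ge0 c0]] := series_of0; have m0 := Int_rho_gt0 posP kP.
have [hH' EH'] := series_of_pred posP kP (conj hH EH).
set l := lam in l0 EH Ec hH' EH'.
set H' := (fun n => _) in hH' EH'.
(* Phi_0 has two expansions, one by descent from [H] and one from the cosine series; uniqueness of
   coefficients identifies them. *)
have HE n : H' n = c n.
  have hd := exp_typeD hH' (exp_typeZ (-1) hc).
  have : H' n + -1 * c n = 0.
    apply: (psum_eq0 hd) => v v0; rewrite psumD ?psumZ//; last exact: exp_typeZ.
    have w0 : 0 < v^-1 by rewrite invr_gt0.
    have := Ec _ w0; rewrite (EH' _ w0) invrK => /mulfI E.
    by rewrite E ?mulN1r ?subrr// gt_eqF// powR_gt0.
  by rewrite mulN1r => /subr0_eq.
(* These weights satisfy r_(n+1) (lam + n) = r_n, so with alternating signs each H_N cancels between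
   consecutive terms of the weighted sum. *)
pose rr n : R := \prod_(0 <= i < n) (l + i%:R)^-1.
have li i : 0 < l + i%:R by rewrite ltr_wpDr.
have rr_ge0 n : 0 <= rr n by apply: prodr_ge0 => i _; rewrite invr_ge0 ltW.
have tel N : \sum_(0 <= n < N.+1) (-1) ^+ n * rr n * c n = (-1) ^+ N * rr N * H N.
  elim: N => [|N IH]; first by rewrite big_nat1 -HE /H' /= addr0.
  rewrite big_nat_recr//= IH -HE /H' /= /rr big_nat_recr//= -/(rr N) exprS.
  have := lt0r_neq0 (li N); move: (l + N%:R) (H N) (H N.+1) (rr N) ((-1) ^+ N) => a b e f g a0.
  by field.
(* Every term (-1)^n r_n c_n is nonnegative, and the one with n = 0 is [m1]. *)
have lower N : m1 <= rr N * `|H N|.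
  rewrite (@le_trans _ _ ((-1) ^+ N * rr N * H N))//; last first.
    rewrite (le_trans (ler_norm _))// !normrM normrX normrN1 expr1n mul1r.
    by rewrite (ger0_norm (rr_ge0 N)).
  rewrite -tel big_nat_recl//= expr0 mul1r /rr big_geq// mul1r c0 lerDl sumr_ge0// => i _.
  by rewrite mulrAC; exact: (mulr_ge0 (c_ge0 _) (rr_ge0 _)).
have [A [B [A0 B0 HB]]] := hH.
(* Only the factor with i = 0 can exceed 1; the summand 1 covers the empty product. *)
have rr_le N : rr N <= 1 + l^-1.
  have il : 0 < l^-1 by rewrite invr_gt0.
  case: N => [|N]; first by rewrite /rr big_geq// lerDl ltW.
  rewrite (@le_trans _ _ l^-1)//; last by rewrite lerDr.
  elim: N => [|N IH]; first by rewrite /rr big_nat1 addr0.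
  rewrite /rr big_nat_recr//= -/(rr N.+1) (le_trans _ IH)// ler_piMr//.
  by rewrite invf_le1// -natr1 addrA lerDr addr_ge0// ltW.
have upper N : m1 <= (1 + l^-1) * A * exp_coeff B N.
  rewrite (le_trans (lower N))// -mulrA ler_pM//.
have C0 : (1 + l^-1) * A * exp_coeff B N @[N --> \oo] --> (1 + l^-1) * A * 0.
  by apply: cvgM; [exact: cvg_cst|apply: cvg_series_cvg_0; exact: is_cvg_series_exp_coeff].
rewrite mulr0 in C0.
have h : m1 <= limn (fun N => (1 + l^-1) * A * exp_coeff B N).
  by apply: limr_ge; [exact: cvgP C0|exact: nearW].
by rewrite (cvg_lim (@Rhausdorff R) C0) leNgt m0 in h.
Qed.

Lemma series_of_absurd p H : 0 < dunkl_gamma Pos k -> series_of Pos k x p.+1 H -> False.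
Proof.
move=> gam0; elim: p H => [|p IH] H; first exact: series_of_1_absurd.
by move=> /(series_of_pred posP kP)/IH.
Qed.

End contradiction.

Lemma compactly_supported_bounded (R : realType) (d : nat) (g : 'rV[R]_d -> R[i]) :
  compactly_supported g -> exists2 B, 0 <= B & forall t, B < dot t t -> g t = 0.
Proof.
move=> cg; have cd : {within closure [set t | g t != 0], continuous (fun t : 'rV[R]_d => dot t t : R^o)}.
  by apply: continuous_subspaceT => t; exact: continuous_sqr_norm.
have [M [_ HM]] := compact_bounded (continuous_compact cd cg).
exists (Num.max M 0 + 1); first by rewrite addr_ge0// le_max lexx orbT.
move=> t; apply: contraTeq => gt0; rewrite -leNgt.
have MM : M < Num.max M 0 + 1 by rewrite ltr_pwDr// le_max lexx.
have := HM _ MM (dot t t); rewrite /= ger0_norm ?dot_ge0//; apply.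
by exists t => //; exact: subset_closure.
Qed.

Theorem mainTheorem1 (R : realType) (d : nat) (d_ge1 : (1 <= d)%N)
    (Phi Pos : {fset 'rV[R]_d}) (k : 'rV[R]_d -> R)
    (K : 'rV[R[i]]_d -> 'rV[R[i]]_d -> R[i])
    (E : set 'rV[R]_d) (x : 'rV[R]_d) (p : int) :
  root_system Phi -> normalized Phi -> positive_subsystem Phi Pos ->
  multiplicity_function Phi k -> 0 < dunkl_gamma Pos k ->
  dunkl_kernel Pos k K ->
  invariant_set Phi E -> compact E ->
  convex_set (E : set (convex_lmodType 'rV[R]_d)) ->
  E x ->
  dunkl_gamma Pos k + d%:R / 2 + 1 <= p%:~R ->
  ~ compactly_supported (F_x Pos k K p x).
Proof.
move=> rootP normP posP kP gam0 dK _ _ _ _ hp.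
(* The lower bound on [p] is positive and excludes zero and negative integers; [p.+1] is the form
   from which the descent starts. *)
case: p hp => [[|p]|p] hp.
- move: hp; rewrite leNgt => /negP[].
  by rewrite ltr_pwDr// addr_ge0 ?divr_ge0// ltW.
- move=> /compactly_supported_bounded[B B0 HB].
  have hp' : (2 * dunkl_gamma Pos k + d%:R) / 2 + 1 <= p.+1%:R.
    by move: hp; rewrite -pmulrn; move: (dunkl_gamma _ _) (d%:R : R) (p.+1%:R : R) => a b c; lra.
  have supp t : B < dot t t -> transform_re Pos k K p.+1 x t = 0.
    by move=> /HB; rewrite -(Re_F_x rootP normP posP kP dK) => ->.
  have [H] := series_of_transform rootP normP posP kP dK hp' B0 supp.
  exact: (series_of_absurd posP kP).
- move: hp; rewrite leNgt => /negP[]; apply: (@lt_trans _ _ 0); first by rewrite ltrz0.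
  by rewrite ltr_pwDr// addr_ge0 ?divr_ge0// ltW.
Qed.
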